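(* Let $A_S$ be an Artin group with presentation graph $\Gamma_S$, and let $X, Y\subseteq S$, $Z=X\cap Y$, be such that $A_S=A_X*_{A_Z}A_Y$ is a non-trivial visual splitting. Assume further that there exist Artin groups $A_{X'}$ and $A_{Y'}$, each having the parabolic intersection property and the ribbon property, that contain $A_X$ and $A_Y$ respectively as special subgroups (i.e. $X\subseteq X'$ with $\Gamma_X$ the induced labelled subgraph of $\Gamma_{X'}$ on $X$, and likewise $Y\subseteq Y'$). Then $A_S=A_X*_{A_Z}A_Y$ is a non-elementary acylindrical splitting if and only if the neighbourhoods $N_{\Gamma_X}(X\setminus Z)$ and $N_{\Gamma_Y}(Y\setminus Z)$ are not connected by an odd labelled path in $\Gamma_S$.
   Context: **Artin groups.** Let $\Gamma_S$ be a finite simple graph with vertex set $S$, each edge $\{u,v\}$ labelled by an integer $m_{uv}\ge 2$. The Artin group with presentation graph $\Gamma_S$ is $A_S=\langle S\mid \underbrace{uvu\cdots}_{m_{uv}}=\underbrace{vuv\cdots}_{m_{uv}},\ \{u,v\}\in E(\Gamma_S)\rangle$. For $X\subseteq S$, $\Gamma_X$ is the induced labelled subgraph, and the special subgroup $A_X$ is the subgroup generated by $X$ (it is naturally the Artin group of $\Gamma_X$, by van der Lek). A parabolic subgroup is a conjugate of a special subgroup. $A_S$ is spherical if its Coxeter group (add the relations $s^2=1$, $s\in S$) is finite. **Graph conventions.** $N_\Gamma(v)$ is $v$ together with all vertices adjacent to $v$ in $\Gamma$; for a set $A$ of vertices, $N_\Gamma(A)=\bigcup_{v\in A}N_\Gamma(v)$.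 An odd labelled path is a path all of whose edges have odd labels. Two sets of vertices are connected (joined) by such a path if one exists from a vertex of the first set to a vertex of the second; paths of length zero are allowed, so intersecting sets are connected. **Visual splittings.** A visual splitting of $A_S$ is an amalgam decomposition $A_S=A_X*_{A_Z}A_Y$ with $X,Y\subseteq S$, $X\cup Y=S$, $Z=X\cap Y$ (it exists exactly when no edge of $\Gamma_S$ joins $X\setminus Z$ to $Y\setminus Z$). It is non-trivial if $A_X\ne A_S\ne A_Y$. **Acylindricity.** An action of a group $G$ on a simplicial tree $T$ (by simplicial isometries, without inversions) is acylindrical if there are integers $k\ge0$, $C>0$ such that the pointwise stabiliser of every edge path of length at least $k$ has at most $C$ elements. A splitting is a non-elementary acylindrical splitting if the action on its Bass--Serre tree is acylindrical with no global fixed point and no invariant line. **Parabolic intersection property (PIP).** $A_S$ has PIP if the intersection of any two parabolic subgroups of $A_S$ is parabolic. **Ribbon property (RP).** The Dynkin diagram $\overline\Gamma_S$ has vertex set $S$, with $u,v$ adjacent iff either $\{u,v\}\in E(\Gamma_S)$ with $m_{uv}>2$, or $\{u,v\}\notin E(\Gamma_S)$. For $X\subseteq S$, the irreducible components of $X$ are the vertex sets of the connected components of $\overline\Gamma_X$; $X_s$ (resp. $X_{as}$) is the union of those irreducible components $U$ with $A_U$ spherical (resp. non-spherical). Put $X^\perp=\{s\in S:\ \{s,t\}\in E(\Gamma_S)\text{ and } m_{st}=2\ \text{for all } t\in X\}$ (so $\emptyset^\perp=S$), and $X_{as}^\perp=(X_{as})^\perp$. If $A_U$ is spherical, $\Delta_U$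 is the least common multiple of $U$ in the positive monoid $A_U^+$ with respect to left divisibility ($\Delta_\emptyset=1$). For $X,Y\subseteq S$, an element $g\in A_S$ is an elementary $(X,Y)$-ribbon if $gXg^{-1}=Y$ and there is $t\in S\setminus X$ such that the vertex set $U$ of the connected component of $\overline\Gamma_{X\cup\{t\}}$ containing $t$ generates a spherical subgroup and $g=\Delta_U^{-1}\Delta_{U\setminus\{t\}}$. Let $\operatorname{Conj}(S)$ be the groupoid whose objects are the subsets of $S$ and whose morphisms $X\to Y$ are the $g\in A_S$ with $gXg^{-1}=Y$, and let $\operatorname{Ribb}(S)$ be the smallest subgroupoid with the same objects containing all elementary ribbons; $\operatorname{Ribb}(S;X,Y)$ is the set of its morphisms $X\to Y$. For $S'\subseteq S$, $\operatorname{Ribb}(S';\cdot,\cdot)\subseteq A_{S'}$ is the same notion for $A_{S'}$. $A_S$ has RP if for all $X,Y\subseteq S$ and $g\in A_S$: $gA_Xg^{-1}\subseteq A_Y$ if and only if $X_{as}\subseteq Y$ and $g\in A_Y\cdot\operatorname{Ribb}(X_{as}^\perp;X_s,R)$ for some $R\subseteq Y$ (with $R\subseteq X_{as}^\perp$). *)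

(* Defs.v *)
From HB Require Import structures.
From mathcomp Require Import all_boot all_order ssralg ssrint.
From mathcomp Require Import boolp classical_sets functions cardinality.

Set Implicit Arguments.
Unset Strict Implicit.
Unset Printing Implicit Defensive.

Local Open Scope group_scope.
Local Open Scope quotient_scope.

Section Congruence.
Context {A : Type} (R : seq A -> seq A -> Prop).

(* Least congruence on the free monoid [seq A] containing [R]. *)
Inductive cong : seq A -> seq A -> Prop :=
| cong_rel l r u v : R u v -> cong (l ++ u ++ r) (l ++ v ++ r)
| cong_refl u : cong u u
| cong_sym u v : cong u v -> cong v u
| cong_trans u v w : cong u v -> cong v w -> cong u w.

Lemma cong_cat u u' v v' : cong u u' -> cong v v' -> cong (u ++ v) (u' ++ v').
Proof.
move=> hu hv; apply: (@cong_trans _ (u' ++ v)).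
  elim: hu => {u u'} [l r u u' h|u|u u' _|u u' w _ ih1 _ ih2].
  - by rewrite -!catA; exact: cong_rel.
  - exact: cong_refl.
  - exact: cong_sym.
  - exact: cong_trans ih1 ih2.
elim: hv => {v v'} [l r v v' h|v|v v' _|v v' w _ ih1 _ ih2].
- by rewrite !(catA u'); exact: cong_rel.
- exact: cong_refl.
- exact: cong_sym.
- exact: cong_trans ih1 ih2.
Qed.

End Congruence.

Section PresentedMonoid.
Context (A : choiceType) (R : seq A -> seq A -> Prop).

Definition congb (u v : seq A) : bool := `[< cong R u v >].

Lemma congb_equiv : equiv_class_of congb.
Proof.
split=> [u|u v|v u w].
- by apply/asboolP; exact: cong_refl.
- by apply/asboolP/asboolP; exact: cong_sym.
- by move=> /asboolP h1 /asboolP h2; apply/asboolP; exact: cong_trans h1 h2.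
Qed.

Canonical congb_equiv_rel := EquivRelPack congb_equiv.

Definition presented := {eq_quot congb}.
HB.instance Definition _ := Choice.on presented.
HB.instance Definition _ := Quotient.on presented.

Definition word_class (u : seq A) : presented := \pi_presented u.

Lemma word_classP u v : word_class u = word_class v <-> cong R u v.
Proof. by split=> [/eqmodP/asboolP|h]; [|apply/eqmodP/asboolP]. Qed.

Lemma repr_cong u : cong R (repr (word_class u)) u.
Proof. by apply/word_classP; rewrite /word_class reprK. Qed.

Definition pmul (x y : presented) : presented := word_class (repr x ++ repr y).
Definition pone : presented := word_class [::].

Lemma pmul_class u v : pmul (word_class u) (word_class v) = word_class (u ++ v).
Proof. by apply/word_classP; apply: cong_cat; exact: repr_cong. Qed.

Lemma word_classW (P : presented -> Prop) : (forall u, P (word_class u)) -> forall x, P x.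
Proof. by move=> h x; rewrite -[x]reprK; exact: h. Qed.

Lemma pmulA : associative pmul.
Proof.
elim/word_classW=> u; elim/word_classW=> v; elim/word_classW=> w.
by rewrite !pmul_class catA.
Qed.

Lemma pmul1g : left_id pone pmul.
Proof. by elim/word_classW=> u; rewrite pmul_class. Qed.

Lemma pmulg1 : right_id pone pmul.
Proof. by elim/word_classW=> u; rewrite pmul_class cats0. Qed.

End PresentedMonoid.

Definition presented_monoid (A : choiceType) (R : seq A -> seq A -> Prop) :=
  presented R.
HB.instance Definition _ A R := Choice.on (@presented_monoid A R).
HB.instance Definition _ A R := isMonoid.Build (@presented_monoid A R)
  (@pmulA A R) (@pmul1g A R) (@pmulg1 A R).

Section PresentedGroup.
Context (A : choiceType) (R : seq A -> seq A -> Prop).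

(* The letter [(a, true)] stands for the generator [a] and [(a, false)] for its
   inverse.  All the relators needed below are equalities of positive words. *)
Definition positive (u : seq A) : seq (A * bool) := [seq (a, true) | a <- u].

Inductive group_rel : seq (A * bool) -> seq (A * bool) -> Prop :=
| group_rel_pos u v : R u v -> group_rel (positive u) (positive v)
| group_rel_cancel a b : group_rel [:: (a, b); (a, ~~ b)] [::].

Definition presented_group := presented group_rel.

Definition winv (u : seq (A * bool)) := rev [seq (x.1, ~~ x.2) | x <- u].

Lemma winvK : involutive winv.
Proof.
move=> u; rewrite /winv map_rev revK -map_comp -[RHS]map_id.
by apply: eq_map => -[a b] /=; rewrite negbK.
Qed.

Lemma cong_winvr u : cong group_rel (u ++ winv u) [::].
Proof.
elim: u => [|[a b] u ih]; first exact: cong_refl.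
have -> : ((a, b) :: u) ++ winv ((a, b) :: u)
          = [:: (a, b)] ++ (u ++ winv u) ++ [:: (a, ~~ b)].
  by rewrite /winv /= rev_cons -cats1 catA.
apply: (@cong_trans _ _ _ ([:: (a, b)] ++ [::] ++ [:: (a, ~~ b)])).
  apply: cong_cat; first exact: cong_refl.
  by apply: cong_cat; [exact: ih | exact: cong_refl].
have := @cong_rel _ group_rel [::] [::] _ _ (group_rel_cancel a b); exact.
Qed.

Lemma cong_winvl u : cong group_rel (winv u ++ u) [::].
Proof. by rewrite -{2}[u]winvK; exact: cong_winvr. Qed.

Lemma cong_winv u v : cong group_rel u v -> cong group_rel (winv u) (winv v).
Proof.
move=> h; apply: (@cong_trans _ _ _ (winv u ++ (v ++ winv v))).
  rewrite -{1}[winv u]cats0; apply: cong_cat; first exact: cong_refl.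
  by apply: cong_sym; exact: cong_winvr.
rewrite catA -{2}[winv v]cat0s; apply: cong_cat; last exact: cong_refl.
apply: (@cong_trans _ _ _ (winv u ++ u)); last exact: cong_winvl.
by apply: cong_cat; [exact: cong_refl | exact: cong_sym].
Qed.

Definition pinv (x : presented_group) : presented_group :=
  word_class group_rel (winv (repr x)).

Lemma pinv_class u : pinv (word_class group_rel u) = word_class group_rel (winv u).
Proof. by apply/word_classP; apply: cong_winv; exact: repr_cong. Qed.

Lemma pmulVg : left_inverse (@pone _ group_rel) pinv (@pmul _ group_rel).
Proof.
elim/word_classW=> u; rewrite pinv_class pmul_class.
by apply/word_classP; exact: cong_winvl.
Qed.

Lemma pmulgV : right_inverse (@pone _ group_rel) pinv (@pmul _ group_rel).
Proof.
elim/word_classW=> u; rewrite pinv_class pmul_class.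
by apply/word_classP; exact: cong_winvr.
Qed.

End PresentedGroup.

HB.instance Definition _ A R := Choice.on (@presented_group A R).
HB.instance Definition _ A R := isGroup.Build (@presented_group A R)
  (@pmulA _ (group_rel R)) (@pmul1g _ (group_rel R)) (@pmulg1 _ (group_rel R))
  (@pmulVg A R) (@pmulgV A R).

(* [label] is only meaningful on edges. *)
Record lgraph (S : finType) := LGraph {
  edge : rel S;
  label : S -> S -> nat;
  edge_sym : symmetric edge;
  edge_irr : irreflexive edge;
  label_sym : forall u v, edge u v -> label u v = label v u;
  label_ge2 : forall u v, edge u v -> 2 <= label u v
}.

Definition induced (S : finType) (G : lgraph S) (X : {set S}) :
  lgraph {x : S | x \in X} :=
  @LGraph {x : S | x \in X}
    (fun u v => edge G (val u) (val v)) (fun u v => label G (val u) (val v))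
    (fun u v => edge_sym G (val u) (val v)) (fun u => edge_irr G (val u))
    (fun u v => @label_sym _ G (val u) (val v))
    (fun u v => @label_ge2 _ G (val u) (val v)).

(* The alternating word [u v u ...] with [n] letters. *)
Fixpoint alternating (T : Type) (u v : T) (n : nat) : seq T :=
  if n is n'.+1 then u :: alternating v u n' else [::].

Section Groups.
Context (S : finType) (G : lgraph S).

Inductive artin_rel : seq S -> seq S -> Prop :=
| ArtinRel u v : edge G u v ->
    artin_rel (alternating u v (label G u v)) (alternating v u (label G u v)).

Inductive coxeter_rel : seq S -> seq S -> Prop :=
| CoxeterArtin u v : artin_rel u v -> coxeter_rel u v
| CoxeterSquare s : coxeter_rel [:: s; s] [::].

Definition artin : groupType := presented_group artin_rel.
Definition coxeter : groupType := presented_group coxeter_rel.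
Definition artin_monoid : monoidType := presented_monoid artin_rel.

Definition artin_gen (s : S) : artin := word_class _ [:: (s, true)].
Definition monoid_gen (s : S) : artin_monoid := word_class _ [:: s].

(* The canonical morphism from the Artin monoid to the Artin group; it does not
   depend on the chosen representative word. *)
Definition of_monoid (x : artin_monoid) : artin :=
  word_class _ (positive (repr (x : presented artin_rel))).

Definition spherical : Prop := finite_set [set: coxeter]%classic.

End Groups.

Definition is_subgroup (H : groupType) (B : set H) : Prop :=
  [/\ B 1, (forall x y, B x -> B y -> B (x * y)) & (forall x, B x -> B x^-1)].

Definition is_submonoid (M : monoidType) (B : set M) : Prop :=
  B 1 /\ (forall x y, B x -> B y -> B (x * y)).

Definition conj_set (H : groupType) (g : H) (B : set H) : set H :=
  [set g * x * g^-1 | x in B]%classic.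

Section Special.
Context (S : finType) (G : lgraph S).

Definition gens (X : {set S}) : set (artin G) :=
  [set artin_gen G x | x in [set` X]]%classic.

Definition special (X : {set S}) : set (artin G) :=
  smallest (@is_subgroup (artin G)) (gens X).

Definition parabolic (P : set (artin G)) : Prop :=
  exists (X : {set S}) (g : artin G), P = conj_set g (special X).

Definition PIP : Prop :=
  forall P Q, parabolic P -> parabolic Q -> parabolic (P `&` Q)%classic.

End Special.

Arguments gens [S] G X.
Arguments special [S] G X.

Section Ribbons.
Context (S : finType) (G : lgraph S).

Definition dynkin : rel S :=
  fun u v => (u != v) && ((edge G u v && (2 < label G u v)) || ~~ edge G u v).

(* Vertex set of the connected component of [x] in the subgraph of the Dynkin
   diagram induced on [X]. *)
Definition component (X : {set S}) (x : S) : {set S} :=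
  [set y in X | connect [rel u v | [&& u \in X, v \in X & dynkin u v]] x y]%SET.

Definition spherical_part (X : {set S}) : {set S} :=
  [set x in X | `[< spherical (induced G (component X x)) >]]%SET.

Definition nonspherical_part (X : {set S}) : {set S} :=
  [set x in X | ~~ `[< spherical (induced G (component X x)) >]]%SET.

Definition perp (X : {set S}) : {set S} :=
  [set s | [forall t in X, edge G s t && (label G s t == 2)]]%SET.

Definition positive_special (U : {set S}) : set (artin_monoid G) :=
  smallest (@is_submonoid (artin_monoid G))
    [set monoid_gen G x | x in [set` U]]%classic.

Definition left_divides (U : {set S}) (a b : artin_monoid G) : Prop :=
  exists2 c, positive_special U c & b = a * c.

(* [d] is the element Delta_U, the left-divisibility lcm of [U] in A_U^+. *)
Definition is_delta (U : {set S}) (d : artin_monoid G) : Prop :=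
  [/\ positive_special U d,
      forall u, u \in U -> left_divides U (monoid_gen G u) d &
      forall e, positive_special U e ->
        (forall u, u \in U -> left_divides U (monoid_gen G u) e) ->
        left_divides U d e].

(* In the next two definitions [W] is the ambient set of generators: these are
   the ribbons of the special subgroup A_W, and [W = [set: S]] gives those of
   the whole Artin group.  A morphism [X -> Y] is a [g] with g X g^-1 = Y, so
   the composite of [g : X -> Y] and [h : Y -> T] is [h * g]. *)
Definition elementary_ribbon (W X Y : {set S}) (g : artin G) : Prop :=
  [/\ X \subset W, Y \subset W, conj_set g (gens G X) = gens G Y &
      exists t, let U := component (t |: X)%SET t in
        [/\ t \in (W :\: X)%SET, spherical (induced G U) &
            exists d e, [/\ is_delta U d, is_delta (U :\ t)%SET e &
              g = (of_monoid d)^-1 * of_monoid e]]].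

Inductive ribb (W : {set S}) : {set S} -> {set S} -> artin G -> Prop :=
| ribb_elementary (X Y : {set S}) g : elementary_ribbon W X Y g -> ribb W X Y g
| ribb_id (X : {set S}) : X \subset W -> ribb W X X 1
| ribb_comp (X Y T : {set S}) g h : ribb W X Y g -> ribb W Y T h -> ribb W X T (h * g)
| ribb_inv (X Y : {set S}) g : ribb W X Y g -> ribb W Y X g^-1.

Definition RP : Prop :=
  forall (X Y : {set S}) (g : artin G),
    (conj_set g (special G X) `<=` special G Y)%classic <->
    nonspherical_part X \subset Y /\
    exists R : {set S},
      [/\ R \subset Y, R \subset perp (nonspherical_part X) &
          exists y r, [/\ special G Y y,
            ribb (perp (nonspherical_part X)) (spherical_part X) R r &
            g = y * r]].

End Ribbons.

Section GraphNotions.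
Context (S : finType) (G : lgraph S).

Definition nbhd (B : {set S}) : {set S} :=
  [set v | [exists b in B, (v == b) || edge G b v]]%SET.

Definition odd_edge : rel S := fun u v => edge G u v && odd (label G u v).

Definition odd_connected (B C : {set S}) : Prop :=
  exists u v, [/\ u \in B, v \in C & connect odd_edge u v].

End GraphNotions.

(* For [B] contained in [X], the neighbourhood of [B] in the induced graph on
   [X], as a set of vertices of [G]. *)
Definition induced_nbhd (S : finType) (G : lgraph S) (X B : {set S}) : {set S} :=
  [set val v | v in nbhd (induced G X) [set x | val x \in B]]%SET.

(* [A_X] is a special subgroup of the Artin group of [G']: the labelled graph
   induced on [X] is, up to renaming vertices by [i], an induced labelled
   subgraph of [G']. *)
Definition contained_as_special (S : finType) (G : lgraph S) (X : {set S})
    (S' : finType) (G' : lgraph S') : Prop :=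
  exists i : {x : S | x \in X} -> S',
    [/\ injective i,
        forall u v, edge G' (i u) (i v) = edge (induced G X) u v &
        forall u v, edge (induced G X) u v ->
          label G' (i u) (i v) = label (induced G X) u v].

Definition hom_on (H T : groupType) (B : set H) (f : H -> T) : Prop :=
  forall x y, B x -> B y -> f (x * y) = f x * f y.

(* [H] is the amalgamated product of its subgroups [B] and [C] over their common
   subgroup [D], i.e. the pushout of the inclusions of [D]; homomorphisms defined
   on a subgroup are given as restrictions of functions on [H]. *)
Definition is_amalgam (H : groupType) (B C D : set H) : Prop :=
  [/\ is_subgroup B, is_subgroup C, is_subgroup D, (D `<=` B `&` C)%classic &
      forall (T : groupType) (f k : H -> T),
        hom_on B f -> hom_on C k -> (forall x, D x -> f x = k x) ->
        exists! h : H -> T,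
          [/\ hom_on setT h, forall x, B x -> h x = f x &
              forall x, C x -> h x = k x]].

Definition visual_splitting (S : finType) (G : lgraph S) (X Y : {set S}) : Prop :=
  (X :|: Y)%SET = [set: S]%SET /\
  is_amalgam (special G X) (special G Y) (special G (X :&: Y)%SET).

Definition nontrivial_visual_splitting (S : finType) (G : lgraph S)
    (X Y : {set S}) : Prop :=
  [/\ visual_splitting G X Y, special G X <> setT & special G Y <> setT].

(* An action without inversions on a graph.  Being a tree is not part of the
   record; [bass_serre] below is a tree when it comes from an amalgam. *)
Record graph_action (H : groupType) := GraphAction {
  vertex : Type;
  adj : vertex -> vertex -> Prop;
  act : H -> vertex -> vertex;
  adj_sym : forall v w, adj v w -> adj w v;
  act1 : forall v, act 1 v = v;
  actM : forall g h v, act (g * h) v = act g (act h v);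
  act_adj : forall g v w, adj v w -> adj (act g v) (act g w);
  no_inversion : forall g v w, adj v w -> ~ (act g v = w /\ act g w = v)
}.

Section GraphAction.
Context (H : groupType) (a : graph_action H).

(* Edge paths must not backtrack: otherwise a single edge would carry arbitrarily
   long paths.  In a tree, having distinct vertices is the same as being reduced. *)
Definition edge_path (n : nat) (p : nat -> vertex a) : Prop :=
  (forall i, i < n -> adj (p i) (p i.+1)) /\
  (forall i j, i <= n -> j <= n -> p i = p j -> i = j).

Definition path_stabiliser (n : nat) (p : nat -> vertex a) : set H :=
  [set g | forall i, i <= n -> act g (p i) = p i]%classic.

Definition acylindrical : Prop :=
  exists k C : nat, 0 < C /\
    forall n p, k <= n -> edge_path n p -> (path_stabiliser n p #<= `I_C)%card.

Definition has_global_fixpoint : Prop := exists v : vertex a, forall g, act g v = v.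

Definition has_invariant_line : Prop :=
  exists l : int -> vertex a,
    [/\ injective l, forall n, adj (l n) (l (n + 1)%R) &
        forall g n, exists m, act g (l n) = l m].

Definition non_elementary_acylindrical : Prop :=
  [/\ acylindrical, ~ has_global_fixpoint & ~ has_invariant_line].

End GraphAction.

Definition translate (H : groupType) (g : H) (B : set H) : set H :=
  [set g * x | x in B]%classic.

Definition lcoset (H : groupType) (B : set H) : Type :=
  {E : set H | exists g, E = translate g B}.

Section BassSerre.
Context (H : groupType) (B C D : set H).

Lemma translate1 (E : set H) : translate 1 E = E.
Proof.
rewrite /translate -[RHS]image_id; apply: eq_imagel => x _; exact: mul1g.
Qed.

Lemma translateM g h (E : set H) :
  translate (g * h) E = translate g (translate h E).
Proof.
by rewrite /translate image_comp; apply: eq_imagel => x _; rewrite /= mulgA.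
Qed.

Lemma lcoset_move_subproof (E0 : set H) g (E : lcoset E0) :
  exists h, translate g (sval E) = translate h E0.
Proof. by case: E => E [h eE]; exists (g * h); rewrite /= eE translateM. Qed.

Definition lcoset_move (E0 : set H) (g : H) (E : lcoset E0) : lcoset E0 :=
  exist _ (translate g (sval E)) (lcoset_move_subproof g E).

Lemma lcoset_eq (E0 : set H) (E F : lcoset E0) : sval E = sval F -> E = F.
Proof.
case: E F => [E hE] [F hF] /= eEF; subst F.
by congr exist; exact: Prop_irrelevance.
Qed.

(* The vertices are the left cosets of [B] and of [C] (tagged by their type), and
   the edges are the left cosets of [D], each one joining the left cosets of [B]
   and [C] which contain it. *)
Definition bs_vertex : Type := (lcoset B + lcoset C)%type.

Definition bs_joined (E : lcoset B) (F : lcoset C) : Prop :=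
  exists K : lcoset D, (sval K `<=` sval E `&` sval F)%classic.

Definition bs_adj (v w : bs_vertex) : Prop :=
  match v, w with
  | inl E, inr F | inr F, inl E => bs_joined E F
  | _, _ => False
  end.

Definition bs_move (g : H) (v : bs_vertex) : bs_vertex :=
  match v with
  | inl E => inl (lcoset_move g E)
  | inr F => inr (lcoset_move g F)
  end.

Lemma bs_adj_sym v w : bs_adj v w -> bs_adj w v.
Proof. by case: v w => [E|F] [E'|F']. Qed.

Lemma bs_move1 v : bs_move 1 v = v.
Proof. by case: v => E /=; congr (_ _); apply: lcoset_eq; exact: translate1. Qed.

Lemma bs_moveM g h v : bs_move (g * h) v = bs_move g (bs_move h v).
Proof. by case: v => E /=; congr (_ _); apply: lcoset_eq; exact: translateM. Qed.

Lemma bs_joined_move g E F :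
  bs_joined E F -> bs_joined (lcoset_move g E) (lcoset_move g F).
Proof.
move=> [K sK]; exists (lcoset_move g K) => _ [x Kx <-] /=.
by have [Ex Fx] := sK _ Kx; split; exists x.
Qed.

Lemma bs_move_adj g v w : bs_adj v w -> bs_adj (bs_move g v) (bs_move g w).
Proof. by case: v w => [E|F] [E'|F'] //=; exact: bs_joined_move. Qed.

Lemma bs_no_inversion g v w :
  bs_adj v w -> ~ (bs_move g v = w /\ bs_move g w = v).
Proof. by case: v w => [E|F] [E'|F'] //= _ []. Qed.

Definition bass_serre : graph_action H :=
  GraphAction bs_adj_sym bs_move1 bs_moveM bs_move_adj bs_no_inversion.

End BassSerre.

Definition non_elementary_acylindrical_splitting (H : groupType)
    (B C D : set H) : Prop :=
  non_elementary_acylindrical (bass_serre B C D).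

(* Main.v *)
(** The Artin group A_S acts on pairs (minimal coset representative of W modulo W_X,
    element of A_X), following the retraction of Charney and Paris; the Tits
    representation shows that the braid relations hold.  This gives the injectivity
    of A_X -> A_S (van der Lek) and A_X meets A_Y in A_Z.

    If neither neighbourhood is reached from the other, consider three consecutive
    edges of the Bass-Serre tree: up to translation their fixer is the intersection of
    A_Z, x A_Z x^-1 and y A_Z y^-1 with x in A_X, y in A_Y, both outside A_Z.  It is
    parabolic, so if it is non-trivial it contains a conjugate, by an element of A_Z, of
    some generator k in Z.  Then k is conjugated into A_Z by an element of A_X outside
    A_Z.  By the ribbon property this element is a product of dihedral ribbons; its
    retraction leaves Z only at a vertex adjacent to X \ Z and joined to k by an odd
    path.  The same holds on the side of Y.

    Conversely, if v in Z has a neighbour x outside Y, w in Z has a neighbour y outside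
    X, and g in A_Z conjugates v to w, then v fixes the axis of the product of
    Delta_{vx}^2 and g^-1 Delta_{wy}^2 g. *)

From HB Require Import structures.
From mathcomp Require Import all_boot all_order all_algebra.
From mathcomp Require Import boolp classical_sets functions cardinality.
From mathcomp Require Import reals Rstruct trigo.
From mathcomp Require Import zify ring lra.
Require Import Defs.

Set Implicit Arguments.
Unset Strict Implicit.
Unset Printing Implicit Defensive.

Import Order.TTheory GRing.Theory Num.Theory.

(** PIP and RP are given for the two ambient groups, not for A_S, so each use of them passes through
    the injection [artin_map]; intersections obtained from X and from Y can be compared because
    their conjugators are chosen in A_Z. The amalgam is given by its universal property, so facts
    about it come from homomorphisms built by that property: one into a semidirect product with
    boolean functions, one into the Artin group whose graph has lost the edges across the splitting.
    Elements of the Coxeter group are represented by the linear maps [actw l], and minimality in a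
    coset by positivity on simple roots. The retraction is no homomorphism, but it is the identity
    on A_X, and comparing it with length detects elements outside A_X: Delta_{wy}^2 has length 2m
    and retracts to w^2, of length 2, while m >= 2. Squares are taken because Delta^2 commutes with
    both generators even when m is odd. Acylindricity holds with k = 3 and C = 1, that is, with
    trivial fixers. *)

Local Open Scope ring_scope.

(** * The Tits representation *)

Section Chebyshev.
Context (R : realType).
Implicit Types c : R.

Fixpoint cheb (c : R) (n : nat) : R * R :=
  if n is n'.+1 then let: (p, q) := cheb c n' in (q, c * q - p) else (0, 1).

(* [U c n] is sin (n * theta) / sin theta for c = 2 cos theta, and n for c = 2. *)
Definition U (c : R) (n : nat) : R := (cheb c n).1.

Lemma U0 c : U c 0 = 0. Proof. by []. Qed.
Lemma U1 c : U c 1 = 1. Proof. by []. Qed.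
Lemma USS c n : U c n.+2 = c * U c n.+1 - U c n.
Proof. by rewrite /U /=; case: (cheb c n). Qed.

Lemma U2E n : U (2 : R) n = n%:R.
Proof.
suff: U 2 n = n%:R /\ U 2 n.+1 = n.+1%:R by case.
elim: n => [|n [IH1 IH2]] //.
split => //; rewrite USS IH1 IH2 -!natr1; lra.
Qed.

Definition ccos (m : nat) : R := 2 * cos (pi / m%:R).

Lemma U_ccos m n : (1 < m)%N ->
  U (ccos m) n = sin (n%:R * (pi / m%:R)) / sin (pi / m%:R).
Proof.
move=> m1.
have s0 : 0 < sin (pi / m%:R : R).
  apply: sin_gt0_pi; rewrite divr_gt0 ?pi_gt0 ?ltr0n 1?ltnW //=.
  by rewrite ltr_pdivrMr ?ltr0n 1?ltnW // -[ltLHS]mulr1 ltr_pM2l ?pi_gt0 // ltr1n.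
set th := pi / m%:R in s0 *.
suff: U (ccos m) n = sin (n%:R * th) / sin th /\
      U (ccos m) n.+1 = sin (n.+1%:R * th) / sin th by case.
elim: n => [|n [IH1 IH2]].
  by split; rewrite ?U0 ?U1 ?mul0r ?sin0 ?mul0r // mul1r divff // gt_eqF.
split => //; rewrite USS IH1 IH2 /ccos -/th.
have -> : n.+2%:R * th = n.+1%:R * th + th :> R by rewrite -natr1; ring.
have -> : n%:R * th = n.+1%:R * th - th :> R by rewrite -natr1; ring.
rewrite sinB sinD; field; exact: lt0r_neq0.
Qed.

Lemma U_ccos_gt0 m n : (1 < m)%N -> (0 < n < m)%N -> 0 < U (ccos m) n.
Proof.
move=> m1 /andP[n0 nm]; rewrite U_ccos //.
have m0 : 0 < m%:R :> R by rewrite ltr0n ltnW.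
have h k : (0 < k < m)%N -> 0 < sin (k%:R * (pi / m%:R) : R).
  move=> /andP[k0 km]; apply: sin_gt0_pi; apply/andP; split.
    by apply: mulr_gt0; [rewrite ltr0n | rewrite divr_gt0 ?pi_gt0].
  rewrite mulrA ltr_pdivrMr // mulrC ltr_pM2l ?pi_gt0 //.
  by rewrite ltr_nat.
apply: divr_gt0; first by apply: h; rewrite n0.
by have := h 1%N; rewrite mul1r; apply.
Qed.

Lemma U_ccos_m m : (1 < m)%N -> U (ccos m) m = 0.
Proof.
move=> m1; rewrite U_ccos // mulrCA divff ?mulr1 ?sinpi ?mul0r //.
by rewrite pnatr_eq0 -lt0n ltnW.
Qed.

Lemma U_ccos_m1 m : (1 < m)%N -> U (ccos m) m.-1 = 1.
Proof.
move=> m1; rewrite U_ccos //.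
have m0 : m%:R != 0 :> R by rewrite pnatr_eq0 -lt0n ltnW.
have -> : m.-1%:R * (pi / m%:R) = pi - pi / m%:R :> R.
  rewrite -subn1 natrB 1?ltnW // mulrBl mul1r mulrCA divff // mulr1 //.
have := U_ccos_gt0 m1 (n := 1) m1; rewrite U_ccos // mul1r => h.
rewrite sinB sinpi cospi mul0r sub0r mulN1r opprK divff //.
by apply/eqP => e; move: h; rewrite e mul0r ltxx.
Qed.

(** Strictness makes the form nondegenerate on the plane of an edge, which [walk_braid] splits off;
    it also separates edges from non-edges, whose Cartan entry is -2. *)
Lemma ccos_sqr m : (1 < m)%N -> ccos m ^+ 2 < 4.
Proof.
move=> m1.
have h : sin (pi / m%:R : R) != 0.
  apply/eqP => e; have := U_ccos_gt0 m1 (n := 1) m1; rewrite U_ccos // e.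
  by rewrite invr0 mulr0 ltxx.
have := cos2Dsin2 (pi / m%:R : R).
have : 0 < sin (pi / m%:R : R) ^+ 2 by rewrite exprn_even_gt0.
rewrite /ccos; set C := cos _; set D := sin _; nra.
Qed.

(** The first positive zero of [U (ccos m)] is at m, so the form determines the label. *)
Lemma ccos_inj m n : (1 < m)%N -> (1 < n)%N -> ccos m = ccos n -> m = n.
Proof.
wlog: m n / (m <= n)%N => [hw|mn] m1 n1 e.
  by case: (leqP m n) => [/hw|/ltnW /hw h]; [exact | symmetry; apply: h].
apply/eqP; rewrite eqn_leq mn leqNgt /=; apply/negP => lt.
have := U_ccos_gt0 n1 (n := m); rewrite -e U_ccos_m // lt ltnW // ltxx.
by move/(_ isT).
Qed.

End Chebyshev.

Section Reflections.
Context (R : realType) (S : finType) (G : lgraph S).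

Let V := S -> R.
Implicit Types (u v w : V) (s t : S) (a b : R).

(** Twice the usual Tits form; a missing edge counts as an infinite label, hence the entry -2. *)
Definition cartan s t : R :=
  if s == t then 2 else if edge G s t then - ccos R (label G s t) else - 2.

Lemma cartan_sym s t : cartan s t = cartan t s.
Proof.
rewrite /cartan eq_sym (edge_sym G s); case: eqP => // _.
by case: ifP => // h; rewrite (label_sym h).
Qed.

Definition basis s : V := fun t => (t == s)%:R.
(** Linearity is always expressed through these binary combinations; [comb 0 u (- 1) u] is the
    negative of [u]. *)
Definition comb a u b v : V := fun r => a * u r + b * v r.
Definition bpair s v : R := \sum_t cartan s t * v t.
Definition bform u v : R := \sum_s u s * bpair s v.
Definition refl s v : V := fun t => v t - bpair s v * (t == s)%:R.
Definition actw (l : seq S) v : V := foldr refl v l.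
Definition nonneg v := forall s, 0 <= v s.

Lemma basisE s t : basis s t = (t == s)%:R. Proof. by []. Qed.

Lemma sum_basis (F : S -> R) s : \sum_t F t * (t == s)%:R = F s.
Proof.
rewrite (bigD1 s) //= eqxx mulr1 big1 ?addr0 // => t /negPf ->.
by rewrite mulr0.
Qed.

Lemma bpair_basis s t : bpair s (basis t) = cartan s t.
Proof. exact: sum_basis. Qed.

Lemma bpair_comb s a u b v :
  bpair s (comb a u b v) = a * bpair s u + b * bpair s v.
Proof.
rewrite /bpair !mulr_sumr -big_split; apply: eq_bigr => t _ /=.
by rewrite /comb; ring.
Qed.

Lemma refl_comb s a u b v :
  refl s (comb a u b v) = comb a (refl s u) b (refl s v).
Proof. by apply: funext => t; rewrite /refl bpair_comb /comb; ring. Qed.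

Lemma reflE s v : refl s v = comb 1 v (- bpair s v) (basis s).
Proof. by apply: funext => t; rewrite /refl /comb /basis; ring. Qed.

Lemma refl_basis s : refl s (basis s) = comb 0 (basis s) (- 1) (basis s).
Proof.
apply: funext => t; rewrite /refl /comb bpair_basis /cartan eqxx /basis; ring.
Qed.

Lemma reflK s : involutive (refl s).
Proof.
move=> v; rewrite (reflE s v) refl_comb refl_basis.
by apply: funext => t; rewrite /comb /refl /basis; ring.
Qed.

Lemma actw_comb l a u b v :
  actw l (comb a u b v) = comb a (actw l u) b (actw l v).
Proof. by elim: l => //= s l ->; rewrite refl_comb. Qed.

Lemma actw_cat l l' v : actw (l ++ l') v = actw l (actw l' v).
Proof. exact: foldr_cat. Qed.

Lemma actw_rcons l s v : actw (rcons l s) v = actw l (refl s v).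
Proof. by rewrite -cats1 actw_cat. Qed.

Lemma actw_revK l v : actw (rev l) (actw l v) = v.
Proof.
elim: l v => // s l IH v; rewrite rev_cons actw_rcons /= reflK; exact: IH.
Qed.

Lemma actw_Krev l v : actw l (actw (rev l) v) = v.
Proof. by rewrite -{1}[l]revK actw_revK. Qed.

Lemma bform_sym u v : bform u v = bform v u.
Proof.
rewrite /bform /bpair.
under eq_bigr do rewrite mulr_sumr.
rewrite exchange_big; apply: eq_bigr => s _ /=; rewrite mulr_sumr.
by apply: eq_bigr => t _; rewrite cartan_sym; ring.
Qed.

Lemma bform_comb w a u b v :
  bform w (comb a u b v) = a * bform w u + b * bform w v.
Proof.
rewrite /bform !mulr_sumr -big_split; apply: eq_bigr => s _ /=.
by rewrite bpair_comb; ring.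
Qed.

Lemma bform_basis s v : bform (basis s) v = bpair s v.
Proof.
rewrite /bform /basis; under eq_bigr do rewrite mulrC.
exact: sum_basis.
Qed.

Lemma bform_refl s u v : bform (refl s u) (refl s v) = bform u v.
Proof.
have h w w' : bform w (refl s w') = bform w w' - bpair s w * bpair s w'.
  by rewrite reflE bform_comb (bform_sym w (basis s)) bform_basis; ring.
rewrite h bform_sym h bform_sym (reflE s u) bpair_comb bpair_basis.
by rewrite /cartan eqxx; ring.
Qed.

Lemma bform_actw l u v : bform (actw l u) (actw l v) = bform u v.
Proof. by elim: l => //= s l; rewrite bform_refl. Qed.

Lemma nonneg_comb a u b v : 0 <= a -> 0 <= b -> nonneg u -> nonneg v ->
  nonneg (comb a u b v).
Proof. by move=> a0 b0 hu hv s; rewrite addr_ge0 ?mulr_ge0. Qed.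

Lemma nonneg_basis s : nonneg (basis s).
Proof. by move=> t; rewrite /basis ler0n. Qed.

Lemma basis_inj : injective basis.
Proof.
move=> s t /(congr1 (@^~ s)); rewrite /basis eqxx.
by case: eqP => // _ /eqP; rewrite oner_eq0.
Qed.

Lemma basis_neg s : ~ nonneg (comb 0 (basis s) (- 1) (basis s)).
Proof.
by move/(_ s); rewrite /comb /basis eqxx !mulr1 add0r ler0N1.
Qed.


Definition alt_letter (T : Type) (x y : T) (k : nat) : T := if odd k then y else x.

(* The reflections applied first [s], then [t], then [s] again, [k] in total. *)
Fixpoint walk s t k v : V :=
  if k is k'.+1 then walk t s k' (refl s v) else v.

Lemma walkS s t k v : walk s t k.+1 v = refl (alt_letter s t k) (walk s t k v).
Proof.
elim: k s t v => [//|k IH] s t v.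
by rewrite -[LHS]/(walk t s k.+1 (refl s v)) IH /alt_letter /=; case: odd.
Qed.

Lemma walkE s t k v : walk s t k v = actw (rev (alternating s t k)) v.
Proof. by elim: k s t v => //= k IH s t v; rewrite rev_cons actw_rcons IH. Qed.

Lemma walk_comb s t k a u b v :
  walk s t k (comb a u b v) = comb a (walk s t k u) b (walk s t k v).
Proof. by rewrite !walkE actw_comb. Qed.

Lemma refl_basis_ne s t : refl t (basis s) = comb 1 (basis s) (- cartan t s) (basis t).
Proof. by rewrite reflE bpair_basis. Qed.

(** The letters alternate, so each reflection changes one coefficient, by the recursion of [U]. *)
Lemma walk_basis s t k : s != t ->
  walk t s k (basis s) =
    comb (U (- cartan s t) k.+1) (basis (alt_letter s t k))
         (U (- cartan s t) k) (basis (alt_letter t s k)).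
Proof.
move=> st; elim: k => [|k IH].
  by apply: funext => r; rewrite /comb U1 U0 /alt_letter /=; ring.
rewrite walkS IH refl_comb refl_basis refl_basis_ne USS.
have -> : cartan (alt_letter t s k) (alt_letter s t k) = cartan s t.
  by rewrite /alt_letter; case: odd => //; rewrite cartan_sym.
by apply: funext => r; rewrite /comb /alt_letter /=; case: odd => /=; ring.
Qed.

Section EdgePair.
Context (s t : S) (st : edge G s t).

Lemma edge_neq : s != t.
Proof. by apply/eqP => e; move: st; rewrite e edge_irr. Qed.

Lemma cartan_edge : - cartan s t = ccos R (label G s t).
Proof. by rewrite /cartan (negPf edge_neq) st opprK. Qed.

(** After m - 1 letters the coefficients are [U m = 0] and [U (m - 1) = 1], so a simple root is
    reached again. This produces the loop at the far end of a dihedral orbit in the action below. *)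
Lemma walk_last : let m := label G s t in
  walk t s m.-1 (basis s) = basis (alt_letter t s m.-1).
Proof.
move=> m; have m2 : (1 < m)%N by apply: label_ge2.
rewrite walk_basis ?edge_neq // cartan_edge prednK; last by rewrite ltnW.
rewrite U_ccos_m // U_ccos_m1 //.
by apply: funext => r; rewrite /comb; ring.
Qed.

End EdgePair.

Lemma walk_braid s t : edge G s t ->
  forall v, walk s t (label G s t) v = walk t s (label G s t) v.
Proof.
have half s' t' : edge G s' t' ->
    walk s' t' (label G s' t') (basis s') = walk t' s' (label G s' t') (basis s').
  move=> st; have m2 := label_ge2 st.
  have em : label G s' t' = (label G s' t').-1.+1 by lia.
  rewrite [in LHS]em /= refl_basis walk_comb walk_last // [in RHS]em walkS.
  by rewrite walk_last // refl_basis.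
move=> st v; have m2 := label_ge2 st; set m := label G s t in m2 *.
set c := ccos R m.
have c4 : 4 - c ^+ 2 != 0 by have := ccos_sqr R m2; rewrite -/c; lra.
have ec : cartan s t = - c by rewrite -[LHS]opprK cartan_edge.
(* Coordinates of the projection of [v] to the plane of s and t, by Cramer's rule with determinant 4
   - c^2. The remainder [v0] is orthogonal to the plane, hence fixed by both reflections. *)
set x := (2 * bpair s v + c * bpair t v) / (4 - c ^+ 2).
set y := (2 * bpair t v + c * bpair s v) / (4 - c ^+ 2).
pose v0 := comb 1 v (-1) (comb x (basis s) y (basis t)).
have e0 : bpair s v0 = 0 /\ bpair t v0 = 0.
  rewrite !bpair_comb !bpair_basis (cartan_sym t s) ec /cartan !eqxx /x /y.
  by split; field.
have f0 k (a b : S) : ((a == s) || (a == t)) && ((b == s) || (b == t)) -> walk a b k v0 = v0.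
  elim: k a b => //= k IH a b /andP[ha hb]; rewrite reflE.
  have -> : bpair a v0 = 0 by case/orP: ha => /eqP ->; case: e0.
  have -> : comb 1 v0 (- 0) (basis a) = v0.
    by apply: funext => r; rewrite /comb; ring.
  by apply: IH; rewrite hb.
have dv : v = comb 1 v0 1 (comb x (basis s) y (basis t)).
  by apply: funext => r; rewrite /v0 /comb; ring.
rewrite dv; clear dv; clearbody v0.
rewrite !walk_comb !f0 ?eqxx ?orbT // half //.
by rewrite /m (label_sym st) half // edge_sym.
Qed.

End Reflections.

(** * Every root is positive or negative *)

Section RootSigns.
Context (R : realType) (S : finType) (G : lgraph S).

Implicit Types s t : S.

Local Notation basis := (@basis R S).
Local Notation actw := (@actw R S G).
Local Notation refl := (@refl R S G).
Local Notation walk := (@walk R S G).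

(** A further letter either prolongs the alternating word or cancels its last reflection. At length
    m the braid relation lets the word end in either letter, so there it always cancels. *)
Lemma dihedral_normal s t (j : seq S) : s != t ->
  {subset j <= [:: s; t]} -> exists k, [/\ (k <= size j)%N,
    edge G s t -> (k <= label G s t)%N &
    actw j =1 walk s t k \/ actw j =1 walk t s k].
Proof.
move=> nst; elim: j => [|x j IH] hj; first by exists 0%N; split=> //; left.
have xst : x \in [:: s; t] by apply: hj; rewrite inE eqxx.
have {}/IH : {subset j <= [:: s; t]} by move=> y yj; apply: hj; rewrite inE yj orbT.
move=> [k [kj km hw]] {hj}.
wlog: s t nst xst km hw / actw j =1 walk s t k => [hwlog|{}hw].
  case: (hw) => h; first exact: hwlog.
  have [||||//|k' [h1 h2 h3]] := hwlog t s.
  - by rewrite eq_sym.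
  - by move: xst; rewrite !inE orbC.
  - by move=> ts; rewrite (label_sym ts); apply: km; rewrite edge_sym.
  - by case: hw; [right|left].
  exists k'; split=> //; last tauto.
  by move=> st; rewrite (label_sym st); apply: h2; rewrite edge_sym.
have down k' : (k'.+1 <= (size j).+1)%N -> (edge G s t -> (k'.+1 <= label G s t)%N) ->
    forall a b, (a, b) = (s, t) \/ (a, b) = (t, s) -> actw j =1 walk a b k'.+1 ->
    x = alt_letter a b k' -> exists k0, [/\ (k0 <= (size j).+1)%N,
    edge G s t -> (k0 <= label G s t)%N &
    actw (x :: j) =1 walk s t k0 \/ actw (x :: j) =1 walk t s k0].
  move=> h1 h2 a b hab hj ex; exists k'; split; [by lia | by move=> /h2; lia |].
  have e : actw (x :: j) =1 walk a b k' by move=> v /=; rewrite hj walkS ex reflK.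
  by case: hab => -[-> ->] in e *; [left|right].
case: (k =P 0%N) => [k0|/eqP]; last rewrite -lt0n => k0.
  exists 1%N; split => //; first by move=> st; rewrite ltnW ?label_ge2.
  move: xst; rewrite !inE => /orP[]/eqP->; [left|right] => v /=; by rewrite hw k0.
have ek : k = k.-1.+1 by lia.
case: (x =P alt_letter s t k.-1) => [ex|nx].
  apply: (down k.-1 _ _ s t) => //; rewrite -?ek //; last by left.
  exact: leqW.
have ex : x = alt_letter s t k.
  have -> : alt_letter s t k = alt_letter t s k.-1.
    by rewrite /alt_letter {1}ek /=; case: odd.
  move: nx xst; rewrite /alt_letter !inE.
  by case: odd => nx /orP[]/eqP h //; case: nx.
have [st|nst'] : edge G s t \/ ~~ edge G s t by case: edge; [left|right].
  2: { exists k.+1; split=> //; first by rewrite (negPf nst').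
       by left => v; rewrite walkS -ex /= hw. }
have := km st; rewrite leq_eqVlt => /orP[/eqP em|lt].
  apply: (down k.-1 _ _ t s); rewrite -?ek //; [exact: leqW | by right | | ].
    by move=> v; rewrite hw em walk_braid.
  by rewrite ex /alt_letter {1}ek /=; case: odd.
exists k.+1; split=> //; left => v; by rewrite walkS -ex /= hw.
Qed.

Lemma size_alternating (T : Type) (x y : T) k : size (alternating x y k) = k.
Proof. by elim: k x y => //= k IH x y; rewrite IH. Qed.

(** Length is measured among words with the same linear action, which stands for the element of the
    Coxeter group. *)
Definition shortest n (f : (S -> R) -> S -> R) :=
  forall l, actw l =1 f -> (n <= size l)%N.

Lemma U_cartan_ge0 s t k : s != t -> (edge G s t -> (k <= label G s t)%N) ->
  0 <= U (- cartan R G s t) k.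
Proof.
move=> nst hk; have [st|nst'] := boolP (edge G s t); last first.
  by rewrite /cartan (negPf nst) (negPf nst') opprK U2E ler0n.
have m2 := label_ge2 st; rewrite cartan_edge //; move: (hk st); rewrite leq_eqVlt.
case/orP=> [/eqP->|lt]; first by rewrite U_ccos_m.
case: k lt {hk} => [|k] lt; first by rewrite U0.
by apply/ltW/U_ccos_gt0.
Qed.

(* Write [l] as [v j] with [v] shortest in its coset modulo the subgroup of [s] and
   [t]: by induction [v] is positive on both, and [j] sends the root [s] to a
   nonnegative combination of the two. *)
Lemma tits_positive (l : seq S) s : shortest (size l) (actw l) ->
  shortest (size l) (actw l \o refl s) -> nonneg (actw l (basis s)).
Proof.
move: {2}(size l) (leqnn (size l)) => N.
elim: N l s => [|N IH] l s.
  by rewrite leqn0 => /eqP/size0nil -> _ _; exact: nonneg_basis.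
case/lastP: l => [|l t] hN hl hs; first exact: nonneg_basis.
have nst : s != t.
  apply/eqP => e.
  suff : actw l =1 actw (rcons l t) \o refl s by move/hs; rewrite size_rcons ltnn.
  by move=> v /=; rewrite actw_rcons -e reflK.
set f := rcons l t in hN hl hs *.
pose P k := `[< exists v j : seq S, [/\ size v = k, {subset j <= [:: s; t]},
  actw (v ++ j) =1 actw f & (size v + size j = size f)%N] >].
have exP : exists k, P k.
  exists (size l); apply/asboolP; exists l, [:: t]; split=> //.
  - by move=> y; rewrite !inE => ->; rewrite orbT.
  - by move=> v; rewrite cats1.
  - by rewrite addn1 size_rcons.
case: (ex_minnP exP) => k /asboolP[v [j [<- hj hvj hsz]]] hmin {exP}.
have vl : (size v <= size l)%N.
  apply: hmin; apply/asboolP; exists l, [:: t]; split=> //.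
  - by move=> y; rewrite !inE => ->; rewrite orbT.
  - by move=> w; rewrite cats1.
  - by rewrite addn1 size_rcons.
have vN : (size v <= N)%N by move: hN; rewrite size_rcons; lia.
have vmin : shortest (size v) (actw v).
  move=> v' e; have : actw (v' ++ j) =1 actw f.
    by move=> w; rewrite actw_cat e -actw_cat.
  by move/hl; rewrite size_cat -hsz; lia.
have vpos r : r \in [:: s; t] -> nonneg (actw v (basis r)).
  move=> hr; apply: IH => // v' e; rewrite leqNgt; apply/negP => lt.
  have ev' : actw (v' ++ r :: j) =1 actw f.
    by move=> w; rewrite actw_cat e /= reflK -actw_cat.
  have := hl _ ev'; rewrite size_cat /= => h.
  suff : (size v <= size v')%N by lia.
  apply: hmin; apply/asboolP; exists v', (r :: j); split=> //; last by move=> /=; lia.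
  by move=> y; rewrite inE => /orP[/eqP->|/hj].
have [k' [k'j k'm hw]] := dihedral_normal nst hj.
(* If the first reflection of [j] were s, dropping it would give too short a word for
   [actw f \o refl s], against [hs]. This also excludes k' = m, where the braid relation would let
   [j] begin with s. *)
have nos : (0 < k')%N -> ~ (actw j =1 walk s t k').
  case: k' k'j {k'm hw} => // k' k'j _ hw.
  have : actw (v ++ rev (alternating t s k')) =1 actw f \o refl s.
    by move=> w /=; rewrite -hvj !actw_cat hw /= reflK walkE.
  by move/hs; rewrite size_cat size_rev size_alternating; lia.
have hw' : actw j =1 walk t s k'.
  case: hw => // hw; case: (posnP k') => [k0|k0]; first by rewrite k0 in hw *.
  by case: (nos k0 hw).
have k'lt : edge G s t -> (k' < label G s t)%N.
  move=> st; rewrite ltn_neqAle k'm // andbT; apply/eqP => e.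
  apply: nos; first by rewrite e ltnW ?label_ge2.
  by move=> w; rewrite hw' e walk_braid.
rewrite -hvj actw_cat hw' walk_basis // actw_comb.
apply: nonneg_comb; try apply: U_cartan_ge0 => //; try apply: vpos.
- by rewrite /alt_letter !inE; case: odd; rewrite eqxx ?orbT.
- by rewrite /alt_letter !inE; case: odd; rewrite eqxx ?orbT.
Qed.

Lemma shortest_exists (f : (S -> R) -> S -> R) (l : seq S) : actw l =1 f ->
  exists l', actw l' =1 f /\ shortest (size l') f.
Proof.
move=> h; pose P n := `[< exists l', actw l' =1 f /\ size l' = n >].
have exP : exists n, P n by exists (size l); apply/asboolP; exists l.
case: (ex_minnP exP) => n /asboolP[l' [h1 <-]] hm; exists l'; split=> // l2 h2.
by apply: hm; apply/asboolP; exists l2.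
Qed.

(** Take shortest words for [actw l] and for [actw l \o refl s]. The shorter of them satisfies both
    hypotheses of [tits_positive], and the two maps send the root s to opposite vectors. *)
Lemma root_sign (l : seq S) s :
  nonneg (actw l (basis s)) \/ nonneg (fun r => - actw l (basis s) r).
Proof.
have [l1 [e1 m1]] := @shortest_exists (actw l) l (fun=> erefl).
have [l2 [e2 m2]] := @shortest_exists (actw l \o refl s) (rcons l s) (actw_rcons _ _ _).
have ext n f g : f =1 g -> shortest n f -> shortest n g.
  by move=> fg h l' e; apply: h => v; rewrite e fg.
case: (leqP (size l1) (size l2)) => [le|/ltnW le].
  left; rewrite -e1; apply: tits_positive; first by apply: ext m1 => v; rewrite e1.
  move=> l' e'; apply: leq_trans le _; apply: m2 => v; by rewrite e' /= e1.
right.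
have -> : (fun r => - actw l (basis s) r) = actw l2 (basis s).
  rewrite e2 /= refl_basis actw_comb; apply: funext => r; rewrite /comb; ring.
apply: tits_positive; first by apply: ext m2 => v; rewrite e2.
move=> l' e'; apply: leq_trans le _; apply: m1 => v; by rewrite e' /= e2 /= reflK.
Qed.

(** [d] is shortest in its coset modulo the dihedral subgroup acting on the left, so prolonging
    [rev d] by s or t cannot give a shorter word; [tits_positive] then applies to [rev d]. *)
Lemma dihedral_coset (l : seq S) s t : exists j d : seq S,
  [/\ {subset j <= [:: s; t]}, actw (j ++ d) =1 actw l &
      forall r, r \in [:: s; t] -> nonneg (actw (rev d) (basis r))].
Proof.
pose P n := `[< exists j d, [/\ {subset j <= [:: s; t]},
  actw (j ++ d) =1 actw l & size d = n] >].
have exP : exists n, P n by exists (size l); apply/asboolP; exists [::], l.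
case: (ex_minnP exP) => n /asboolP[j [d [hj e <-]]] hm.
exists j, d; split=> // r hr; apply: tits_positive => l' e'; rewrite size_rev.
  apply: leq_trans (hm (size (rev l')) _) _; last by rewrite size_rev.
  apply/asboolP; exists j, (rev l'); split=> // v; rewrite actw_cat -e actw_cat.
  by congr actw; rewrite -{1}[v](actw_revK G d) -e' actw_revK.
apply: leq_trans (hm (size (rev l')) _) _; last by rewrite size_rev.
apply/asboolP; exists (rcons j r), (rev l'); split=> //.
  by move=> y; rewrite mem_rcons inE => /orP[/eqP->|/hj].
move=> v; rewrite actw_cat actw_rcons -e actw_cat; congr actw.
have ev : actw l' (refl r (actw d v)) = v by rewrite e' /= reflK actw_revK.
by rewrite -{1}ev actw_revK reflK.
Qed.

End RootSigns.

Local Close Scope ring_scope.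
Local Open Scope group_scope.

(** * Words and morphisms of Artin groups *)

Definition altp (M : monoidType) (x y : M) k : M := \prod_(z <- alternating x y k) z.

Lemma altp0 (M : monoidType) (x y : M) : altp x y 0 = 1.
Proof. by rewrite /altp big_nil. Qed.

Lemma altpS (M : monoidType) (x y : M) k : altp x y k.+1 = x * altp y x k.
Proof. by rewrite /altp big_cons. Qed.

Lemma altpSr (M : monoidType) (x y : M) k :
  altp x y k.+1 = altp x y k * alt_letter x y k.
Proof.
elim: k x y => [|k IH] x y; first by rewrite altpS !altp0 mul1g mulg1.
by rewrite altpS IH mulgA -altpS /alt_letter /=; case: odd.
Qed.

(** The integers written multiplicatively, so that they can be a target of [artin_lift]. *)
Definition mint : Type := int.
HB.instance Definition _ := Choice.on mint.
Definition mint_mul (a b : mint) : mint := (a + b)%R.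
Definition mint_one : mint := 0%R.
Definition mint_inv (a : mint) : mint := (- a)%R.
Lemma mint_mulA : associative mint_mul. Proof. exact: addrA. Qed.
Lemma mint_mul1g : left_id mint_one mint_mul. Proof. exact: add0r. Qed.
Lemma mint_mulg1 : right_id mint_one mint_mul. Proof. exact: addr0. Qed.
Lemma mint_mulVg : left_inverse mint_one mint_inv mint_mul.
Proof. exact: addNr. Qed.
Lemma mint_mulgV : right_inverse mint_one mint_inv mint_mul.
Proof. exact: addrN. Qed.
HB.instance Definition _ := isGroup.Build mint
  mint_mulA mint_mul1g mint_mulg1 mint_mulVg mint_mulgV.

Section ArtinWords.
Context (S : finType) (G : lgraph S).

Definition aw (u : seq (S * bool)) : artin G := word_class (group_rel (artin_rel G)) u.

Lemma aw_cat u v : aw (u ++ v) = aw u * aw v.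
Proof. by symmetry; exact: pmul_class. Qed.

Lemma aw_nil : aw [::] = 1. Proof. by []. Qed.

Lemma aw_cons x u : aw (x :: u) = aw [:: x] * aw u.
Proof. by rewrite -aw_cat. Qed.

Lemma aw_inv u : aw (winv u) = (aw u)^-1.
Proof. by symmetry; exact: (@pinv_class _ (artin_rel G)). Qed.

Lemma awP u v : aw u = aw v <-> cong (group_rel (artin_rel G)) u v.
Proof. exact: word_classP. Qed.

Lemma awW (P : artin G -> Prop) : (forall u, P (aw u)) -> forall g, P g.
Proof. exact: (@word_classW _ (group_rel (artin_rel G))). Qed.

Lemma aw_gen s (b : bool) :
  aw [:: (s, b)] = if b then artin_gen G s else (artin_gen G s)^-1.
Proof. by case: b => //; rewrite -aw_inv. Qed.

Lemma artin_ind (P : artin G -> Prop) : P 1 ->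
  (forall s g, P g -> P (artin_gen G s * g)) ->
  (forall s g, P g -> P ((artin_gen G s)^-1 * g)) -> forall g, P g.
Proof.
move=> h1 hM hV; elim/awW => u; elim: u => [//|[s b] u IH].
by rewrite aw_cons aw_gen; case: b; [exact: hM | exact: hV].
Qed.

Lemma aw_alternating u v k :
  aw (positive (alternating u v k)) = altp (artin_gen G u) (artin_gen G v) k.
Proof.
elim: k u v => [|k IH] u v; first by rewrite altp0.
by rewrite /= aw_cons IH altpS.
Qed.

Lemma artin_braid u v : edge G u v ->
  altp (artin_gen G u) (artin_gen G v) (label G u v) =
  altp (artin_gen G v) (artin_gen G u) (label G u v).
Proof.
move=> uv; rewrite -!aw_alternating; apply/awP.
rewrite -[positive _]cats0 -[positive (alternating v u _)]cats0.
by apply: (cong_rel [::] [::]); constructor; constructor.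
Qed.

Section Lift.
Context (T : groupType) (phi : S -> T).

Definition wprod (u : seq (S * bool)) : T :=
  \prod_(x <- u) (if x.2 then phi x.1 else (phi x.1)^-1).

Definition artin_lift (g : artin G) : T :=
  wprod (repr (g : presented (group_rel (artin_rel G)))).

Lemma wprod_positive l : wprod (positive l) = \prod_(x <- l) phi x.
Proof. by rewrite /wprod /positive big_map. Qed.

Lemma wprod_alternating u v k :
  wprod (positive (alternating u v k)) = altp (phi u) (phi v) k.
Proof.
rewrite wprod_positive; elim: k u v => [|k IH] u v; first by rewrite altp0 big_nil.
by rewrite altpS /= big_cons IH.
Qed.

Hypothesis phi_braid : forall u v, edge G u v ->
  altp (phi u) (phi v) (label G u v) = altp (phi v) (phi u) (label G u v).

Lemma wprod_cong u v : cong (group_rel (artin_rel G)) u v -> wprod u = wprod v.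
Proof.
elim=> {u v} [l r u v h|//|u v _ ->//|u v w _ -> _ -> //].
rewrite /wprod !big_cat /= -!/(wprod _); congr (_ * (_ * _)).
case: h => {u v} [_ _ [u v uv]|a b].
  by rewrite !wprod_alternating phi_braid.
by rewrite /wprod !big_cons !big_nil /=; case: b => /=; rewrite mulg1 ?mulgV ?mulVg.
Qed.

Lemma artin_lift_aw u : artin_lift (aw u) = wprod u.
Proof. by apply: wprod_cong; exact: repr_cong. Qed.

Lemma artin_liftM : {morph artin_lift : g h / g * h}.
Proof.
elim/awW => u; elim/awW => v.
by rewrite -aw_cat !artin_lift_aw /wprod big_cat.
Qed.

Lemma artin_lift1 : artin_lift 1 = 1.
Proof. by rewrite -aw_nil artin_lift_aw /wprod big_nil. Qed.

Lemma artin_liftV : {morph artin_lift : g / g^-1}.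
Proof.
by move=> g; apply: (mulgI (artin_lift g)); rewrite -artin_liftM !mulgV artin_lift1.
Qed.

Lemma artin_lift_gen s : artin_lift (artin_gen G s) = phi s.
Proof. by rewrite -(aw_gen s true) artin_lift_aw /wprod big_seq1. Qed.

End Lift.

Definition artin_len (g : artin G) : mint := artin_lift (fun=> (1%R : int) : mint) g.

Lemma artin_lenM : {morph artin_len : g h / g * h >-> (g + h)%R}.
Proof. exact: artin_liftM. Qed.

Lemma artin_len_gen s : artin_len (artin_gen G s) = 1%R.
Proof. exact: artin_lift_gen. Qed.

Lemma artin_len1 : artin_len 1 = 0%R.
Proof. exact: artin_lift1. Qed.

Lemma artin_lenV g : artin_len g^-1 = (- artin_len g)%R.
Proof. by rewrite /artin_len artin_liftV. Qed.

Lemma artin_lenX g n : artin_len (g ^+ n) = (artin_len g *+ n)%R.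
Proof. by elim: n => [|n IH]; rewrite ?artin_len1 // expgS artin_lenM IH mulrS. Qed.

Lemma artin_len_altp s t k :
  artin_len (altp (artin_gen G s) (artin_gen G t) k) = (k%:Z)%R.
Proof.
elim: k s t => [|k IH] s t; first by rewrite altp0 artin_len1.
by rewrite altpS artin_lenM artin_len_gen IH; lia.
Qed.

Lemma artin_gen_neq1 s : artin_gen G s <> 1.
Proof. by move/(congr1 artin_len); rewrite artin_len_gen artin_len1. Qed.

Lemma special_subgroup X : is_subgroup (special G X).
Proof.
split=> [B [[] //]|x y hx hy B hB|x hx B hB].
  by have [_ h _] := hB.1; apply: h; [exact: hx | exact: hy].
by have [_ _ h] := hB.1; apply: h; exact: hx.
Qed.

Lemma special1 X : special G X 1. Proof. by case: (special_subgroup X). Qed.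
Lemma specialM X x y : special G X x -> special G X y -> special G X (x * y).
Proof. by case: (special_subgroup X) => _ h _; exact: h. Qed.
Lemma specialV X x : special G X x -> special G X x^-1.
Proof. by case: (special_subgroup X) => _ _; exact. Qed.

Lemma special_gen (X : {set S}) s : s \in X -> special G X (artin_gen G s).
Proof. by move=> sX B [_]; apply; exists s. Qed.

Lemma special_min (X : {set S}) (B : set (artin G)) : is_subgroup B ->
  (forall s, s \in X -> B (artin_gen G s)) -> (special G X `<=` B)%classic.
Proof. by move=> hB hs g; apply; split=> // _ [s sX <-]; exact: hs. Qed.

Lemma specialVE X x : special G X x^-1 <-> special G X x.
Proof. by split=> h; [rewrite -[x]invgK|]; exact: specialV. Qed.

Lemma special_mull X x y : special G X x -> special G X (x * y) <-> special G X y.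
Proof.
move=> hx; split=> h; last exact: specialM.
by rewrite -[y](mulKg x); apply: specialM => //; exact: specialV.
Qed.

Lemma special_mulr X x y : special G X y -> special G X (x * y) <-> special G X x.
Proof.
move=> hy; split=> h; last exact: specialM.
by rewrite -[x](mulgK y); apply: specialM => //; exact: specialV.
Qed.

Lemma specialX X x n : special G X x -> special G X (x ^+ n).
Proof.
by move=> h; elim: n => [|n IH]; [exact: special1 | rewrite expgS; exact: specialM].
Qed.

Lemma special_mono (X Y : {set S}) : X \subset Y ->
  (special G X `<=` special G Y)%classic.
Proof.
move=> /fintype.subsetP XY; apply: special_min; first exact: special_subgroup.
by move=> s /XY; exact: special_gen.
Qed.

Lemma specialT g : special G [set: S]%SET g.
Proof.
elim/artin_ind: g => [|s g|s g]; first exact: special1.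
  by apply: specialM; apply: special_gen.
by apply: specialM; apply: specialV; apply: special_gen.
Qed.

Lemma special_altp (X : {set S}) x y k : special G X x -> special G X y ->
  special G X (altp x y k).
Proof.
elim: k x y => [|k IH] x y hx hy; first by rewrite altp0; exact: special1.
by rewrite altpS; apply: specialM => //; exact: IH.
Qed.

Lemma special_set0 g : special G finset.set0 g -> g = 1.
Proof.
move=> h; apply: (special_min (B := [set 1]%classic) _ _ h).
  by split=> [//|_ _ -> ->|_ ->]; rewrite /= ?mulg1 ?invg1.
by move=> s; rewrite inE.
Qed.

Lemma gen_delta s t : edge G s t ->
  let D := altp (artin_gen G s) (artin_gen G t) (label G s t) in
  artin_gen G s * D = D * artin_gen G (if odd (label G s t) then t else s).
Proof.
move=> st D; rewrite /D [in LHS]artin_braid // -altpS altpSr; congr (_ * _).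
by rewrite /alt_letter; case: odd.
Qed.

End ArtinWords.

Lemma conj_setE (H : groupType) (g : H) (B : set H) x :
  conj_set g B x <-> B (g^-1 * x * g).
Proof.
split=> [[y By <-]|h]; first by rewrite !mulgA mulVg mul1g mulgVK.
by exists (g^-1 * x * g) => //; rewrite !mulgA mulgV mul1g mulgK.
Qed.

Lemma conj_setM (H : groupType) (g h : H) (B : set H) :
  conj_set (g * h) B = conj_set g (conj_set h B).
Proof.
by apply/seteqP; split=> x; rewrite !conj_setE invgM !mulgA.
Qed.

Lemma conj_set1 (H : groupType) (B : set H) : conj_set 1 B = B.
Proof. by apply/seteqP; split=> x; rewrite conj_setE invg1 mul1g mulg1. Qed.

Lemma conj_set_subgroup (H : groupType) (g : H) (B : set H) :
  is_subgroup B -> is_subgroup (conj_set g B).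
Proof.
move=> [h1 hM hV]; split.
- by apply/conj_setE; rewrite mulg1 mulVg.
- move=> x y /conj_setE hx /conj_setE hy; apply/conj_setE.
  by have := hM _ _ hx hy; rewrite !mulgA mulgK.
- move=> x /conj_setE hx; apply/conj_setE.
  by have := hV _ hx; rewrite !invgM invgK mulgA.
Qed.

Local Close Scope group_scope.
Local Open Scope ring_scope.

(** * The retraction action *)

Lemma rev_alternating (T : Type) (x y : T) k :
  rev (alternating x y k) = if odd k then alternating x y k else alternating y x k.
Proof.
have h n : forall a b : T, alternating a b n.+1 = rcons (alternating a b n) (alt_letter a b n).
  elim: n => // n IH a b; rewrite -[LHS]/(a :: alternating b a n.+1) IH /=.
  by rewrite /alt_letter /=; case: odd.
elim: k x y => // k IH x y; transitivity (rcons (rev (alternating y x k)) x).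
  by rewrite -rev_cons.
by rewrite IH !h /alt_letter /=; case: odd.
Qed.

Lemma alt_letter_add (T : Type) (x y : T) j k :
  alt_letter (alt_letter x y j) (alt_letter y x j) k = alt_letter x y (j + k).
Proof. by rewrite /alt_letter oddD; case: (odd j); case: (odd k). Qed.

Lemma mem_alternating (T : eqType) (x y : T) k : {subset alternating x y k <= [:: x; y]}.
Proof.
elim: k x y => // k IH x y z /=; rewrite !inE => /orP[->//|/IH].
by rewrite !inE orbC.
Qed.

Section RootSupport.
Context (R : realType) (S : finType) (G : lgraph S).
Implicit Types s t : S.

Local Notation basis := (@basis R S).
Local Notation actw := (@actw R S G).
Local Notation refl := (@refl R S G).
Local Notation walk := (@walk R S G).
Local Notation bform := (@bform R S G).

Lemma root_norm l s : bform (actw l (basis s)) (actw l (basis s)) = 2.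
Proof. by rewrite bform_actw bform_basis bpair_basis /cartan eqxx. Qed.

(** The form is invariant, so a root has norm 2, while a multiple a of [basis s] has norm 2 a^2;
    with a >= 0 this gives a = 1. *)
Lemma root_supp l s r : nonneg (actw l (basis r)) ->
  (forall t, t != s -> actw l (basis r) t = 0) -> actw l (basis r) = basis s.
Proof.
move=> h0 hs; have := root_norm l r; move: (actw l (basis r)) h0 hs => v h0 hs.
have -> : v = comb (v s) (basis s) 0 (basis s).
  apply: funext => t; rewrite /comb !basisE mul0r addr0.
  by case: eqP => [->|/eqP/hs->]; rewrite ?mulr1 ?mulr0.
set a := v s; have a0 : 0 <= a := h0 s.
rewrite bform_comb bform_sym bform_comb !bform_basis bpair_basis /cartan eqxx => h.
have -> : a = 1 by nra.
by apply: funext => t; rewrite /comb; ring.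
Qed.

Lemma root_not_both l s : nonneg (actw l (basis s)) ->
  nonneg (fun r => - actw l (basis s) r) -> False.
Proof.
move=> h1 h2; have := root_norm l s.
have -> : actw l (basis s) = comb 0 (basis s) 0 (basis s).
  apply: funext => r; rewrite /comb !mul0r addr0; apply/eqP.
  by rewrite eq_le h1 andbT -oppr_ge0 h2.
by rewrite bform_comb !mul0r addr0 => /eqP; rewrite eq_sym pnatr_eq0.
Qed.

Lemma actw_out (j : seq S) s t (v : S -> R) r : {subset j <= [:: s; t]} ->
  r \notin [:: s; t] -> actw j v r = v r.
Proof.
move=> hj hr; elim: j hj => //= x j IH hj; rewrite {1}/refl.
have xr : r == x = false.
  by apply/eqP => e; move/negP: hr; apply; rewrite e; apply: hj; rewrite inE eqxx.
by rewrite xr mulr0 subr0; apply: IH => y yj; apply: hj; rewrite inE yj orbT.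
Qed.

Lemma actw_inj l : injective (actw l).
Proof. by move=> u v /(congr1 (actw (rev l))); rewrite !actw_revK. Qed.

Lemma plane_comb s t (v : S -> R) : s != t ->
  (forall r, r \notin [:: s; t] -> v r = 0) -> v = comb (v s) (basis s) (v t) (basis t).
Proof.
move=> st h; apply: funext => r; rewrite /comb !basisE.
case: (r =P s) => [->|/eqP rs]; first by rewrite (negPf st) mulr1 mulr0 addr0.
case: (r =P t) => [->|/eqP rt]; first by rewrite mulr1 mulr0 add0r.
by rewrite h ?mulr0 ?addr0 // !inE negb_or rs.
Qed.

Section CosetRep.
Context (s t : S) (st : s != t) (d : seq S).
Hypothesis dpos : forall r, r \in [:: s; t] -> nonneg (actw (rev d) (basis r)).

(** The letters of [j] leave the coordinates outside {s, t} unchanged. If [d] made r negative, these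
    coordinates would vanish, and applying [rev d] would write [basis r] as a nonpositive
    combination of nonnegative vectors. *)
Lemma coset_rep_nonneg (j : seq S) r : {subset j <= [:: s; t]} ->
  nonneg (actw (j ++ d) (basis r)) -> nonneg (actw d (basis r)).
Proof.
move=> hj h; case: (root_sign R G d r) => // h2; exfalso.
have e : actw d (basis r) =
    comb (actw d (basis r) s) (basis s) (actw d (basis r) t) (basis t).
  apply: plane_comb => // q hq; apply/eqP; rewrite eq_le -oppr_ge0 h2 /=.
  by have := h q; rewrite actw_cat (actw_out _ hj).
have := actw_revK G d (basis r); rewrite e actw_comb => /(congr1 (@^~ r)).
rewrite /comb basisE eqxx.
have hs := dpos (mem_head s [:: t]) r.
have ht : 0 <= actw (rev d) (basis t) r by apply: dpos; rewrite !inE eqxx orbT.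
by have := mulr_ge0 (h2 s) hs; have := mulr_ge0 (h2 t) ht; rewrite mulr1n; lra.
Qed.

(** Applying [rev d] writes [basis r] as a nonnegative combination of two positive roots. One that
    occurs with positive coefficient is supported on r, hence is [basis r] itself by [root_supp]. *)
Lemma coset_rep_simple r : nonneg (actw d (basis r)) ->
  (forall q, q \notin [:: s; t] -> actw d (basis r) q = 0) ->
  actw d (basis r) = basis s \/ actw d (basis r) = basis t.
Proof.
move=> h /(plane_comb st) e.
have := actw_revK G d (basis r); rewrite e actw_comb.
set p := actw d _ s; set q := actw d _ t => er.
have p0 : 0 <= p := h s.
have q0 : 0 <= q := h t.
have hs := dpos (mem_head s [:: t]).
have ht : nonneg (actw (rev d) (basis t)) by apply: dpos; rewrite !inE eqxx orbT.
have simple a b v w : 0 < a -> 0 <= b -> nonneg (actw (rev d) (basis v)) ->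
    nonneg w -> comb a (actw (rev d) (basis v)) b w = basis r ->
    actw d (basis r) = basis v.
  move=> a0 b0 hv hw ew; rewrite -[basis v](actw_Krev G d); congr actw.
  symmetry; apply: root_supp => // k kr; move/(congr1 (@^~ k)): ew.
  rewrite /comb [in RHS]basisE (negPf kr) mulr0n => /eqP.
  have x0 := mulr_ge0 (ltW a0) (hv k); have y0 := mulr_ge0 b0 (hw k).
  by rewrite paddr_eq0 // mulf_eq0 gt_eqF //= => /andP[/eqP].
move: p0; rewrite le_eqVlt => /orP[/eqP p0|p0]; last first.
  by left; rewrite -/p -/q -e; apply: simple er.
move: q0; rewrite le_eqVlt => /orP[/eqP q0|q0]; last first.
  right; rewrite -/p -/q -e; apply: (simple q p t (actw (rev d) (basis s))) => //.
    by rewrite -p0.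
  by rewrite -er; apply: funext => k; rewrite /comb; ring.
by exfalso; move/(congr1 (@^~ r)): er; rewrite -p0 -q0 /comb [in RHS]basisE eqxx mulr1n; lra.
Qed.

End CosetRep.

End RootSupport.

(** [contained_as_special G X G'] unfolds to the existence of an embedding of [induced G X], so the
    inclusions [val] into A_S and the given ones into the ambient groups are treated alike. *)
Definition embedding (S0 S : finType) (G0 : lgraph S0) (G : lgraph S) (i : S0 -> S) :=
  [/\ injective i, forall u v, edge G (i u) (i v) = edge G0 u v &
      forall u v, edge G0 u v -> label G (i u) (i v) = label G0 u v].

Section Action.
Context (R : realType) (S0 S : finType) (G0 : lgraph S0) (G : lgraph S) (i : S0 -> S).
Hypothesis hi : embedding G0 G i.
Implicit Types (s t : S) (x y : S0).

Local Notation basis := (@basis R S).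
Local Notation actw := (@actw R S G).
Local Notation refl := (@refl R S G).
Local Notation walk := (@walk R S G).
Local Notation bform := (@bform R S G).

Let fn := (S -> R) -> S -> R.
Let state := (fn * artin G0)%type.
Implicit Types (f : fn) (p : state) (a : artin G0).

(* [f] is the image of a minimal length representative of a right coset of the
   Coxeter group W modulo the parabolic subgroup of [i]. *)
Definition min_rep f : Prop :=
  (exists l, f = actw l) /\ forall x, nonneg (f (basis (i x))).

(** Here f conjugates the generator x to s, so s fixes the coset of f: a loop in the graph of
    cosets, labelled by x. *)
Definition loop f s : option S0 := [pick x | `[< f (basis (i x)) = basis s >]].

Definition sgen (x : S0) (b : bool) : artin G0 :=
  if b then artin_gen G0 x else ((artin_gen G0 x)^-1)%g.

(* The left action underlying the Charney-Paris retraction: a letter moves the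
   representative [f], unless this would leave the minimal ones, in which case it is
   a conjugate under [f] of a generator of the subgroup and acts there instead. *)
Definition sstep (z : S * bool) p : state :=
  if loop p.1 z.1 is Some x then (p.1, (sgen x z.2 * p.2)%g)
  else (refl z.1 \o p.1, p.2).

Definition sact (u : seq (S * bool)) p : state := foldr sstep p u.

Lemma i_inj : injective i. Proof. by case: hi. Qed.

Lemma min_rep_inj f : min_rep f -> injective f.
Proof. by case=> -[l ->] _; exact: actw_inj. Qed.

Lemma loopP f s x : min_rep f -> loop f s = Some x <-> f (basis (i x)) = basis s.
Proof.
move=> hf; rewrite /loop; case: pickP => [y /asboolP e|h].
  split=> [[<-]//|e']; congr Some.
  by apply: i_inj; apply: (@basis_inj R); apply: (min_rep_inj hf); rewrite e.
by split=> // e; have := h x; rewrite asboolT.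
Qed.

Lemma loopN f s : loop f s = None <-> forall x, f (basis (i x)) <> basis s.
Proof.
rewrite /loop; case: pickP => [y /asboolP e|h]; first by split=> // /(_ y).
by split=> // _ x e; have := h x; rewrite asboolT.
Qed.

(** The reflection s changes only the coordinate s. If it turns the positive root [f (basis (i x))]
    negative, that root is supported on s, so it is [basis s], and x labels a loop. *)
Lemma min_rep_refl f s : min_rep f -> loop f s = None -> min_rep (refl s \o f).
Proof.
move=> [[l ->] h0] /loopN hN; split; first by exists (s :: l).
move=> x; have [//|h2] := root_sign R G (s :: l) (i x); exfalso; apply: (hN x).
apply: root_supp => // t ts; apply/eqP; rewrite eq_le h0 andbT.
by have := h2 t; rewrite /= {1}/refl (negPf ts) mulr0 subr0 oppr_ge0.
Qed.

Lemma min_rep_step z p : min_rep p.1 -> min_rep (sstep z p).1.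
Proof.
rewrite /sstep; case e: loop => //= h; exact: min_rep_refl.
Qed.

Lemma min_rep_act u p : min_rep p.1 -> min_rep (sact u p).1.
Proof. by move=> h; elim: u => //= z u; exact: min_rep_step. Qed.

Lemma sstepK s b p : min_rep p.1 -> sstep (s, ~~ b) (sstep (s, b) p) = p.
Proof.
case: p => f a /= hf; rewrite {2}/sstep /=; case e: (loop f s) => [x|].
  rewrite /sstep /= e /sgen; congr pair.
  by case: b => /=; rewrite ?mulKg ?mulVKg.
have -> : sstep (s, ~~ b) (refl s \o f, a) = (refl s \o (refl s \o f), a).
  rewrite /sstep /=; case e': loop => [x|//]; exfalso.
  have [_ hp] := hf; apply: (@basis_neg R S s); rewrite -(@refl_basis R S G).
  by move/(loopP s x (min_rep_refl hf e)): e' => /= <-; rewrite reflK.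
by congr pair; apply: funext => v /=; rewrite reflK.
Qed.

Lemma sact_cat u v p : sact (u ++ v) p = sact u (sact v p).
Proof. exact: foldr_cat. Qed.

Definition swalk s t k p : state := sact (rev (positive (alternating s t k))) p.

Lemma swalkS s t k p : swalk s t k.+1 p = swalk t s k (sstep (s, true) p).
Proof. by rewrite /swalk /= rev_cons -cats1 sact_cat. Qed.

Lemma swalk_add s t j k p :
  swalk s t (j + k) p =
  swalk (alt_letter s t j) (alt_letter t s j) k (swalk s t j p).
Proof.
elim: j s t p => [//|j IH] s t p; rewrite addSn !swalkS IH /alt_letter /=.
by case: odd.
Qed.

Lemma sact_alternating s t k p :
  sact (positive (alternating s t k)) p =
  if odd k then swalk s t k p else swalk t s k p.
Proof.
rewrite /swalk /positive -!map_rev !rev_alternating.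
by case: odd.
Qed.

Section OneLoop.
Context (s t : S) (d : seq S) (x : S0) (st : edge G s t).
Let m := label G s t.
Hypothesis hd : min_rep (actw d).
Hypothesis hx : actw d (basis (i x)) = basis s.
Hypothesis hloop : forall (j : seq S) y r, {subset j <= [:: s; t]} ->
  r \in [:: s; t] -> actw (j ++ d) (basis (i y)) = basis r -> y = x.

(** The orbit of the coset under s and t is the path [F 0], ..., [F (m - 1)], with a loop labelled x
    at each end. *)
Let F k : fn := walk t s k \o actw d.

Let m2 : (1 < m)%N. Proof. exact: label_ge2. Qed.

Lemma alt_in k : (alt_letter s t k \in [:: s; t]) && (alt_letter t s k \in [:: s; t]).
Proof. by rewrite /alt_letter !inE; case: odd; rewrite !eqxx ?orbT. Qed.

Lemma F_actw k : exists j, {subset j <= [:: s; t]} /\ F k = actw (j ++ d).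
Proof.
exists (rev (alternating t s k)); split.
  by move=> y; rewrite mem_rev => /mem_alternating; rewrite !inE orbC.
by apply: funext => v; rewrite /F /= walkE actw_cat.
Qed.

Lemma F_basis k : F k (basis (i x)) =
  comb (U (ccos R m) k.+1) (basis (alt_letter s t k)) (U (ccos R m) k)
       (basis (alt_letter t s k)).
Proof. by rewrite /F /= hx walk_basis ?(edge_neq st) // cartan_edge. Qed.

Lemma F_none k y r : r \in [:: s; t] -> F k (basis (i x)) <> basis r ->
  F k (basis (i y)) <> basis r.
Proof.
move=> hr hn e; have [j [hj ej]] := F_actw k.
by move: (e); rewrite ej => /(hloop hj hr) yx; apply: hn; rewrite -yx.
Qed.

Lemma alt_neq k : alt_letter s t k == alt_letter t s k = false.
Proof.
rewrite /alt_letter; case: odd; last exact/negbTE/(edge_neq st).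
by rewrite eq_sym; exact/negbTE/(edge_neq st).
Qed.

Lemma F_up k a : (k.+1 < m)%N ->
  sstep (alt_letter t s k, true) (F k, a) = (F k.+1, a).
Proof.
move=> km; rewrite /sstep /=.
have -> : loop (F k) (alt_letter t s k) = None.
  apply/loopN => y; apply: F_none; first by case/andP: (alt_in k).
  rewrite F_basis => /(congr1 (@^~ (alt_letter s t k))).
  rewrite /comb !basisE eqxx alt_neq mulr0 addr0 mulr1 mulr0n => h.
  by have := U_ccos_gt0 R m2 (n := k.+1); rewrite h km ltxx => /(_ isT).
by congr pair; apply: funext => v; rewrite /F /comp walkS.
Qed.

Lemma F_down k a : (k.+1 < m)%N ->
  sstep (alt_letter t s k, true) (F k.+1, a) = (F k, a).
Proof.
move=> km; rewrite /sstep /=.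
have -> : loop (F k.+1) (alt_letter t s k) = None.
  apply/loopN => y; apply: F_none; first by case/andP: (alt_in k).
  rewrite F_basis => /(congr1 (@^~ (alt_letter s t k))).
  have -> : alt_letter s t k.+1 = alt_letter t s k by rewrite /alt_letter /=; case: odd.
  have -> : alt_letter t s k.+1 = alt_letter s t k by rewrite /alt_letter /=; case: odd.
  rewrite /comb !basisE eqxx alt_neq mulr0 add0r mulr1 mulr0n => h.
  by have := U_ccos_gt0 R m2 (n := k.+1); rewrite h km ltxx => /(_ isT).
by congr pair; apply: funext => v; rewrite /F /comp walkS reflK.
Qed.

Lemma F_min_rep k : (k < m)%N -> min_rep (F k).
Proof.
elim: k => [|k IH] km; first by rewrite (_ : F 0 = actw d).
have := min_rep_step (alt_letter t s k, true) (p := (F k, 1%g)) (IH (ltnW km)).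
by rewrite F_up.
Qed.

Lemma F_loop0 a : sstep (s, true) (F 0, a) = (F 0, (artin_gen G0 x * a)%g).
Proof. by rewrite /sstep /= (_ : loop (F 0) s = Some x) //; apply/loopP. Qed.

Lemma F_loopm a : sstep (alt_letter t s m.-1, true) (F m.-1, a) =
  (F m.-1, (artin_gen G0 x * a)%g).
Proof.
rewrite /sstep /= (_ : loop _ _ = Some x) //; apply/loopP.
  by apply: F_min_rep; lia.
by rewrite /F /= hx walk_last.
Qed.

Lemma swalk_up j k a : (k + j < m)%N ->
  swalk (alt_letter t s k) (alt_letter s t k) j (F k, a) = (F (k + j), a).
Proof.
elim: j k => [|j IH] k km; first by rewrite addn0.
rewrite swalkS F_up; last by lia.
have := IH k.+1; rewrite addSnnS => <- //.
by rewrite /alt_letter /=; case: odd.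
Qed.

Lemma swalk_down j k a : (k + j < m)%N ->
  swalk (alt_letter s t (k + j)) (alt_letter t s (k + j)) j (F (k + j), a) = (F k, a).
Proof.
elim: j k => [|j IH] k km; first by rewrite addn0.
have e : alt_letter s t (k + j.+1) = alt_letter t s (k + j).
  by rewrite addnS /alt_letter /=; case: odd.
have e' : alt_letter t s (k + j.+1) = alt_letter s t (k + j).
  by rewrite addnS /alt_letter /=; case: odd.
rewrite swalkS e e' addnS F_down; last by lia.
by apply: IH; lia.
Qed.

(** The m letters are spent on m - 1 - k steps up, one passage through the loop at the top, and k
    steps down. In [swalk_full_down] they are k steps down, the loop at [F 0], and m - 1 - k steps
    up; the results agree. *)
Lemma swalk_full_up k a : (k < m)%N ->
  swalk (alt_letter t s k) (alt_letter s t k) m (F k, a) =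
  (F (m.-1 - k), (artin_gen G0 x * a)%g).
Proof.
move=> km; have em : m = ((m.-1 - k) + k.+1)%N by lia.
rewrite [X in swalk _ _ X]em swalk_add swalk_up; last by lia.
rewrite !alt_letter_add (_ : (k + (m.-1 - k))%N = m.-1); last by lia.
rewrite swalkS F_loopm.
have -> : m.-1 = (m.-1 - k + k)%N by lia.
by rewrite swalk_down; [congr (F _, _) |]; lia.
Qed.

Lemma swalk_full_down k a : (k < m)%N ->
  swalk (alt_letter s t k) (alt_letter t s k) m (F k, a) =
  (F (m.-1 - k), (artin_gen G0 x * a)%g).
Proof.
move=> km; have em : m = (k + (m.-1 - k).+1)%N by lia.
rewrite [X in swalk _ _ X]em swalk_add.
have /= -> := @swalk_down k 0 a km.
rewrite !alt_letter_add swalkS addnn /alt_letter odd_double F_loop0.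
have lt : (0 + (m.-1 - k) < m)%N by lia.
exact: (swalk_up (artin_gen G0 x * a)%g lt).
Qed.

Lemma swalk_oneloop k a : (k < m)%N ->
  swalk s t m (F k, a) = (F (m.-1 - k), (artin_gen G0 x * a)%g) /\
  swalk t s m (F k, a) = (F (m.-1 - k), (artin_gen G0 x * a)%g).
Proof.
move=> km; have := swalk_full_up a km; have := swalk_full_down a km.
by rewrite /alt_letter; case: odd => -> ->.
Qed.

End OneLoop.

Lemma walk_neg s t k : edge G s t -> (k < label G s t)%N ->
  ~ nonneg (walk s t k.+1 (basis s)).
Proof.
move=> st km /=; rewrite refl_basis walk_comb => h.
have ew : walk t s k (basis s) = actw (rev (alternating t s k)) (basis s).
  exact: walkE.
have nst := edge_neq st.
apply: (@root_not_both R S G (rev (alternating t s k)) s); rewrite -ew.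
  rewrite walk_basis //; apply: nonneg_comb; try exact: nonneg_basis.
    by apply: U_cartan_ge0.
  by apply: U_cartan_ge0 => // _; exact: ltnW.
have -> // : (fun r => - walk t s k (basis s) r) =
    comb 0 (walk t s k (basis s)) (-1) (walk t s k (basis s)).
by apply: funext => r; rewrite /comb; ring.
Qed.

(** The return from [f'] to [f] is recorded too: it computes the inverse of the Garside element in
    [good_ribbon] and its square in [gact_delta_sqr]. *)
Definition one_loop f s t : Prop := exists x f', [/\ min_rep f',
  forall a, swalk s t (label G s t) (f, a) = (f', (artin_gen G0 x * a)%g) /\
            swalk t s (label G s t) (f, a) = (f', (artin_gen G0 x * a)%g),
  forall a, swalk s t (label G s t) (f', a) = (f, (artin_gen G0 x * a)%g) /\
            swalk t s (label G s t) (f', a) = (f, (artin_gen G0 x * a)%g) &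
  forall y r, r \in [:: s; t] -> f (basis (i y)) = basis r -> y = x].

Lemma one_loop_sym f s t : edge G s t -> one_loop f s t -> one_loop f t s.
Proof.
move=> st [x [f' [h1 h2 h3 h4]]]; exists x, f'; split=> //.
- by move=> a; rewrite -(label_sym st); have [] := h2 a.
- by move=> a; rewrite -(label_sym st); have [] := h3 a.
- by move=> y r hr; apply: h4; move: hr; rewrite !inE orbC.
Qed.

(** A normal form of [j] that applies s first would make the image of x negative. Hence it applies t
    first and has fewer than m letters, which places [actw (j ++ d)] on the path of the maps [F]. *)
Lemma one_loop_case s t (j d : seq S) x : edge G s t -> min_rep (actw (j ++ d)) ->
  {subset j <= [:: s; t]} -> min_rep (actw d) -> actw d (basis (i x)) = basis s ->
  (forall (j' : seq S) y r, {subset j' <= [:: s; t]} ->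
     r \in [:: s; t] -> actw (j' ++ d) (basis (i y)) = basis r -> y = x) ->
  one_loop (actw (j ++ d)) s t.
Proof.
move=> st hf hj hd hx hloop; have m2 := label_ge2 st.
have [k [_ km hw]] := dihedral_normal R G (edge_neq st) hj.
have {}km := km st.
have hpos : nonneg (actw j (basis s)) by rewrite -hx -actw_cat; case: hf.
have nw k' : (k' < label G s t)%N -> ~ (actw j =1 walk s t k'.+1).
  by move=> k'm e; apply: (walk_neg st k'm); rewrite -e.
have [k' [k'm hk']] : exists k', (k' < label G s t)%N /\ actw j =1 walk t s k'.
  case: hw => hw.
    case: k km hw => [|k] km hw; last by case: (nw k km hw).
    by exists 0%N; split; [exact: ltnW |].
  move: km; rewrite leq_eqVlt => /orP[/eqP km|km]; last by exists k.
  exfalso; apply: (nw k.-1); first by lia.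
  by move=> v; rewrite hw prednK ?km ?walk_braid // ltnW.
have -> : actw (j ++ d) = walk t s k' \o actw d.
  by apply: funext => v; rewrite actw_cat hk'.
have k2m : ((label G s t).-1 - k' < label G s t)%N by lia.
exists x, (walk t s ((label G s t).-1 - k') \o actw d); split.
- exact: (F_min_rep st hd hx hloop).
- by move=> a; exact: (swalk_oneloop st hd hx hloop).
- move=> a; have := swalk_oneloop st hd hx hloop a k2m.
  by rewrite (_ : (_ - (_ - k'))%N = k') //; lia.
- move=> y r hr e; apply: (hloop (rev (alternating t s k')) _ r) => //.
    by move=> z; rewrite mem_rev => /mem_alternating; rewrite !inE orbC.
  by rewrite -e actw_cat /= walkE.
Qed.

(** The cases count the generators whose roots the coset representative [d] sends to s or t. With
    none the orbit has no loops; with one it is a path with a loop at each end; with two it is a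
    single point, where the braid relation of G becomes one of G0. *)
Variant dihedral_spec f s t : Prop :=
| DihedralFree f' of (forall a, swalk s t (label G s t) (f, a) = (f', a) /\
      swalk t s (label G s t) (f, a) = (f', a)) &
    loop f s = None & loop f t = None
| DihedralOne of one_loop f s t
| DihedralTwo x y of f (basis (i x)) = basis s & f (basis (i y)) = basis t &
    edge G0 x y & label G0 x y = label G s t.

Lemma dihedralP f s t : edge G s t -> min_rep f -> dihedral_spec f s t.
Proof.
move=> st hf; have [[l el] hpos] := hf; have nst := edge_neq st.
have [j [d [hj ejd hd]]] := dihedral_coset R G l s t.
have {el ejd}ef : f = actw (j ++ d) by rewrite el; apply: funext => v.
rewrite {}ef in hf hpos *.
have hdmin : min_rep (actw d).
  by split; [exists d | move=> x; exact: (coset_rep_nonneg nst hd hj (hpos x))].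
have key (j' : seq S) y r : {subset j' <= [:: s; t]} -> r \in [:: s; t] ->
    actw (j' ++ d) (basis (i y)) = basis r ->
    actw d (basis (i y)) = basis s \/ actw d (basis (i y)) = basis t.
  move=> hj' hr e; apply: (coset_rep_simple nst hd); first by case: hdmin.
  move=> q hq; rewrite -(actw_out G _ hj' hq) -actw_cat e basisE.
  by case: eqP => // qr; rewrite qr hr in hq.
have uniq x y : actw d (basis (i x)) = actw d (basis (i y)) -> x = y.
  by move/actw_inj/basis_inj/i_inj.
have [[x hx]|hs] := pselect (exists x, actw d (basis (i x)) = basis s);
  have [[y hy]|ht] := pselect (exists y, actw d (basis (i y)) = basis t).
- have ej : actw (j ++ d) = actw d.
    have [k [_ km hw]] := dihedral_normal R G nst hj.
    have {}km := km st; apply: funext => v; rewrite actw_cat.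
    have p1 : nonneg (actw j (basis s)) by rewrite -hx -actw_cat.
    have p2 : nonneg (actw j (basis t)) by rewrite -hy -actw_cat.
    case: hw => hw; case: k km hw => [|k] km hw; rewrite ?hw //; exfalso.
      by apply: (walk_neg st km); rewrite -hw.
    apply: (@walk_neg t s k); rewrite ?(edge_sym G t) -?(label_sym st) //.
    by rewrite -hw.
  (* The invariant form gives x and y the same Cartan entry as s and t, hence an edge with the same
     label. *)
  rewrite ej; have e : cartan R G s t = cartan R G (i x) (i y).
    by rewrite -!(@bpair_basis R S G) -!bform_basis -hx -hy bform_actw.
  have xy : x != y.
    by apply/eqP => xy; move: nst; rewrite -(inj_eq (@basis_inj R S)) -hx -hy xy eqxx.
  have [_ hE hL] := hi.
  move: e; rewrite /cartan (inj_eq i_inj) (negPf xy) (negPf nst) st hE.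
  case: ifP => hxy /eqP; rewrite eqr_opp => /eqP ec; last first.
    by exfalso; have := ccos_sqr R (label_ge2 st); rewrite ec; lra.
  have hxy' : edge G (i x) (i y) by rewrite hE.
  apply: (DihedralTwo hx hy hxy); rewrite -(hL _ _ hxy).
  by apply: (@ccos_inj R); [exact: label_ge2 | exact: label_ge2 | rewrite ec].
- apply: DihedralOne; apply: (one_loop_case st hf hj hdmin hx) => j' y r hj' hr.
  case/key => // e; last by case: ht; exists y.
  by apply: uniq; rewrite e.
- apply: DihedralOne; apply: one_loop_sym; first by rewrite edge_sym.
  have ts : edge G t s by rewrite edge_sym.
  have sw : {subset [:: s; t] <= [:: t; s]} by move=> z; rewrite !inE orbC.
  have ws : {subset [:: t; s] <= [:: s; t]} by move=> z; rewrite !inE orbC.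
  apply: (one_loop_case ts hf _ hdmin hy) => [z /hj/sw //|j' x r hj' hr].
  case/(key _ _ _ (fun z hz => ws z (hj' z hz)) (ws r hr)) => e.
    by case: hs; exists x.
  by apply: uniq; rewrite e.
- have none (j' : seq S) r : {subset j' <= [:: s; t]} -> r \in [:: s; t] ->
      loop (actw (j' ++ d)) r = None.
    move=> hj' hr; apply/loopN => y /(key _ _ _ hj' hr)[e|e]; [apply: hs|apply: ht];
    by exists y.
  have free a k : forall (u v : S) (j' : seq S), {subset j' <= [:: s; t]} ->
      {subset [:: u; v] <= [:: s; t]} ->
      swalk u v k (actw (j' ++ d), a) = (walk u v k \o actw (j' ++ d), a).
    elim: k => [//|k IH] u v j' hj' huv; rewrite swalkS /sstep /= none //; last first.
      by apply: huv; rewrite inE eqxx.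
    have := IH v u (u :: j'); rewrite /= => -> //.
    + move=> z; rewrite inE => /orP[/eqP->|/hj' //].
      by apply: huv; rewrite inE eqxx.
    + by move=> z hz; apply: huv; move: hz; rewrite !inE orbC.
  apply: (@DihedralFree _ _ _ (walk s t (label G s t) \o actw (j ++ d))) => [a||].
  + split; rewrite free //; last by move=> z; rewrite !inE orbC.
    by congr pair; apply: funext => v /=; rewrite walk_braid.
  + by apply: none => //; rewrite inE eqxx.
  + by apply: none => //; rewrite !inE eqxx orbT.
Qed.

Lemma sact_two_loops f s t x y k a : min_rep f ->
  f (basis (i x)) = basis s -> f (basis (i y)) = basis t ->
  sact (positive (alternating s t k)) (f, a) =
  (f, (altp (artin_gen G0 x) (artin_gen G0 y) k * a)%g).
Proof.
move=> hf; elim: k s t x y => [|k IH] s t x y hx hy; first by rewrite altp0 mul1g.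
rewrite altpS /= (IH t s y x) // /sstep /=.
have -> : loop f s = Some x by apply/loopP.
by rewrite mulgA.
Qed.

Lemma sact_braid p s t : edge G s t -> min_rep p.1 ->
  sact (positive (alternating s t (label G s t))) p =
  sact (positive (alternating t s (label G s t))) p.
Proof.
case: p => f a /= st hf; case: (dihedralP st hf) => [f' h _ _|[x [f' [_ h _ _]]]|x y hx hy xy em].
- by rewrite !sact_alternating; have [-> ->] := h a.
- by rewrite !sact_alternating; have [-> ->] := h a.
- by rewrite !(sact_two_loops _ _ hf hx hy) !(sact_two_loops _ _ hf hy hx) -em artin_braid.
Qed.

Lemma sact_cong u v p : cong (group_rel (artin_rel G)) u v -> min_rep p.1 ->
  sact u p = sact v p.
Proof.
move=> h; elim: h p => {u v} [l r u v h|u|u v _ IH|u v w _ IH1 _ IH2] p hp //.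
- rewrite !sact_cat; congr sact; have := min_rep_act r hp; move: (sact r p) => {hp}q hq.
  case: h => {u v} [_ _ [s t st]|s b]; first exact: sact_braid.
  by have := sstepK s (~~ b) hq; rewrite negbK.
- by rewrite IH.
- by rewrite IH1 // IH2.
Qed.

Definition gact (g : artin G) p : state :=
  sact (repr (g : presented (group_rel (artin_rel G)))) p.

Lemma gact_aw u p : min_rep p.1 -> gact (aw G u) p = sact u p.
Proof. by apply: sact_cong; exact: repr_cong. Qed.

Lemma gactM g h p : min_rep p.1 -> gact (g * h)%g p = gact g (gact h p).
Proof.
elim/awW: g => u; elim/awW: h => v hp.
rewrite -aw_cat (gact_aw _ hp) (gact_aw v hp) sact_cat gact_aw //.
exact: min_rep_act.
Qed.

Lemma gact1 p : min_rep p.1 -> gact 1%g p = p.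
Proof. by move=> hp; rewrite -(aw_nil G) gact_aw. Qed.

Lemma gactK g p : min_rep p.1 -> gact g^-1%g (gact g p) = p.
Proof. by move=> hp; rewrite -gactM // mulVg gact1. Qed.

Lemma gact_gen s f a x : min_rep f -> f (basis (i x)) = basis s ->
  gact (artin_gen G s) (f, a) = (f, (artin_gen G0 x * a)%g).
Proof.
move=> hf /(loopP s x hf) e; rewrite -(aw_gen G s true) gact_aw //.
by rewrite /= /sstep /= e.
Qed.

Lemma gact_genV s f a x : min_rep f -> f (basis (i x)) = basis s ->
  gact (artin_gen G s)^-1%g (f, a) = (f, ((artin_gen G0 x)^-1 * a)%g).
Proof.
move=> hf /(loopP s x hf) e; rewrite -(aw_gen G s false) gact_aw //.
by rewrite /= /sstep /= e.
Qed.

Lemma gact_delta s t p : min_rep p.1 -> edge G s t ->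
  gact (altp (artin_gen G s) (artin_gen G t) (label G s t)) p =
  swalk s t (label G s t) p.
Proof.
move=> hp st; rewrite -aw_alternating gact_aw //.
have e := sact_braid st hp; have := sact_alternating s t (label G s t) p.
have := sact_alternating t s (label G s t) p; rewrite -e.
by case: odd => -> //.
Qed.

Lemma min_rep_id : min_rep (fun v => v).
Proof. by split; [exists [::] | move=> x; exact: nonneg_basis]. Qed.

End Action.

Local Close Scope ring_scope.
Local Open Scope group_scope.

Local Notation R := Rdefinitions.R.

(** * Van der Lek's theorem and special subgroups *)

Section ArtinMap.
Context (S0 S : finType) (G0 : lgraph S0) (G : lgraph S) (i : S0 -> S).
Hypothesis hi : embedding G0 G i.

Definition artin_map : artin G0 -> artin G := artin_lift (fun x => artin_gen G (i x)).

Lemma artin_map_braid u v : edge G0 u v ->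
  altp (artin_gen G (i u)) (artin_gen G (i v)) (label G0 u v) =
  altp (artin_gen G (i v)) (artin_gen G (i u)) (label G0 u v).
Proof.
by case: hi => _ hE hL uv; rewrite -hL // artin_braid // hE.
Qed.

Lemma artin_mapM : {morph artin_map : g h / g * h}.
Proof. exact: artin_liftM artin_map_braid. Qed.

Lemma artin_map1 : artin_map 1 = 1.
Proof. exact: artin_lift1 artin_map_braid. Qed.

Lemma artin_mapV : {morph artin_map : g / g^-1}.
Proof. exact: artin_liftV artin_map_braid. Qed.

Lemma artin_map_gen s : artin_map (artin_gen G0 s) = artin_gen G (i s).
Proof. exact: (artin_lift_gen artin_map_braid). Qed.

(** Over the identity representative each generator of the subgroup is a loop, so the second
    coordinate records the element: the retraction is the identity on the subgroup. *)
Lemma gact_artin_map g a :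
  gact i (artin_map g) ((fun v => v) : (S -> R) -> S -> R, a) = (fun v => v, g * a).
Proof.
have hid := min_rep_id R G i.
elim/artin_ind: g => [|s g IH|s g IH].
- by rewrite artin_map1 (gact1 hi) // mul1g.
- rewrite artin_mapM (gactM hi) // IH artin_map_gen (gact_gen hi _ (x := s)) //.
  by rewrite mulgA.
- rewrite artin_mapM artin_mapV (gactM hi) // IH artin_map_gen.
  by rewrite (gact_genV hi _ (x := s)) // mulgA.
Qed.

(* Van der Lek's theorem. *)
Theorem artin_map_inj : injective artin_map.
Proof.
move=> g h e; have := gact_artin_map g 1; rewrite e gact_artin_map !mulg1.
by case.
Qed.

Lemma special_artin_map (C : {set S0}) g :
  special G [set i x | x in C]%SET g <-> exists2 g0, special G0 C g0 & artin_map g0 = g.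
Proof.
split; last first.
  move=> [g0 hg0 <-].
  apply: (special_min (B := fun a => special G [set i x | x in C]%SET (artin_map a)) _ _ hg0).
    split=> [|x y|x]; rewrite ?artin_map1 ?artin_mapM ?artin_mapV.
    - exact: special1.
    - exact: specialM.
    - exact: specialV.
  by move=> s sC; rewrite artin_map_gen; apply: special_gen; apply: imset_f.
move=> hg; apply: (special_min (B := fun g => exists2 g0, special G0 C g0 & artin_map g0 = g) _ _ hg).
  split=> [|_ _ [x hx <-] [y hy <-]|_ [x hx <-]].
  - by exists 1; rewrite ?artin_map1 //; exact: special1.
  - by exists (x * y); rewrite ?artin_mapM //; exact: specialM.
  - by exists x^-1; rewrite ?artin_mapV //; exact: specialV.
move=> _ /imsetP[x xC ->]; exists (artin_gen G0 x); last exact: artin_map_gen.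
exact: special_gen.
Qed.

Lemma special_artin_mapE (C : {set S0}) g :
  special G [set i x | x in C]%SET (artin_map g) <-> special G0 C g.
Proof.
rewrite special_artin_map; split=> [[g0 h /artin_map_inj <-]//|h].
by exists g.
Qed.

End ArtinMap.

Section Special.
Context (S : finType) (G : lgraph S).

Lemma induced_embedding (X : {set S}) : embedding (induced G X) G val.
Proof. by split=> //; exact: val_inj. Qed.

Lemma val_preimset (X Y : {set S}) :
  [set val x | x in [set x : {x | x \in X} | val x \in Y]]%SET = X :&: Y.
Proof.
apply/setP => s; rewrite inE; apply/imsetP/andP => [[x]|[sX sY]].
  by rewrite inE => h ->; split=> //; exact: valP.
by exists (exist _ s sX); rewrite ?inE.
Qed.

Lemma special_induced (X : {set S}) g : special G X g ->
  exists a : artin (induced G X), artin_map G val a = g.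
Proof.
have {1}-> : X = [set val x | x in [set: {x | x \in X}]]%SET.
  apply/setP => s; apply/idP/imsetP => [sX|[x _ ->]]; last exact: valP.
  by exists (exist _ s sX).
by move/(special_artin_map (induced_embedding X)) => [a _ <-]; exists a.
Qed.

Lemma special_inter (X Y : {set S}) g :
  special G X g -> special G Y g -> special G (X :&: Y) g.
Proof.
move=> /special_induced[a <-] /special_induced[b hb].
have hi := induced_embedding X.
pose C := [set x : {x | x \in X} | val x \in Y].
pose P (p : ((S -> R) -> S -> R) * artin (induced G X)) :=
  [/\ min_rep G (val : {x | x \in X} -> S) p.1,
      exists2 l : seq S, {subset l <= Y} & p.1 = @actw R S G l &
      special (induced G X) C p.2].
have step (z : S * bool) p : z.1 \in Y -> P p -> P (sstep G val z p).
  move=> zY [hm [l hl el] hs]; split; first exact: (min_rep_step z hm).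
    rewrite /sstep; case: loop => [x|]; first by exists l.
    by exists (z.1 :: l); rewrite /= ?el // => y; rewrite inE => /orP[/eqP->|/hl].
  rewrite /sstep; case e: loop => [x|//] /=.
  have xC : x \in C.
    move/(loopP hi _ _ hm): e; rewrite el inE => /(congr1 (@^~ (val x))).
    case: (boolP (val x \in Y)) => // xY.
    have out (v : S -> R) : actw G l v (val x) = v (val x).
      elim: l hl {el} => //= r l IH hl; rewrite {1}/refl.
      rewrite (_ : (val x == r) = false) ?mulr0 ?subr0.
        by apply: IH => y yl; apply: hl; rewrite inE yl orbT.
      by apply/eqP => xr; move: xY; rewrite xr hl // inE eqxx.
    rewrite out !basisE eqxx; case: eqP => [exz|_ /eqP]; last by rewrite oner_eq0.
    by move: xY; rewrite exz zY.
  apply: specialM => //; rewrite /sgen; case: z.2; last apply: specialV;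
  exact: special_gen.
have hid := min_rep_id R G (val : {x | x \in X} -> S).
have hP1 : P (fun v => v, 1).
  by split=> //; [exists [::] | exact: special1].
have act c : P (gact val (artin_map G val (c : artin (induced G Y)))
                 (fun v => v, 1 : artin (induced G X))).
  elim/artin_ind: c => [|s c IH|s c IH].
  - by rewrite (artin_map1 (induced_embedding Y)) (gact1 hi).
  - rewrite (artin_mapM (induced_embedding Y)) (gactM hi) //.
    rewrite (artin_map_gen (induced_embedding Y)) -(aw_gen G (val s) true).
    rewrite (gact_aw hi); last by case: IH.
    by apply: step => //; exact: valP.
  - rewrite (artin_mapM (induced_embedding Y)) (gactM hi) //.
    rewrite (artin_mapV (induced_embedding Y)).
    rewrite (artin_map_gen (induced_embedding Y)) -(aw_gen G (val s) false).
    rewrite (gact_aw hi); last by case: IH.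
    by apply: step => //; exact: valP.
have := act b; rewrite hb (gact_artin_map hi) mulg1 => -[_ _ /= ha].
by rewrite -val_preimset; apply/(special_artin_mapE hi).
Qed.

(** At the base point s moves the coset, where its exponent is invisible: s^2 acts there like s^-1
    s. If it lay in A_Y it would therefore be 1, but its length is 2. *)
Lemma not_special_gen_sqr (Y : {set S}) s : s \notin Y ->
  ~ special G Y (artin_gen G s ^+ 2).
Proof.
move=> sY /special_induced[a ha]; have hi := induced_embedding Y.
have hid := min_rep_id R G (val : {x | x \in Y} -> S).
have := gact_artin_map hi a 1; rewrite ha -(aw_gen G s true) expg2 -aw_cat.
rewrite (gact_aw hi) //.
have e1 : sstep G val (s, true) (fun v : S -> R => v, 1 : artin (induced G Y)) =
          sstep G val (s, false) (fun v : S -> R => v, 1).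
  rewrite /sstep /=.
  have -> // : loop val (fun v : S -> R => v) s = None :> option {x | x \in Y}.
  by apply/loopN => x /basis_inj e; move: sY; rewrite -e (valP x).
rewrite /= e1 (sstepK hi s false (p := (fun v => v, 1)) hid) mulg1 => -[e2].
move: ha; rewrite -e2 (artin_map1 hi) => /(congr1 (@artin_len S G)).
by rewrite artin_len1 artin_lenX artin_len_gen.
Qed.

Lemma not_special_gen (Y : {set S}) s : s \notin Y -> ~ special G Y (artin_gen G s).
Proof. by move=> sY h; apply: (not_special_gen_sqr sY); exact: specialX. Qed.

Lemma artin_gen_inj : injective (artin_gen G).
Proof.
move=> s t e; apply/eqP/negPn/negP => st.
have : s \notin [set t] by rewrite inE.
by move/not_special_gen; apply; rewrite e; apply: special_gen; rewrite inE.
Qed.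

(** Only s gives a loop at the base point. The path is run through and back, and each run passes a
    loop once, whence the square of the generator s. *)
Lemma gact_delta_sqr (Y : {set S}) s t (sY : s \in Y) a : t \notin Y -> edge G s t ->
  gact (val : {x | x \in Y} -> S)
    (altp (artin_gen G s) (artin_gen G t) (label G s t) ^+ 2)
    ((fun v => v) : (S -> R) -> S -> R, a) =
  (fun v => v, artin_gen (induced G Y) (exist _ s sY) ^+ 2 * a).
Proof.
move=> tY st; have hi := induced_embedding Y.
have hid := min_rep_id R G (val : {x | x \in Y} -> S).
set x0 := exist _ s sY.
rewrite expg2 (gactM hi) // [gact _ _ (_, a)](gact_delta hi _ st) //.
case: (dihedralP hi st hid) => [f' _ hN _|[x [f' [hf' h h' hx]]]|x y _ hy].
- by exfalso; apply: (iffLR (@loopN R _ _ val (fun v => v) s) hN x0).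
- have {hx}ex : x0 = x by apply: (hx x0 s); rewrite ?mem_head.
  have [-> _] := h a; rewrite (gact_delta hi _ st) //.
  by have [-> _] := h' (artin_gen (induced G Y) x * a); rewrite -ex expg2 mulgA.
- by move/basis_inj: hy => e; move: tY; rewrite -e (valP y).
Qed.

End Special.

(** * Ribbons between single generators *)

Section Monoid.
Context (S : finType) (G : lgraph S).

Definition mw (u : seq S) : artin_monoid G := word_class (artin_rel G) u.

Lemma mw_cat u v : mw u * mw v = mw (u ++ v).
Proof. exact: pmul_class. Qed.

Lemma mwP u v : mw u = mw v <-> cong (artin_rel G) u v.
Proof. exact: word_classP. Qed.

Lemma mwW (P : artin_monoid G -> Prop) : (forall u, P (mw u)) -> forall x, P x.
Proof. exact: (@word_classW _ (artin_rel G)). Qed.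

Lemma cong_size u v : cong (artin_rel G) u v -> size u = size v.
Proof.
elim=> {u v} [l r _ _ [u v _]|//|//|u v w _ -> _ -> //].
by rewrite !size_cat !size_alternating.
Qed.

Lemma positive_specialP (U : {set S}) x :
  positive_special U x -> exists2 u, {subset u <= U} & x = mw u.
Proof.
move=> h; apply: (h (fun x => exists2 u, {subset u <= U} & x = mw u)); split.
  split=> [|_ _ [u hu ->] [v hv ->]]; first by exists [::].
  by exists (u ++ v); rewrite ?mw_cat // => y; rewrite mem_cat => /orP[/hu|/hv].
by move=> _ [s sU <-]; exists [:: s] => // y; rewrite inE => /eqP->.
Qed.

Lemma positive_special_mw (U : {set S}) u : {subset u <= U} ->
  positive_special U (mw u).
Proof.
elim: u => [|s u IH] hu B hB; have [[h1 hM] hg] := hB; first exact: h1.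
rewrite -[mw _]/(mw ([:: s] ++ u)) -mw_cat; apply: hM.
  by apply: hg; exists s => //; apply: hu; rewrite inE eqxx.
by apply: IH => // y yu; apply: hu; rewrite inE yu orbT.
Qed.

Lemma of_monoid_mw u : of_monoid (mw u) = aw G (positive u).
Proof.
apply/awP; have := repr_cong (artin_rel G) u; move: (repr _) => v.
elim=> {u v} [l r u v h|u|u v _|u v w _ h1 _ h2].
- rewrite /positive !map_cat; apply: cong_rel; exact: group_rel_pos.
- exact: cong_refl.
- exact: cong_sym.
- exact: cong_trans h1 h2.
Qed.

Lemma of_monoid_gen s : of_monoid (monoid_gen G s) = artin_gen G s.
Proof. exact: (of_monoid_mw [:: s]). Qed.

Lemma of_monoid_special (U : {set S}) x : positive_special U x ->
  special G U (of_monoid x).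
Proof.
move=> /positive_specialP[u hu ->]; rewrite of_monoid_mw.
elim: u hu => [|s u IH] hu; first exact: special1.
rewrite /= aw_cons; apply: specialM.
  by apply: special_gen; apply: hu; rewrite inE eqxx.
by apply: IH => y yu; apply: hu; rewrite inE yu orbT.
Qed.

Lemma delta_set0 d : is_delta (finset.set0 : {set S}) d -> d = 1 :> artin_monoid G.
Proof.
case=> /positive_specialP[[|s u] hu -> //]; have := hu s.
by rewrite inE eqxx inE => /(_ isT).
Qed.

Lemma divides_antisym (U : {set S}) x y :
  left_divides U x y -> left_divides U y x -> x = y :> artin_monoid G.
Proof.
move=> [c _ ->] [c' _ +]; elim/mwW: x => x; elim/mwW: c => c; elim/mwW: c' => c'.
rewrite !mw_cat => /mwP/cong_size; rewrite !size_cat => h.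
have -> : c = [::] by apply: size0nil; lia.
by rewrite cats0.
Qed.

Lemma left_divides_refl U x : left_divides U x (x : artin_monoid G).
Proof.
exists 1; last by rewrite mulg1.
by apply: (@positive_special_mw U [::]).
Qed.

Lemma delta_set1 s d : is_delta [set s]%SET d -> d = monoid_gen G s.
Proof.
move=> [h1 h2 h3]; apply: (@divides_antisym [set s]%SET).
  apply: h3; first by apply: (@positive_special_mw _ [:: s]) => y; rewrite !inE.
  by move=> u; rewrite inE => /eqP->; exact: left_divides_refl.
by apply: h2; rewrite inE.
Qed.

(** Such a word is too short to contain a side of a braid relation, so its congruence class is a
    single word. *)
Lemma dihedral_rigid s t u v : cong (artin_rel G) u v ->
  let ok w := {subset w <= [:: s; t]} /\ (edge G s t -> size w < label G s t) in
  ok u \/ ok v -> u = v.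
Proof.
have bad l r a b : edge G a b ->
    {subset l ++ alternating a b (label G a b) ++ r <= [:: s; t]} ->
    (edge G s t -> size (l ++ alternating a b (label G a b) ++ r) < label G s t) ->
    False.
  move=> ab; have m2 := label_ge2 ab; move em: (label G a b) m2 => m m2 hs hz.
  have sub y : y \in alternating a b m -> y \in [:: s; t].
    by move=> h; apply: hs; rewrite !mem_cat h orbT.
  have {}hs1 : a \in [:: s; t].
    by apply: sub; case: m m2 {em hz hs} => //= m _; rewrite inE eqxx.
  have hs2 : b \in [:: s; t].
    by apply: sub; case: m m2 {em hz hs} => [|[|m]] //= _; rewrite !inE eqxx orbT.
  have ne := edge_neq ab.
  have [st e] : edge G s t /\ label G s t = m.
    move: hs1 hs2 ne ab em; rewrite !inE => /orP[]/eqP-> /orP[]/eqP->; rewrite ?eqxx //.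
    by move=> _ ts; rewrite edge_sym (label_sym ts).
  by have := hz st; rewrite !size_cat size_alternating e; lia.
move=> h ok; elim: h => {u v} [l r _ _ [a b ab]|//|u v _ IH|u v w h1 IH1 h2 IH2].
- case=> -[h1 h2]; exfalso; first exact: (bad l r a b).
  apply: (bad l r b a); rewrite ?[edge G b a]edge_sym //; by rewrite -(label_sym ab).
- by move=> h; symmetry; apply: IH; tauto.
- case=> hw; first by have e := IH1 (or_introl hw); rewrite e in hw *; apply: IH2; left.
  by have e := IH2 (or_intror hw); rewrite -e in hw *; apply: IH1; right.
Qed.

(** [d] has a word starting with s and one starting with t, so by rigidity there is an edge and [d]
    has length at least m. It divides the alternating word of length m, so it equals it. *)
Lemma delta_set2 s t d : s != t -> is_delta [set t; s]%SET d ->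
  edge G s t /\ d = mw (alternating s t (label G s t)).
Proof.
move=> st [h1 h2 h3].
have sub : {subset [set t; s]%SET <= [:: s; t]} by move=> y; rewrite !inE orbC.
have [c1 /positive_specialP[u1 hu1 ->]] : left_divides [set t; s]%SET (monoid_gen G s) d.
  by apply: h2; rewrite !inE eqxx orbT.
have [c2 /positive_specialP[u2 hu2 ->]] : left_divides [set t; s]%SET (monoid_gen G t) d.
  by apply: h2; rewrite !inE eqxx.
rewrite -[monoid_gen G t]/(mw [:: t]) -[monoid_gen G s]/(mw [:: s]) !mw_cat => ed e; rewrite ed in e; rewrite e in ed; move/esym: e => e.
have [st' sz] : edge G s t /\ label G s t <= (size u1).+1.
  have key : ~ (edge G s t -> (size u1).+1 < label G s t).
    move=> h; have := dihedral_rigid (s := s) (t := t) (iffLR (mwP _ _) e).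
    have ok : {subset [:: s] ++ u1 <= [:: s; t]}.
      by move=> y; rewrite /= inE => /orP[/eqP->|/hu1/sub//]; rewrite inE eqxx.
    by move=> /(_ (or_introl (conj ok h))) [est]; rewrite est eqxx in st.
  have st' : edge G s t by apply/negPn/negP => nst; apply: key; rewrite (negPf nst).
  by split=> //; rewrite leqNgt; apply/negP => lt; apply: key.
split=> //; have m2 := label_ge2 st'; pose m := label G s t.
have eb : mw (alternating s t m) = mw (alternating t s m).
  apply/mwP; rewrite -[alternating s t _]cats0 -[alternating t s _]cats0.
  by apply: (cong_rel [::] [::]); constructor.
have pre a b : {subset [:: a; b] <= [set t; s]%SET} ->
    left_divides [set t; s]%SET (monoid_gen G a) (mw (alternating a b m)).
  move=> hab; exists (mw (alternating b a m.-1)).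
    apply: positive_special_mw => y /mem_alternating hy; apply: hab.
    by move: hy; rewrite !inE orbC.
  by rewrite -[monoid_gen G a]/(mw [:: a]) mw_cat /m -[in LHS](ltn_predK m2).
have [c _] : left_divides [set t; s]%SET d (mw (alternating s t m)).
  apply: h3.
    by apply: positive_special_mw => y /mem_alternating; rewrite !inE orbC.
  move=> u; rewrite !inE => /orP[]/eqP->.
    by rewrite eb; apply: pre => y; rewrite !inE.
  by apply: pre => y; rewrite !inE orbC.
elim/mwW: c => c; rewrite ed /= mw_cat => ec; rewrite -/m ec.
have /cong_size := iffLR (mwP _ _) ec.
rewrite size_alternating size_cat /= => hsz; have -> : c = [::].
  apply: size0nil; move: hsz sz; rewrite /m; move: (label G s t) (size u1) (size c) => a b k; clear. lia.
by rewrite cats0.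
Qed.

End Monoid.

Section SingletonRibbons.
Context (S : finType) (G : lgraph S).

Lemma conj_gens_set1 s (Y : {set S}) g : conj_set g (gens G [set s]%SET) = gens G Y ->
  exists s', Y = [set s']%SET /\ g * artin_gen G s = artin_gen G s' * g.
Proof.
move=> e.
have : gens G Y (g * artin_gen G s * g^-1).
  rewrite -e; exists (artin_gen G s) => //; exists s => //; exact/set11.
move=> [s' s'Y es']; exists s'; split; last by rewrite es' mulgVK.
apply/setP => y; rewrite inE; apply/idP/eqP => [yY|->//].
have : gens G Y (artin_gen G y) by exists y.
rewrite -e => -[_ [z zs <-] ez]; apply: (@artin_gen_inj _ G).
by rewrite es' -ez; move/set1P: zs => ->.
Qed.

Lemma dynkin_component s t : t != s ->
  component G (t |: [set s])%SET t = if dynkin G s t then [set t; s]%SET else [set t]%SET.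
Proof.
move=> ts.
have dsym : dynkin G t s = dynkin G s t.
  rewrite /dynkin eq_sym (edge_sym G t); case: (boolP (edge G s t)) => //= st.
  by rewrite (label_sym st).
apply/setP => y; rewrite [component _ _ _]/component inE.
case: ifP => d.
  apply/andP/idP => [[]//|hy]; split=> //; move: hy; rewrite !inE => /orP[]/eqP->.
    exact: connect0.
  by apply: connect1; rewrite /= !inE !eqxx orbT dsym.
rewrite !inE; apply/andP/eqP => [[_ /connectP[[//|z p] /= /andP[/and3P[_ hz dz] _] _]]|->].
  move: hz dz; rewrite !inE => /orP[]/eqP->; last by rewrite dsym d.
  by rewrite /dynkin eqxx.
by rewrite eqxx connect0.
Qed.

(** If t commutes with s, its component is {t} and the ribbon is t^-1, which is (s t)^-1 s: the
    dihedral formula with m = 2. *)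
Lemma elementary_ribbon_set1 W s (Y : {set S}) g :
  elementary_ribbon W [set s]%SET Y g ->
  exists2 t, edge G s t &
    g = (altp (artin_gen G s) (artin_gen G t) (label G s t))^-1 * artin_gen G s.
Proof.
move=> [_ _ _ [t /= [ht _ [d [e [hd he ->]]]]]]; exists t;
have ts : t != s by move: ht; rewrite !inE => /andP[].
  move: hd; rewrite dynkin_component //; case: ifP => [_|dst _].
    by case/delta_set2 => //; rewrite eq_sym.
  by move: dst; rewrite /dynkin eq_sym ts /=; case: edge; rewrite ?orbT.
move: hd he; rewrite dynkin_component //; case: ifP => [_|dst].
  move=> hd; have -> : ([set t; s] :\ t = [set s])%SET.
    apply/setP => y; rewrite !inE; case: (y =P t) => //= ->; apply/esym/negbTE.
    by rewrite ts.
  move/delta_set1 => ->; have [||st ->] := @delta_set2 _ G s t d; rewrite 1?eq_sym //.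
  by rewrite of_monoid_mw aw_alternating of_monoid_gen.
move=> /delta_set1 ->; have -> : ([set t] :\ t = finset.set0)%SET.
  by apply/setP => y; rewrite !inE; case: eqP.
move/delta_set0 => ->; rewrite of_monoid_gen.
have -> : of_monoid (1 : artin_monoid G) = 1 by exact: (of_monoid_mw G [::]).
have st : edge G s t by move: dst; rewrite /dynkin eq_sym ts /=; case: edge; rewrite ?orbT.
have -> : label G s t = 2.
  have := label_ge2 st; move: dst; rewrite /dynkin eq_sym ts st /= orbF.
  by case: ltngtP.
by rewrite !altpS altp0 mulg1 invgM mulgVK mulg1.
Qed.

Lemma spherical_set1 s : spherical (induced G [set s]%SET).
Proof.
have all1 (x y : {x | x \in [set s]%SET}) : x = y.
  by apply: val_inj; rewrite (set1P (valP x)) (set1P (valP y)).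
pose x0 : {x | x \in [set s]%SET} := exist _ s (set11 s).
pose cl u : coxeter (induced G [set s]%SET) := word_class (group_rel (coxeter_rel _)) u.
have clM u v : cl (u ++ v) = cl u * cl v by symmetry; exact: pmul_class.
have sq : cl [:: (x0, true)] * cl [:: (x0, true)] = 1.
  rewrite -clM; apply/word_classP.
  apply: (@cong_rel _ _ [::] [::] [:: (x0, true); (x0, true)] [::]).
  exact: (group_rel_pos (CoxeterSquare _ x0)).
apply: (@sub_finite_set _ _ [set 1; cl [:: (x0, true)]]%classic); last first.
  exact: finite_set2.
elim/word_classW => u _; rewrite -/(cl u); elim: u => [|[x b] u IH]; first by left.
have ex : cl [:: (x, b)] = cl [:: (x0, true)].
  rewrite (all1 x x0); case: b => //; apply: (mulgI (cl [:: (x0, true)])).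
  rewrite sq -clM; apply/word_classP.
  by apply: (@cong_rel _ _ [::] [::] [:: (x0, true); (x0, false)] [::]); constructor.
rewrite -[cl ((x, b) :: u)]/(cl ([:: (x, b)] ++ u)) clM ex.
by case: IH => ->; [right; rewrite mulg1 | left; rewrite sq].
Qed.

Lemma component_set1 s : component G [set s]%SET s = [set s]%SET.
Proof.
apply/setP => y; rewrite !inE; case: eqP => //= ->; exact: connect0.
Qed.

Lemma nonspherical_set1 s : nonspherical_part G [set s]%SET = finset.set0.
Proof.
apply/setP => y; rewrite !inE; case: eqP => //= ->; rewrite component_set1.
by apply/negbF/asboolP; exact: spherical_set1.
Qed.

Lemma spherical_part_set1 s : spherical_part G [set s]%SET = [set s]%SET.
Proof.
apply/setP => y; rewrite !inE; case: eqP => //= ->; rewrite component_set1.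
by apply/asboolP; exact: spherical_set1.
Qed.

End SingletonRibbons.

(** * Following a ribbon through the retraction *)

Section RibbonExit.
Context (S0 S : finType) (G0 : lgraph S0) (G : lgraph S) (i : S0 -> S).
Hypothesis hi : embedding G0 G i.
Context (C : {set S0}) (r : S0) (rC : r \in C).

Definition odd_within : rel S0 := [rel u v | [&& u \in C, v \in C & odd_edge G0 u v]].

Hypothesis closed : forall c t, c \in C -> connect odd_within r c -> edge G0 c t -> t \in C.

(** The invariant carried along a ribbon: s corresponds to a generator [b] of C that odd edges
    inside C join to r, and the second coordinate has stayed in A_C. By [closed], no such [b] has a
    neighbour outside C. *)
Let good (p : ((S -> R) -> S -> R) * artin G0) s : Prop :=
  min_rep G i p.1 /\ exists b, [/\ b \in C, connect odd_within r b,
    p.1 (basis R (i b)) = basis R s & special G0 C p.2].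

(** Apply both sides of h s = s' h to the state (f, 1). One side puts the generator b in the second
    coordinate, so on the other side s' must act as a loop labelled b. *)
Lemma good_loop (h : artin G) s s' f f' b : min_rep G i f -> min_rep G i f' ->
  h * artin_gen G s = artin_gen G s' * h -> f (basis R (i b)) = basis R s ->
  (forall a : artin G0, gact i h (f, a) = (f', a)) -> f' (basis R (i b)) = basis R s'.
Proof.
move=> hf hf' eh hb hh.
have := gactM hi h (artin_gen G s) (p := (f, 1 : artin G0)) hf.
rewrite (gact_gen hi _ hf hb) hh eh (gactM hi _ _ (p := (f, 1)) hf) hh.
rewrite -(aw_gen G s' true) (gact_aw hi) //= /sstep /=.
case e: loop => [y|] => -[].
  rewrite !mulg1 => /artin_gen_inj <-; exact/(loopP hi).
by rewrite mulg1 => _ /esym/artin_gen_neq1.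
Qed.

(** In the case of one loop, the factor contributed by the Garside element and that of the single
    generator cancel, so the second coordinate is unchanged. In the case of two loops, [closed] puts
    both labels in C, the second coordinate is multiplied by an element of A_C, and [b] moves along
    the edge exactly when its label is odd. *)
Lemma good_ribbon s s' t (h : artin G) : edge G s t ->
  h = (altp (artin_gen G s) (artin_gen G t) (label G s t))^-1 * artin_gen G s ->
  h * artin_gen G s = artin_gen G s' * h ->
  (forall p, good p s -> good (gact i h p) s') /\
  (forall p, good p s' -> good (gact i h^-1 p) s).
Proof.
move=> st eh hs; pose D := altp (artin_gen G s) (artin_gen G t) (label G s t).
rewrite -/D in eh.
have es' : s' = if odd (label G s t) then t else s.
  apply: (@artin_gen_inj _ G); have := gen_delta st; rewrite -/D => e.
  apply: (mulIg h); rewrite -hs eh; apply: (mulgI D); rewrite !mulgA mulgV mul1g.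
  by rewrite -e mulgK.
have eD : D = artin_gen G s * h^-1 by rewrite eh invgM invgK mulVKg.
have hV : h^-1 = D * (artin_gen G s')^-1.
  by rewrite eD -mulgA -invgM -hs invgM mulgA mulgV mul1g.
have hsV : h^-1 * artin_gen G s' = artin_gen G s * h^-1 by rewrite hV mulgVK -hV eD.
split=> -[f a] [/= hf [b [bC rb hb ha]]].
  have hD (a' : artin G0) : gact i h (f, a') = gact i D^-1 (f, artin_gen G0 b * a').
    by rewrite eh (gactM hi) // (gact_gen hi _ hf hb).
  case: (dihedralP hi st hf) => [f' _ hN _|[x [f' [hf' _ h' hx]]]|x y hx hy xy em].
  - by exfalso; apply: (iffLR (@loopN R _ _ i f s) hN b).
  - have eb : b = x by apply: (hx b s) => //; exact: mem_head.
    have hh (a' : artin G0) : gact i h (f, a') = (f', a').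
      rewrite hD eb; have [<- _] := h' a'.
      by rewrite -(gact_delta hi (p := (f', a')) hf' st) (gactK hi D (p := (f', a'))).
    rewrite hh; split=> //=; exists b; split=> //; exact: (good_loop hf hf' hs hb hh).
  - have eb : b = x by apply/(i_inj hi)/(@basis_inj R)/(min_rep_inj hf); rewrite hb hx.
    subst x.
    set D0 := altp (artin_gen G0 b) (artin_gen G0 y) (label G s t).
    have hDD (c : artin G0) : gact i D (f, c) = (f, D0 * c).
      by rewrite /D -aw_alternating (gact_aw hi) //; exact: sact_two_loops.
    have hh (a' : artin G0) : gact i h (f, a') = (f, D0^-1 * (artin_gen G0 b * a')).
      rewrite hD -[in LHS](mulVKg D0 (_ * a')) -hDD.
      exact: (gactK hi D (p := (f, _))).
    have yC := closed bC rb xy; have bsC := @special_gen _ G0 _ _ bC.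
    rewrite hh; split=> //=; exists (if odd (label G s t) then y else b).
    split; [by case: odd | | by rewrite es'; case: odd |].
      case: ifP => // om; apply: connect_trans rb _; apply: connect1.
      by rewrite /odd_within /= bC yC /odd_edge xy em om.
    apply: specialM; first by apply: specialV; apply: special_altp => //; exact: special_gen.
    exact: specialM.
have hD (a' : artin G0) : gact i h^-1 (f, a') = gact i D (f, (artin_gen G0 b)^-1 * a').
  by rewrite hV (gactM hi) // (gact_genV hi _ hf hb).
have s'st : s' \in [:: s; t] by rewrite es' !inE; case: odd; rewrite eqxx ?orbT.
case: (dihedralP hi st hf) => [f' _ hNs hNt|[x [f' [hf' h' _ hx]]]|x y hx hy xy em].
- exfalso; move: s'st; rewrite !inE => /orP[]/eqP e; rewrite e in hb.
    exact: (iffLR (@loopN R _ _ i f s) hNs b).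
  exact: (iffLR (@loopN R _ _ i f t) hNt b).
- have eb : b = x by apply: (hx b s').
  have hh (a' : artin G0) : gact i h^-1 (f, a') = (f', a').
    rewrite hD (gact_delta hi (p := (f, _)) hf st).
    by have [-> _] := h' ((artin_gen G0 b)^-1 * a'); rewrite eb mulVKg.
  rewrite hh; split=> //=; exists b; split=> //; exact: (good_loop hf hf' hsV hb hh).
- set D0 := altp (artin_gen G0 x) (artin_gen G0 y) (label G s t).
  have hDD (c : artin G0) : gact i D (f, c) = (f, D0 * c).
    by rewrite /D -aw_alternating (gact_aw hi) //; exact: sact_two_loops.
  have eb : b = if odd (label G s t) then y else x.
    apply/(i_inj hi)/(@basis_inj R)/(min_rep_inj hf); rewrite hb es'.
    by case: odd; rewrite ?hx ?hy.
  have yx : edge G0 y x by rewrite edge_sym.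
  have [xC yC] : x \in C /\ y \in C.
    move: eb; case: odd => eb; rewrite eb in bC rb.
      by split=> //; exact: (closed bC rb yx).
    by split=> //; exact: (closed bC rb xy).
  rewrite hD hDD; split=> //=; exists x; split=> //.
    move: eb; case: ifP => om eb; rewrite eb in rb => //.
    apply: connect_trans rb _; apply: connect1.
    by rewrite /odd_within /= yC xC /odd_edge yx -(label_sym xy) em om.
  have xs := @special_gen _ G0 _ _ xC; have ys := @special_gen _ G0 _ _ yC.
  apply: specialM; first exact: special_altp.
  by apply: specialM => //; apply: specialV; exact: special_gen.
Qed.

(** Both directions are proved together because [ribb_inv] exchanges them. *)
Lemma good_ribb (W X Y : {set S}) (g : artin G) : ribb W X Y g ->
  (forall s, X = [set s]%SET -> exists s', [/\ Y = [set s']%SET &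
     forall p, good p s -> good (gact i g p) s']) /\
  (forall s', Y = [set s']%SET -> exists s, [/\ X = [set s]%SET &
     forall p, good p s' -> good (gact i g^-1 p) s]).
Proof.
elim=> {X Y g} [X Y g hg|X _|X Y T g h _ [IH1 IH2] _ [IH3 IH4]|X Y g _ [IH1 IH2]].
- have [_ _ eg _] := hg; split=> [s es|s' es'].
    subst X; have [s' [-> hs]] := conj_gens_set1 eg; exists s'; split=> //.
    have [t st eh] := elementary_ribbon_set1 hg.
    by have [] := good_ribbon st eh hs.
  have eg' : conj_set g^-1 (gens G [set s']%SET) = gens G X.
    by rewrite -es' -eg -conj_setM mulVg conj_set1.
  have [s [es hs']] := conj_gens_set1 eg'; exists s; split=> //; subst X.
  have [s1 [es1 hs]] := conj_gens_set1 eg.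
  have e1 : s1 = s' by apply/set1P; rewrite -es' es1 set11.
  have [t st eh] := elementary_ribbon_set1 hg.
  by have [_] := good_ribbon st eh hs; rewrite e1.
- split=> s ->; exists s; split=> // p hp; rewrite ?invg1 (gact1 hi) //; exact: hp.1.
- split=> s es.
    have [s' [es' h1]] := IH1 _ es; have [s2 [es2 h2]] := IH3 _ es'.
    exists s2; split=> // p hp; rewrite (gactM hi); last exact: hp.1.
    exact/h2/h1.
  have [s' [es' h1]] := IH4 _ es; have [s2 [es2 h2]] := IH2 _ es'.
  exists s2; split=> // p hp; rewrite invgM (gactM hi); last exact: hp.1.
  exact/h2/h1.
- by split=> s es; rewrite ?invgK; [exact: IH2 | exact: IH1].
Qed.

End RibbonExit.

(* An element conjugating [r] into A_C without lying in A_C factors, by the ribbon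
   property, through a ribbon that leaves [C] along an edge. *)
Lemma ribbon_exit (S0 S : finType) (G0 : lgraph S0) (G : lgraph S) (i : S0 -> S)
    (C : {set S0}) r g0 : embedding G0 G i -> RP G -> r \in C ->
  special G0 C (g0 * artin_gen G0 r * g0^-1) -> ~ special G0 C g0 ->
  exists c t, [/\ c \in C, t \notin C, edge G0 c t & connect (odd_within G0 C) r c].
Proof.
move=> hi hRP rC hg ng; apply: contrapT => hn; apply: ng.
have closed c t : c \in C -> connect (odd_within G0 C) r c -> edge G0 c t -> t \in C.
  by move=> cC rc ct; apply/negPn/negP => tC; apply: hn; exists c, t.
have : (conj_set (artin_map G i g0) (special G [set i r]%SET) `<=`
        special G [set i x | x in C]%SET)%classic.
  move=> _ [x hx <-].
  have hB := conj_set_subgroup (artin_map G i g0)^-1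
     (special_subgroup G [set i x | x in C]%SET).
  have := special_min hB _ hx; case.
    move=> s /set1P->; apply/conj_setE; rewrite invgK -(artin_map_gen hi).
    rewrite -(artin_mapV hi) -!(artin_mapM hi); exact/(special_artin_mapE hi).
  by move=> z hz <-; rewrite invgK !mulgA mulgV mul1g mulgK.
rewrite hRP nonspherical_set1 spherical_part_set1.
move=> [_ [Q [_ _ [y [q [hy hq e]]]]]].
have [y0 hy0 ey0] := iffLR (special_artin_map hi C y) hy.
have eq0 : q = artin_map G i (y0^-1 * g0).
  by rewrite (artin_mapM hi) (artin_mapV hi) ey0 e mulKg.
have [hq1 _] := good_ribb hi closed hq.
have [s' [_ hs']] := hq1 _ erefl.
(* The base point is good for [i r]. The ribbon [q] keeps it good, and its second coordinate becomes
   y0^-1 g0, which is therefore in A_C. *)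
have := hs' ((fun v => v), 1); rewrite eq0 (gact_artin_map hi) mulg1 => h.
suff : special G0 C (y0^-1 * g0) by rewrite special_mull //; exact: specialV.
have [|_ [b [_ _ _ hb]]] := h; last exact: hb.
split; first exact: min_rep_id.
by exists r; split=> //; exact: special1.
Qed.

(** * Intersections of parabolic subgroups *)

Section RibbonConjugation.
Context (S : finType) (G : lgraph S).

Lemma conj_setVK (H : groupType) (g : H) (B : set H) : conj_set g^-1 (conj_set g B) = B.
Proof. by rewrite -conj_setM mulVg conj_set1. Qed.

Lemma ribb_gens (W X Y : {set S}) (g : artin G) :
  ribb W X Y g -> conj_set g (gens G X) = gens G Y.
Proof.
elim=> {X Y g} [X Y g []//|X _|X Y T g h _ e1 _ e2|X Y g _ e].
- by rewrite conj_set1.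
- by rewrite conj_setM e1.
- by rewrite -e conj_setVK.
Qed.

Lemma ribb_special (W X Y : {set S}) (g : artin G) : ribb W X Y g -> special G W g.
Proof.
elim=> {X Y g} [X Y g hg|X _|X Y T g h _ s1 _ s2|X Y g _ s1].
- have [XW _ _ [t [tW _ [d [e [[hd _ _] [he _ _] ->]]]]]] := hg.
  have UW : component G (t |: X)%SET t \subset W.
    apply/fintype.subsetP => y; rewrite [component _ _ _]/component !inE.
    case/andP => /orP[/eqP->|yX] _; last exact: (fintype.subsetP XW).
    by move: tW; rewrite inE => /andP[].
  apply: specialM; first apply: specialV.
    exact: special_mono UW _ (of_monoid_special hd).
  apply: special_mono (of_monoid_special he).
  exact: fintype.subset_trans (subsetDl _ _) UW.
- exact: special1.
- exact: specialM.
- exact: specialV.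
Qed.

Lemma perp_commute (A : {set S}) g a : special G (perp G A) g -> a \in A ->
  g * artin_gen G a = artin_gen G a * g.
Proof.
move=> hg aA; apply: (special_min (B := fun g => g * artin_gen G a = artin_gen G a * g) _ _ hg).
  split=> [|x y hx hy|x hx]; first by rewrite mul1g mulg1.
    by rewrite -mulgA hy mulgA hx mulgA.
  by apply: (mulgI x); rewrite !mulgA mulgV mul1g hx mulgK.
move=> s; rewrite inE => /'forall_implyP/(_ a aA)/andP[sa /eqP e].
by have := artin_braid sa; rewrite e !altpS !altp0 !mulg1.
Qed.

Lemma conj_special_sub (X Y : {set S}) g :
  (forall s, s \in X -> special G Y (g * artin_gen G s * g^-1)) ->
  (conj_set g (special G X) `<=` special G Y)%classic.
Proof.
move=> h x /conj_setE hx.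
have : (special G X `<=` conj_set g^-1 (special G Y))%classic.
  apply: special_min; first exact: conj_set_subgroup (special_subgroup _ _).
  by move=> s sX; apply/conj_setE; rewrite invgK; exact: h.
by move=> /(_ _ hx)/conj_setE; rewrite invgK !mulgA mulgV mul1g mulgK.
Qed.

Lemma ribb_conj_special (A X Y : {set S}) (g : artin G) : ribb (perp G A) X Y g ->
  conj_set g (special G (A :|: X)%SET) = special G (A :|: Y)%SET.
Proof.
have half X' Y' g' : ribb (perp G A) X' Y' g' ->
    (conj_set g' (special G (A :|: X')%SET) `<=` special G (A :|: Y')%SET)%classic.
  move=> hg; apply: conj_special_sub => s; rewrite inE => /orP[sA|sX].
    rewrite (perp_commute (ribb_special hg) sA) mulgK.
    by apply: special_gen; rewrite inE sA.
  have : gens G Y' (g' * artin_gen G s * g'^-1).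
    by rewrite -(ribb_gens hg); exists (artin_gen G s) => //; exists s.
  by move=> [y yY <-]; apply: special_gen; rewrite inE yY orbT.
move=> hg; apply/seteqP; split; first exact: half.
move=> x hx; have : special G (A :|: X)%SET (g^-1 * x * g).
  by apply: (half _ _ _ (ribb_inv hg)); apply/conj_setE; rewrite invgK !mulgA mulgV mul1g mulgK.
by move/conj_setE.
Qed.

Lemma parts_union (X : {set S}) :
  (nonspherical_part G X :|: spherical_part G X)%SET = X.
Proof.
by apply/setP => x; rewrite !inE -andb_orr orNb andbT.
Qed.

(** The ribbon carries the spherical generators to other generators and commutes with the
    nonspherical ones, so it takes A_T to a special subgroup of A_C; what is left of the conjugator
    lies in A_C. *)
Lemma parabolic_in_special (T C : {set S}) c : RP G ->
  (conj_set c (special G T) `<=` special G C)%classic ->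
  exists (Q : {set S}) z, [/\ Q \subset C, special G C z & conj_set c (special G T) = conj_set z (special G Q)].
Proof.
move=> hRP; rewrite hRP => -[TC [Q [QC _ [y [r [hy hr ->]]]]]].
exists (nonspherical_part G T :|: Q)%SET, y; split=> //; first by rewrite finset.subUset TC.
by rewrite conj_setM -{1}(parts_union T) (ribb_conj_special hr).
Qed.

End RibbonConjugation.

Lemma artin_map_conj_special (S0 S : finType) (G0 : lgraph S0) (G : lgraph S) (i : S0 -> S)
    (X : {set S0}) g a : embedding G0 G i ->
  conj_set (artin_map G i g) (special G [set i x | x in X]%SET) (artin_map G i a) <->
  conj_set g (special G0 X) a.
Proof.
move=> hi; rewrite !conj_setE -(artin_mapV hi) -!(artin_mapM hi).
exact: special_artin_mapE.
Qed.

(* The intersection property and the ribbon property descend to the Artin groups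
   of embedded graphs in this form. *)
Lemma embedded_parabolic_inter (S0 S : finType) (G0 : lgraph S0) (G : lgraph S)
    (i : S0 -> S) (P Q : set (artin G0)) (C : {set S0}) :
  embedding G0 G i -> PIP G -> RP G -> parabolic P -> parabolic Q ->
  (P `<=` special G0 C)%classic ->
  exists (T : {set S0}) z, [/\ T \subset C, special G0 C z & (P `&` Q)%classic = conj_set z (special G0 T)].
Proof.
move=> hi hPIP hRP [X [g ->]] [Y [h ->]] hP.
have par (Z : {set S0}) (k : artin G0) : parabolic (conj_set (artin_map G i k) (special G [set i x | x in Z]%SET)).
  by exists [set i x | x in Z]%SET, (artin_map G i k).
have [T' [c e]] := hPIP _ _ (par X g) (par Y h).
have im (Z : {set S0}) (k : artin G0) y : conj_set (artin_map G i k) (special G [set i x | x in Z]%SET) y ->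
    exists a : artin G0, artin_map G i a = y.
  move=> /conj_setE/(special_artin_map hi)[a _ ea]; exists (k * a * k^-1).
  by rewrite !(artin_mapM hi) (artin_mapV hi) ea !mulgA mulgV mul1g mulgK.
have sub : (conj_set c (special G T') `<=` special G [set i x | x in C]%SET)%classic.
  rewrite -e => y [hy _]; have [a ea] := im _ _ _ hy.
  move: hy; rewrite -ea => /(artin_map_conj_special _ _ _ hi) ha.
  apply/(special_artin_mapE hi); exact: hP.
have [Q' [z [QC hz ez]]] := parabolic_in_special hRP sub.
have [z0 hz0 ez0] := iffLR (special_artin_map hi C z) hz.
pose T := [set x | i x \in Q'].
have eQ : Q' = [set i x | x in T]%SET.
  apply/setP => y; apply/idP/imsetP => [yQ|[x]]; last by rewrite inE => h1 ->.
  have /imsetP[x xC ey] := fintype.subsetP QC _ yQ.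
  by exists x => //; rewrite inE -ey.
exists T, z0; split=> //.
  apply/fintype.subsetP => x; rewrite inE => /(fintype.subsetP QC)/imsetP[y yC].
  by move/(i_inj hi) ->.
apply/seteqP; split=> a.
  move=> [ha hb]; apply/(artin_map_conj_special _ _ _ hi).
  rewrite ez0 -eQ -ez -e.
  by split; apply/(artin_map_conj_special _ _ _ hi).
move/(artin_map_conj_special _ _ _ hi); rewrite ez0 -eQ -ez -e.
by move=> [/(artin_map_conj_special _ _ _ hi) ha /(artin_map_conj_special _ _ _ hi) hb].
Qed.

(** * Fixers of three consecutive edges *)

Section EdgeStabilisers.
Context (S : finType) (G : lgraph S).

Lemma odd_edge_sym : symmetric (odd_edge G).
Proof.
move=> u v; rewrite /odd_edge (edge_sym G u).
by case: (boolP (edge G v u)) => //= vu; rewrite (label_sym vu).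
Qed.

Lemma odd_connect_sym : connect_sym (odd_edge G).
Proof. exact: (sym_connect_sym odd_edge_sym). Qed.

Lemma connect_induced (X : {set S}) (C : {set {x | x \in X}}) a b :
  connect (odd_within (induced G X) C) a b -> connect (odd_edge G) (val a) (val b).
Proof.
move=> /connectP[p]; elim: p a => [|c p IH] a /=; first by move=> _ ->.
move=> /andP[/and3P[_ _ ac] hp] hb; apply: connect_trans (IH _ hp hb).
exact: connect1.
Qed.

Lemma special_inducedE (X Z : {set S}) (a : artin (induced G X)) : Z \subset X ->
  special G Z (artin_map G val a) <-> special (induced G X) [set x | val x \in Z]%SET a.
Proof.
move=> ZX; rewrite -(special_artin_mapE (induced_embedding G X)) val_preimset.
by rewrite (finset.setIidPr ZX).
Qed.

Lemma ribbon_exit_special (X Z : {set S}) (X' : finType) (GX' : lgraph X') g k :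
  Z \subset X -> contained_as_special G X GX' -> RP GX' -> k \in Z ->
  special G X g -> ~ special G Z g -> special G Z (g * artin_gen G k * g^-1) ->
  exists2 c, c \in induced_nbhd G X (X :\: Z) & connect (odd_edge G) k c.
Proof.
move=> ZX [i hi] hRP kZ /special_induced[g0 <-] ng hg.
have hv := induced_embedding G X; have kX := fintype.subsetP ZX _ kZ.
pose k0 : {x | x \in X} := exist _ k kX.
have [|||c [t [cZ tZ ct kc]]] := @ribbon_exit _ _ (induced G X) GX' i
    [set x | val x \in Z]%SET k0 g0 hi hRP.
- by rewrite inE.
- move: hg; rewrite -[k]/(val k0) -(artin_map_gen hv) -(artin_mapV hv) -!(artin_mapM hv).
  by move/(special_inducedE _ ZX).
- by move=> h; apply: ng; apply/(special_inducedE _ ZX).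
exists (val c); last exact: (connect_induced kc).
apply: imset_f; rewrite inE; apply/existsP; exists t.
move: tZ; rewrite !inE => tZ; rewrite tZ (valP t) /=.
by apply/orP; right; rewrite edge_sym.
Qed.

(** The conjugator lies in A_Z, hence in both factors of the splitting, so the intersections found
    in A_X and in A_Y can be brought together. *)
Lemma special_conj_inter (X Z : {set S}) (X' : finType) (GX' : lgraph X') x :
  Z \subset X -> contained_as_special G X GX' -> PIP GX' -> RP GX' -> special G X x ->
  exists (T : {set S}) z, [/\ T \subset Z, special G Z z &
    (special G Z `&` conj_set x (special G Z))%classic = conj_set z (special G T)].
Proof.
move=> ZX [i hi] hPIP hRP /special_induced[x0 <-].
have hv := induced_embedding G X; pose C := [set x : {x | x \in X} | val x \in Z]%SET.
have p1 : parabolic (special (induced G X) C) by exists C, 1; rewrite conj_set1.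
have p2 : parabolic (conj_set x0 (special (induced G X) C)) by exists C, x0.
have [T [z [TC hz e]]] := embedded_parabolic_inter hi hPIP hRP p1 p2 (fun _ h => h).
have vC : [set val x | x in C]%SET = Z by rewrite val_preimset (finset.setIidPr ZX).
exists [set val x | x in T]%SET, (artin_map G val z); split.
- by rewrite -vC; exact: imsetS.
- exact/(special_inducedE _ ZX).
apply/seteqP; split=> a.
  move=> [ha hb]; have [a0 ea] := special_induced (special_mono ZX ha); subst a.
  apply/(artin_map_conj_special _ _ _ hv); rewrite -e; split.
    exact/(special_inducedE _ ZX).
  by apply/(artin_map_conj_special _ _ _ hv); rewrite vC.
move=> h; have := h; move/conj_setE => /(special_artin_map hv)[b _ eb].
have ea : artin_map G val (z * b * z^-1) = a.
  by rewrite !(artin_mapM hv) (artin_mapV hv) eb !mulgA mulgV mul1g mulgK.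
move: h; rewrite -ea => /(artin_map_conj_special _ _ _ hv); rewrite -e => -[h1 h2].
split; first exact/(special_inducedE _ ZX).
by move/(artin_map_conj_special _ _ _ hv): h2; rewrite vC.
Qed.

Lemma edge_fixer_trivial (X Y Z : {set S}) (X' Y' : finType)
    (GX' : lgraph X') (GY' : lgraph Y') x y q :
  Z \subset X -> Z \subset Y ->
  contained_as_special G X GX' -> PIP GX' -> RP GX' ->
  contained_as_special G Y GY' -> PIP GY' -> RP GY' ->
  ~ odd_connected G (induced_nbhd G X (X :\: Z)) (induced_nbhd G Y (Y :\: Z)) ->
  special G X x -> ~ special G Z x -> special G Y y -> ~ special G Z y ->
  special G Z q -> conj_set x (special G Z) q -> conj_set y (special G Z) q -> q = 1.
Proof.
move=> ZX ZY cX pX rX cY pY rY nodd xX xZ yY yZ q1 q2 q3.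
have hv := induced_embedding G X.
have [T1 [z1 [T1Z hz1 e1]]] := special_conj_inter ZX cX pX rX xX.
have [T2 [z2 [T2Z hz2 e2]]] := special_conj_inter ZY cY pY rY yY.
have [i hi] := cX.
pose pre (T : {set S}) := [set x : {x | x \in X} | val x \in T]%SET.
have preE (T : {set S}) : T \subset Z -> [set val x | x in pre T]%SET = T.
  by move=> TZ; rewrite val_preimset; apply/finset.setIidPr/(fintype.subset_trans TZ ZX).
have [w1 ew1] := special_induced (special_mono ZX hz1).
have [w2 ew2] := special_induced (special_mono ZX hz2).
have par T w : parabolic (conj_set w (special (induced G X) (pre T))) by exists (pre T), w.
have preC a : conj_set w1 (special (induced G X) (pre T1)) a ->
    special (induced G X) (pre Z) a.
  move/(artin_map_conj_special _ _ _ hv); rewrite ew1 preE // -e1 => -[h _].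
  by move/(special_inducedE _ ZX): h.
(* Both intersections are conjugates, by elements of A_Z, of special subgroups inside A_Z. They
   therefore live in A_X, and the ambient group of X handles both. *)
have [K [z0 [KZ hz0 e]]] := embedded_parabolic_inter hi pX rX (par T1 w1) (par T2 w2) preC.
have mem a : conj_set z0 (special (induced G X) K) a <->
    [/\ special G Z (artin_map G val a), conj_set x (special G Z) (artin_map G val a) &
        conj_set y (special G Z) (artin_map G val a)].
  rewrite -e; split.
    move=> [/(artin_map_conj_special _ _ _ hv) + /(artin_map_conj_special _ _ _ hv)].
    by rewrite ew1 ew2 !preE // -e1 -e2 => -[? ?] [? ?].
  move=> [h1 h2 h3]; split; apply/(artin_map_conj_special _ _ _ hv).
    by rewrite ew1 preE // -e1.
  by rewrite ew2 preE // -e2.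
have [q0 eq0] := special_induced (special_mono ZX q1); subst q.
have hq0 : conj_set z0 (special (induced G X) K) q0 by apply/mem.
case: (set_0Vmem K) => [K0|[k kK]].
  move/conj_setE: hq0; rewrite K0.
  move/special_set0 => /(congr1 (fun b => z0 * b * z0^-1)).
  by rewrite !mulgA mulgV mul1g mulgK mulg1 mulgV => ->; rewrite (artin_map1 hv).
exfalso; apply: nodd.
have kZ : val k \in Z by have := fintype.subsetP KZ _ kK; rewrite inE.
have hz0' : special G Z (artin_map G val z0) by apply/(special_inducedE _ ZX).
have [h1 h2 h3] : [/\ special G Z (artin_map G val z0 * artin_gen G (val k) * (artin_map G val z0)^-1),
    conj_set x (special G Z) (artin_map G val z0 * artin_gen G (val k) * (artin_map G val z0)^-1) &
    conj_set y (special G Z) (artin_map G val z0 * artin_gen G (val k) * (artin_map G val z0)^-1)].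
  rewrite -(artin_map_gen hv) -(artin_mapV hv) -!(artin_mapM hv); apply/mem/conj_setE.
  by rewrite !mulgA mulVg mul1g mulgVK; exact: special_gen.
have exit (W : {set S}) (W' : finType) (GW' : lgraph W') w : Z \subset W ->
    contained_as_special G W GW' -> RP GW' -> special G W w -> ~ special G Z w ->
    conj_set w (special G Z) (artin_map G val z0 * artin_gen G (val k) * (artin_map G val z0)^-1) ->
    exists2 c, c \in induced_nbhd G W (W :\: Z) & connect (odd_edge G) (val k) c.
  move=> ZW cW rW wW wZ /conj_setE hw.
  (* The conjugate of k by [z0] lies in w A_Z w^-1, so w^-1 z0 conjugates k into A_Z; it is outside
     A_Z because w is and [z0] is not. *)
  apply: (@ribbon_exit_special W Z W' GW' (w^-1 * artin_map G val z0)) => //.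
  - by apply: specialM; [exact: specialV | exact: (special_mono ZW)].
  - by rewrite special_mulr // specialVE.
  - by move: hw; rewrite invgM invgK !mulgA.
have [c hc kc] := exit _ _ _ _ ZX cX rX xX xZ h2.
have [c' hc' kc'] := exit _ _ _ _ ZY cY rY yY yZ h3.
exists c, c'; split=> //; apply: connect_trans kc'.
by rewrite odd_connect_sym.
Qed.

End EdgeStabilisers.

(** * Bass-Serre graphs of amalgams *)

Section Cocycles.
Context (H : groupType).

(* The semidirect product of [H] with the boolean functions on [H]; homomorphisms
   into it over [H] are cocycles. *)
Definition cocycle_group : Type := (H * (H -> bool))%type.
HB.instance Definition _ := gen_eqMixin cocycle_group.
HB.instance Definition _ := gen_choiceMixin cocycle_group.

Definition cocycle_mul (a b : cocycle_group) : cocycle_group :=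
  (a.1 * b.1, fun g => b.2 g (+) a.2 (b.1 * g)).
Definition cocycle_one : cocycle_group := (1, fun=> false).
Definition cocycle_inv (a : cocycle_group) : cocycle_group :=
  (a.1^-1, fun g => a.2 (a.1^-1 * g)).

Lemma cocycle_mulA : associative cocycle_mul.
Proof.
move=> a b c; rewrite /cocycle_mul /= mulgA; congr pair.
by apply: funext => g; rewrite addbA mulgA.
Qed.

Lemma cocycle_mul1g : left_id cocycle_one cocycle_mul.
Proof.
by case=> a p; rewrite /cocycle_mul /= mul1g; congr pair; apply: funext => g; rewrite addbF.
Qed.

Lemma cocycle_mulg1 : right_id cocycle_one cocycle_mul.
Proof.
by case=> a p; rewrite /cocycle_mul /= mulg1; congr pair; apply: funext => g; rewrite mul1g.
Qed.

Lemma cocycle_mulVg : left_inverse cocycle_one cocycle_inv cocycle_mul.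
Proof.
case=> a p; rewrite /cocycle_mul /= mulVg; congr pair.
by apply: funext => g; rewrite mulKg addbb.
Qed.

Lemma cocycle_mulgV : right_inverse cocycle_one cocycle_inv cocycle_mul.
Proof.
by case=> a p; rewrite /cocycle_mul /= mulgV; congr pair; apply: funext => g; rewrite addbb.
Qed.

HB.instance Definition _ := isGroup.Build cocycle_group
  cocycle_mulA cocycle_mul1g cocycle_mulg1 cocycle_mulVg cocycle_mulgV.

End Cocycles.

(* The potential which jumps exactly across the edge D of the Bass-Serre graph:
   removing that edge disconnects its endpoints. *)
Lemma amalgam_potential (H : groupType) (B C D : set H) : is_amalgam B C D ->
  exists phiB phiC : H -> bool, [/\ forall g b, B b -> phiB (g * b) = phiB g,
    forall g c, C c -> phiC (g * c) = phiC g &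
    forall g, phiB g (+) phiC g = `[< D g >]].
Proof.
move=> [sB sC sD DBC univ].
have [_ DM DV] := sD; have [_ BM BV] := sB; have [_ CM CV] := sC.
have Dl d g : D d -> `[< D (d * g) >] = `[< D g >].
  move=> hd; apply/asboolP/asboolP => h; last exact: DM.
  by rewrite -[g](mulKg d); apply: DM => //; exact: DV.
(* The trivial cocycle on B and the coboundary of the indicator of D on C. They agree on D because
   the indicator is invariant under left translation by D. *)
pose f b : cocycle_group H := (b, fun=> false).
pose k c : cocycle_group H := (c, fun g => `[< D g >] (+) `[< D (c * g) >]).
have hf : hom_on B f.
  by move=> x y _ _; congr pair; apply: funext => g.
have hk : hom_on C k.
  move=> x y _ _; congr pair; apply: funext => g /=.
  by rewrite -mulgA -addbA; congr (_ (+) _); rewrite addbA addbb.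
have hfk x : D x -> f x = k x.
  by move=> hx; congr pair; apply: funext => g; rewrite Dl // addbb.
have [h [[hM hB hC] _]] := univ _ f k hf hk hfk.
(* The first component of [h] extends the inclusions of B and C into H, so by uniqueness it is the
   identity. *)
have h1 x : (h x).1 = x.
  have [id' [_ uniq]] := univ H id id (fun _ _ _ _ => erefl) (fun _ _ _ _ => erefl) (fun _ _ => erefl).
  have e1 : id' = id by apply: uniq; split.
  have e2 : id' = (fun x => (h x).1).
    apply: uniq; split=> [y z _ _|y /hB -> //|y /hC -> //].
    by rewrite hM.
  by rewrite -[RHS]/(id x) -e1 e2.
(* Inversion turns a right factor in B into a left one, where the cocycle vanishes; adding the
   indicator does the same for C. *)
exists (fun g => (h g^-1).2 1), (fun g => (h g^-1).2 1 (+) `[< D g^-1 >]); split.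
- by move=> g b hb; rewrite invgM hM // (hB _ (BV _ hb)) /= addbF.
- move=> g c hc; rewrite invgM hM // (hC _ (CV _ hc)) /= h1 mulg1.
  by rewrite -!addbA; rewrite addbb addbF.
- move=> g; rewrite addbA addbb /=; apply/asboolP/asboolP => /DV; by rewrite ?invgK.
Qed.

Section BassSerreGraph.
Context (H : groupType) (B C D : set H).
Hypotheses (sB : is_subgroup B) (sC : is_subgroup C) (sD : is_subgroup D).
Hypothesis (DBC : (D `<=` B `&` C)%classic).

Lemma translateP (E : set H) g x : translate g E x <-> E (g^-1 * x).
Proof.
split=> [[y Ey <-]|h]; first by rewrite mulKg.
by exists (g^-1 * x) => //; rewrite mulVKg.
Qed.

Lemma translate_eq (E : set H) g h : is_subgroup E ->
  translate g E = translate h E <-> E (g^-1 * h).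
Proof.
move=> [E1 EM EV]; split=> [e|gh].
  by apply/translateP; rewrite e; apply/translateP; rewrite mulVg.
apply/seteqP; split=> x /translateP hx; apply/translateP.
  by have := EM _ _ (EV _ gh) hx; rewrite invgM invgK mulgA mulgK.
by have := EM _ _ gh hx; rewrite mulgA mulgK.
Qed.

Definition mkcoset (E : set H) g : lcoset E := exist _ (translate g E) (ex_intro _ g erefl).

Lemma lcosetP (E : set H) (K : lcoset E) : exists g, K = mkcoset E g.
Proof. by case: K => K [g e]; exists g; apply: lcoset_eq. Qed.

Lemma mkcoset_eq (E : set H) g h : is_subgroup E ->
  mkcoset E g = mkcoset E h <-> E (g^-1 * h).
Proof.
move=> sE; rewrite -translate_eq //; split=> [/(congr1 sval)//|e].
exact: lcoset_eq.
Qed.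

Lemma move_mkcoset (E : set H) q g : lcoset_move q (mkcoset E g) = mkcoset E (q * g).
Proof. by apply: lcoset_eq; rewrite /= translateM. Qed.

Lemma fix_mkcoset (E : set H) q g : is_subgroup E ->
  lcoset_move q (mkcoset E g) = mkcoset E g <-> E (g^-1 * q * g).
Proof.
move=> sE; rewrite move_mkcoset mkcoset_eq //; have [_ _ EV] := sE.
split=> /EV; first by rewrite !invgM !invgK mulgA.
by rewrite !invgM !invgK mulgA.
Qed.

Lemma joinedP (E : lcoset B) (F : lcoset C) :
  bs_joined D E F <-> exists k, E = mkcoset B k /\ F = mkcoset C k.
Proof.
split=> [[K sK]|[k [-> ->]]]; last first.
  exists (mkcoset D k) => x /translateP/DBC[hB hC].
  by split; apply/translateP.
have [k eK] := lcosetP K; subst K; exists k.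
have kk : sval (mkcoset D k) k by apply/translateP; rewrite mulVg; case: sD.
have [] := sK _ kk; have [g ->] := lcosetP E; have [h ->] := lcosetP F.
by move=> /translateP hE /translateP hF; split; apply/mkcoset_eq.
Qed.

Lemma bass_serre_acylindrical :
  (forall x, B x -> C x -> D x) ->
  (forall b c q, B b -> ~ D b -> C c -> ~ D c -> D q -> conj_set b D q ->
     conj_set c D q -> q = 1) ->
  acylindrical (bass_serre B C D).
Proof.
move=> BCD triv; exists 3, 1%N; split=> // n p n3 [padj pinj].
suff sub : (path_stabiliser n p `<=` [set 1])%classic.
  by rewrite -(card_le_eqr (@card_set1 _ (1 : H))); exact: subset_card_le.
move=> q hq.
(* The middle edge is kD, with ends kB and kC; the outer vertices are k b C and k c B with b in B
   and c in C. As the path does not backtrack, b and c are outside D, and conjugation by k^-1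
   reduces to [triv]. *)
have core (E : lcoset B) (F : lcoset C) (E3 : lcoset B) (F0 : lcoset C) : bs_joined D E F -> bs_joined D E F0 -> bs_joined D E3 F ->
    F0 <> F -> E3 <> E -> lcoset_move q E = E -> lcoset_move q F = F ->
    lcoset_move q F0 = F0 -> lcoset_move q E3 = E3 -> q = 1.
  move=> /joinedP[k [-> ->]] /joinedP[k0 [e0 ->]] /joinedP[k3 [-> e3]].
  move=> nF nE /(fix_mkcoset _ _ sB) q1 /(fix_mkcoset _ _ sC) q2.
  move=> /(fix_mkcoset _ _ sC) q0 /(fix_mkcoset _ _ sB) q3.
  have b0 : B (k^-1 * k0) by apply/(mkcoset_eq _ _ sB).
  have c3 : C (k^-1 * k3) by apply/(mkcoset_eq _ _ sC).
  have [_ BM BV] := sB; have [_ CM CV] := sC.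
  have : k^-1 * q * k = 1.
    apply: (triv (k^-1 * k0) (k^-1 * k3)) => //.
    - move=> /DBC[_ h]; apply: nF; apply/esym/(mkcoset_eq _ _ sC) => //.
    - move=> /DBC[h _]; apply: nE; apply/esym/(mkcoset_eq _ _ sB) => //.
    - exact: BCD.
    - apply/conj_setE; apply: BCD; last by move: q0; rewrite invgM invgK !mulgA !mulgK.
      by apply: (BM _ _ (BM _ _ (BV _ b0) q1) b0).
    - apply/conj_setE; apply: BCD; first by move: q3; rewrite invgM invgK !mulgA !mulgK.
      by apply: (CM _ _ (CM _ _ (CV _ c3) q2) c3).
  move=> /(congr1 (fun x => k * x * k^-1)).
  by rewrite !mulgA mulgV mul1g mulgK mulg1 mulgV.
have a0 := padj 0 (ltnW (ltnW n3)); have a1 := padj 1%N (ltnW n3); have a2 := padj 2%N n3.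
have d02 : p 0 <> p 2 by move/pinj; rewrite (ltnW n3) => /(_ isT isT).
have d13 : p 1%N <> p 3 by move/pinj; rewrite n3 (ltnW (ltnW n3)) => /(_ isT isT).
have f0 := hq 0 isT; have f1 := hq 1%N (ltnW (ltnW n3)).
have f2 := hq 2 (ltnW n3); have f3 := hq 3 n3.
move: a0 a1 a2 d02 d13 f0 f1 f2 f3.
case: (p 0) => [E0|F0]; case: (p 1%N) => [E1|F1] //; case: (p 2) => [E2|F2] //;
  case: (p 3) => [E3|F3] // /= a0 a1 a2 d02 d13 [f0] [f1] [f2] [f3].
- apply: (core E2 F1 E0 F3) => //; first by move=> e; apply: d13; rewrite e.
  by move=> e; apply: d02; rewrite e.
- apply: (core E1 F2 E3 F0) => //; first by move=> e; apply: d02; rewrite e.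
  by move=> e; apply: d13; rewrite e.
Qed.

Lemma no_fixpoint : B <> setT -> C <> setT -> ~ has_global_fixpoint (bass_serre B C D).
Proof.
have main (E : set H) (K : lcoset E) : is_subgroup E -> E <> setT ->
    ~ forall g, lcoset_move g K = K.
  move=> sE nE hK; apply: nE; apply/seteqP; split=> // x _.
  have [g eK] := lcosetP K; have := hK (g * x * g^-1); rewrite eK.
  by move/(fix_mkcoset _ _ sE); rewrite !mulgA mulVg mul1g mulgVK.
move=> nB nC [[E|F] hv].
  by apply: (main B E) => // g; case: (hv g).
by apply: (main C F) => // g; case: (hv g).
Qed.

End BassSerreGraph.

(** An invariant line can be shown to pass through the vertex B, and invariance under B puts all its
    neighbours b C on the line. The neighbours C, x C and x^2 C are distinct, but by the potential
    each of the two rays leaving the vertex contains at most one neighbour. *)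
Lemma no_invariant_line (H : groupType) (B C D : set H) x : is_amalgam B C D ->
  B x -> ~ C x -> ~ C (x ^+ 2) -> ~ has_invariant_line (bass_serre B C D).
Proof.
move=> hA Bx Cx Cx2 [l [linj ladj linv]].
have [sB sC sD DBC _] := hA; have [phiB [phiC [hB hC hD]]] := amalgam_potential hA.
have [B1 BM BV] := sB; have [_ CM CV] := sC; have [D1 _ _] := sD.
pose rep (E : set H) (K : lcoset E) := sval (cid (svalP K)).
have repE (E : set H) (K : lcoset E) : K = mkcoset E (rep E K).
  by apply: lcoset_eq; rewrite /rep; case: cid => g.
(* The potential translated so as to jump exactly across the edge e D. It is read off a chosen
   representative, and right invariance removes the choice. *)
pose psi e (v : bs_vertex B C) := match v with
  | inl E => phiB (e^-1 * rep B E) | inr F => phiC (e^-1 * rep C F) end.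
have psiB e g : psi e (inl (mkcoset B g)) = phiB (e^-1 * g).
  have hr : B ((rep B (mkcoset B g))^-1 * g).
    by apply/(mkcoset_eq _ _ sB); rewrite -repE.
  by rewrite /= -(hB _ _ hr) -mulgA mulVKg.
have psiC e g : psi e (inr (mkcoset C g)) = phiC (e^-1 * g).
  have hr : C ((rep C (mkcoset C g))^-1 * g).
    by apply/(mkcoset_eq _ _ sC); rewrite -repE.
  by rewrite /= -(hC _ _ hr) -mulgA mulVKg.
pose v0 : bs_vertex B C := inl (mkcoset B 1).
(* For e in B the edge e D ends at [v0], so [psi e] does not change along edges avoiding [v0]. *)
have psi_adj e v w : B e -> bs_adj D v w -> v <> v0 -> w <> v0 -> psi e v = psi e w.
  move=> Be.
  have core E F : bs_joined D E F -> inl E <> v0 -> psi e (inl E) = psi e (inr F).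
    move=> /(joinedP sB sC sD DBC)[k [-> ->]] nk; rewrite psiB psiC.
    have nD : ~ D (e^-1 * k).
      move=> /DBC[h _]; apply: nk; congr inl; apply/(mkcoset_eq _ _ sB); rewrite mulg1.
      by apply: BV; rewrite -[k](mulVKg e); apply: BM.
    by have := hD (e^-1 * k); rewrite asboolF //; case: (phiB _); case: (phiC _).
  case: v w => [E|F] [E'|F'] // hj hv hw; first exact: core.
  by symmetry; exact: core.
have [m0 em0] : exists m, l m = v0.
  have [m [E eE]] : exists m E, l m = inl E.
    have := ladj 0%R; case e0: (l 0%R) => [E|F]; first by exists 0%R, E.
    by case e1: (l (0 + 1)%R) => [E'|F'] //= _; exists (0 + 1)%R, E'.
  have [g eg] := lcosetP E; have [m' em'] := linv g^-1 m; exists m'.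
  by rewrite -em' eE eg /= move_mkcoset mulVg.
have const (f : nat -> bs_vertex B C) e : B e -> (forall n, bs_adj D (f n) (f n.+1)) ->
    (forall n, f n <> v0) -> forall n, psi e (f n) = psi e (f 0).
  by move=> Be fadj fn0; elim=> // n <-; symmetry; apply: psi_adj.
have up e : B e -> forall n : nat, psi e (l (m0 + 1 + n%:Z)%R) = psi e (l (m0 + 1)%R).
  move=> Be n; rewrite (const (fun n : nat => l (m0 + 1 + n%:Z)%R) e Be) ?addr0 //.
    move=> k; have := ladj (m0 + 1 + k%:Z)%R.
    by rewrite (_ : (m0 + 1 + k%:Z + 1 = m0 + 1 + k.+1%:Z)%R) //; lia.
  by move=> k; rewrite -em0 => /linj; lia.
have down e : B e -> forall n : nat, psi e (l (m0 - 1 - n%:Z)%R) = psi e (l (m0 - 1)%R).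
  move=> Be n; rewrite (const (fun n : nat => l (m0 - 1 - n%:Z)%R) e Be) ?subr0 //.
    move=> k; apply: bs_adj_sym; have := ladj (m0 - 1 - k.+1%:Z)%R.
    by rewrite (_ : (m0 - 1 - k.+1%:Z + 1 = m0 - 1 - k%:Z)%R) //; lia.
  by move=> k; rewrite -em0 => /linj; lia.
have orbit b : B b -> exists2 n, n <> m0 & l n = inr (mkcoset C b).
  move=> Bb; have := ladj m0; rewrite em0; case e1: (l (m0 + 1)%R) => [//|F].
  move=> /(joinedP sB sC sD DBC)[k [ek eF]].
  have Bk : B k by have := iffLR (mkcoset_eq _ _ sB) ek; rewrite invg1 mul1g.
  have [n en] := linv (b * k^-1) (m0 + 1)%R; exists n.
    by move=> nm; move: en; rewrite nm em0 e1.
  by rewrite -en e1 eF /= move_mkcoset mulgVK.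
(* Among the neighbours of [v0], only b C is separated from it by the edge b D. *)
have side b b' n n' : B b -> B b' -> ~ C (b^-1 * b') -> l n = inr (mkcoset C b) ->
    l n' = inr (mkcoset C b') -> psi b (l n) <> psi b (l n').
  move=> hb hb' nC -> ->; rewrite !psiC => e.
  have eqB a : B a -> phiB (b^-1 * a) = phiB b^-1.
    by move=> ha; rewrite hB.
  have e1 := hD (b^-1 * b); have e2 := hD (b^-1 * b').
  have nD : ~ D (b^-1 * b') by move=> /DBC[].
  by move: e1; rewrite eqB // e -(eqB b') // e2 mulVg (asboolT D1) (asboolF nD).
have same b b' n n' : B b -> B b' -> ~ C (b^-1 * b') -> l n = inr (mkcoset C b) ->
    l n' = inr (mkcoset C b') -> ((m0 < n) == (m0 < n'))%R -> n <> m0 -> n' <> m0 -> False.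
  move=> hb hb' nC en en' s nm n'm; apply: (side b b' n n') => //.
  have hup (k : int) : (m0 < k)%R -> psi b (l k) = psi b (l (m0 + 1)%R).
    move=> mk; rewrite -(up b hb (absz (k - m0 - 1)%R)); congr (psi b (l _)); lia.
  have hdown (k : int) : ~~ (m0 < k)%R -> k <> m0 -> psi b (l k) = psi b (l (m0 - 1)%R).
    move=> mk nk; rewrite -(down b hb (absz (m0 - 1 - k)%R)); congr (psi b (l _)); lia.
  move: s; case: (boolP (m0 < n)%R) => h1; case: (boolP (m0 < n')%R) => h2 // _.
    by rewrite !hup.
  by rewrite !hdown.
have [n0 n0m e0] := orbit 1 B1.
have [n1 n1m e1] := orbit x Bx.
have [n2 n2m e2] := orbit (x ^+ 2) (BM _ _ Bx Bx).
have c01 : ~ C (1^-1 * x) by rewrite invg1 mul1g.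
have c02 : ~ C (1^-1 * x ^+ 2) by rewrite invg1 mul1g.
have c12 : ~ C (x^-1 * x ^+ 2) by rewrite expg2 mulKg.
case: (boolP ((m0 < n0) == (m0 < n1))%R) => [s|s1]; first exact: (same _ _ _ _ B1 Bx c01 e0 e1 s).
case: (boolP ((m0 < n0) == (m0 < n2))%R) => [s|s2].
  exact: (same _ _ _ _ B1 (BM _ _ Bx Bx) c02 e0 e2 s).
apply: (same _ _ _ _ Bx (BM _ _ Bx Bx) c12 e1 e2) => //.
by move: s1 s2; do 3!case: (_ < _)%R.
Qed.

(** * The splitting *)

Lemma altp_morph (H T : groupType) (h : H -> T) (x y : H) k :
  {morph h : x y / x * y} -> h (altp x y k) = altp (h x) (h y) k.
Proof.
move=> hM; have h1 : h 1 = 1 by apply: (mulgI (h 1)); rewrite -hM !mulg1.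
by elim: k x y => [|k IH] x y; rewrite ?altp0 // !altpS hM IH.
Qed.

(** * No odd edge crosses the splitting *)

Section CrossEdges.
Context (S : finType) (G : lgraph S) (X Y : {set S}).
Hypothesis hA : is_amalgam (special G X) (special G Y) (special G (X :&: Y)).

Let same_side u v := ((u \in X) && (v \in X)) || ((u \in Y) && (v \in Y)).

Fact cut_edge_sym : symmetric [rel u v | edge G u v && same_side u v].
Proof. by move=> u v /=; rewrite edge_sym /same_side ![(u \in _) && _]andbC. Qed.

Fact cut_edge_irr : irreflexive [rel u v | edge G u v && same_side u v].
Proof. by move=> u /=; rewrite edge_irr. Qed.

Fact cut_label_sym u v : [rel u v | edge G u v && same_side u v] u v -> label G u v = label G v u.
Proof. by move=> /andP[/label_sym]. Qed.

Fact cut_label_ge2 u v : [rel u v | edge G u v && same_side u v] u v -> 2 <= label G u v.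
Proof. by move=> /andP[/label_ge2]. Qed.

(** The graph without the edges from X \ Y to Y \ X. The inclusions of A_X and A_Y into its Artin
    group agree on A_Z, so the pushout property maps A_S to it; an odd edge across would impose its
    braid relation on two generators that are not adjacent there. *)
Definition cut_graph : lgraph S :=
  LGraph cut_edge_sym cut_edge_irr cut_label_sym cut_label_ge2.

Lemma cut_embedding (W : {set S}) : (W == X) || (W == Y) ->
  embedding (induced G W) cut_graph val.
Proof.
move=> hW; split; [exact: val_inj | | by []].
move=> u v /=; rewrite /same_side.
have hu : sval u \in W := valP u; have hv : sval v \in W := valP v.
move: (sval u) (sval v) hu hv => a b; case/orP: hW => /eqP-> -> ->.
  by rewrite /= andbT.
by rewrite /= orbT andbT.
Qed.

(** A homomorphism on A_W has to be given as a function on the whole group; the default value 1 is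
    taken outside A_W. *)
Definition to_cut (W : {set S}) (g : artin G) : artin cut_graph :=
  artin_map cut_graph val (xget 1 [set a : artin (induced G W) | artin_map G val a = g]%classic).

Lemma to_cut_map (W : {set S}) (a : artin (induced G W)) :
  to_cut W (artin_map G val a) = artin_map cut_graph val a.
Proof.
rewrite /to_cut; congr artin_map; case: xgetP => [b _ /(artin_map_inj (induced_embedding G W)) //|].
by move=> h; case: (h a).
Qed.

Lemma to_cut_hom (W : {set S}) : (W == X) || (W == Y) -> hom_on (special G W) (to_cut W).
Proof.
move=> hW _ _ /special_induced[a <-] /special_induced[b <-].
rewrite -(artin_mapM (induced_embedding G W)) !to_cut_map.
exact: (artin_mapM (cut_embedding hW)).
Qed.

Lemma to_cut_gen (W : {set S}) s : (W == X) || (W == Y) -> s \in W ->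
  to_cut W (artin_gen G s) = artin_gen cut_graph s.
Proof.
move=> hW sW; rewrite -[s]/(val (exist _ s sW : {x | x \in W})).
rewrite -(artin_map_gen (induced_embedding G W)) to_cut_map.
exact: (artin_map_gen (cut_embedding hW)).
Qed.

Lemma hom_on1 (H T : groupType) (B : set H) (f : H -> T) : is_subgroup B -> hom_on B f -> f 1 = 1.
Proof. by move=> [B1 _ _] hf; apply: (mulgI (f 1)); rewrite -hf // !mulg1. Qed.

Lemma hom_onV (H T : groupType) (B : set H) (f : H -> T) x : is_subgroup B -> hom_on B f ->
  B x -> f x^-1 = (f x)^-1.
Proof.
move=> sB hf hx; have [_ _ BV] := sB; apply: (mulgI (f x)).
by rewrite -hf ?mulgV ?(hom_on1 sB hf) //; exact: BV.
Qed.

Lemma to_cut_agree g : special G (X :&: Y) g -> to_cut X g = to_cut Y g.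
Proof.
have hX := @to_cut_hom X; have hY := @to_cut_hom Y; rewrite !eqxx ?orbT in hX hY.
have {hX}hX := hX isT; have {hY}hY := hY isT.
have sX := special_subgroup G X; have sY := special_subgroup G Y.
move=> hg; suff : [/\ special G X g, special G Y g & to_cut X g = to_cut Y g] by case.
apply: (special_min (B := fun g => [/\ special G X g, special G Y g & to_cut X g = to_cut Y g]) _ _ hg).
  split=> [|x y [x1 x2 x3] [y1 y2 y3]|x [x1 x2 x3]].
  - by rewrite (hom_on1 sX hX) (hom_on1 sY hY); split=> //; exact: special1.
  - by rewrite hX // hY // x3 y3; split=> //; exact: specialM.
  - by rewrite (hom_onV sX hX) // (hom_onV sY hY) // x3; split=> //; exact: specialV.
move=> s; rewrite inE => /andP[xX xY].
by rewrite !to_cut_gen ?eqxx ?orbT //; split=> //; exact: special_gen.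
Qed.

Fact no_edge_label (T : finType) (u v : T) : [rel u v : T | false] u v -> 0 = 0 :> nat.
Proof. by []. Qed.

Fact no_edge_label2 (T : finType) (u v : T) : [rel u v : T | false] u v -> 2 <= 0.
Proof. by []. Qed.

Definition edgeless (T : finType) : lgraph T :=
  @LGraph T [rel u v | false] (fun _ _ => 0) (fun _ _ => erefl) (fun _ => erefl)
    (@no_edge_label T) (@no_edge_label2 T).

(** [phi] counts the occurrences of [true], which differ by one in the two words when k is odd. *)
Lemma edgeless_altp_odd k : odd k ->
  altp (artin_gen (edgeless bool) true) (artin_gen (edgeless bool) false) k <>
  altp (artin_gen (edgeless bool) false) (artin_gen (edgeless bool) true) k.
Proof.
pose phi (b : bool) : mint := (nat_of_bool b)%:Z%R.
have hphi u v : edge (edgeless bool) u v ->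
  altp (phi u) (phi v) (label (edgeless bool) u v) =
  altp (phi v) (phi u) (label (edgeless bool) u v) by [].
move=> ok /(congr1 (artin_lift phi)).
rewrite !(altp_morph _ _ _ (artin_liftM hphi)) !(artin_lift_gen hphi).
have cnt j : altp (phi true) (phi false) j = (uphalf j)%:Z%R /\
             altp (phi false) (phi true) j = (j./2)%:Z%R.
  elim: j => [|j [IH1 IH2]]; first by rewrite !altp0.
  by rewrite !altpS IH1 IH2; split; [exact: esym (intS _) | exact: add0r].
have [-> ->] := cnt k; rewrite uphalf_half ok => -[].
by move/eqP; rewrite -[X in _ == X]add0n eqn_add2r.
Qed.

Lemma cross_edge_even x y : x \in X -> x \notin Y -> y \in Y -> y \notin X ->
  ~~ odd_edge G x y.
Proof.
move=> xX xY yY yX; apply/negP => /andP[xy om].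
have [_ _ _ _ univ] := hA.
have hX : (X == X) || (X == Y) by rewrite eqxx.
have hY : (Y == X) || (Y == Y) by rewrite eqxx orbT.
have [h [[hM hfX hfY] _]] := univ _ _ _ (to_cut_hom hX) (to_cut_hom hY) to_cut_agree.
have hM' : {morph h : g g' / g * g'} by move=> g g'; apply: hM.
have hx : h (artin_gen G x) = artin_gen cut_graph x.
  by rewrite hfX ?to_cut_gen //; exact: special_gen.
have hy : h (artin_gen G y) = artin_gen cut_graph y.
  by rewrite hfY ?to_cut_gen //; exact: special_gen.
have := congr1 h (artin_braid xy); rewrite !(altp_morph _ _ _ hM') hx hy.
pose i (b : bool) := if b then x else y.
have hi : embedding (edgeless bool) cut_graph i.
  split=> //.
    have xny : x <> y by move=> e; move: yX; rewrite -e xX.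
    by case=> -[] //= e; case: xny.
  by case=> -[] /=; rewrite ?edge_irr // /same_side (negPf xY) (negPf yX) ?andbF.
rewrite -[artin_gen cut_graph x](artin_map_gen hi true).
rewrite -[artin_gen cut_graph y](artin_map_gen hi false).
rewrite -!(altp_morph _ _ _ (artin_mapM hi)) => /(artin_map_inj hi).
exact: edgeless_altp_odd.
Qed.

End CrossEdges.

Lemma conj_expg_mul (H : groupType) (a b : H) k :
  a^-1 * (a * b) ^+ k * a = (b * a) ^+ k.
Proof.
elim: k => [|k IH]; first by rewrite mulg1 mulVg.
by rewrite [RHS]expgS -IH [in LHS]expgS !mulgA mulVg mul1g mulgK.
Qed.

(** * A line fixed by infinitely many elements *)

Section FixedAxis.
Context (S : finType) (G : lgraph S).

(** Over the base point b acts like the element c of A_X. If (a b)^n lay in A_X, the retraction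
    would make it equal to (a c)^n, whose length is different. *)
Lemma retract_power (X : {set S}) a b c n : special G X a -> special G X c ->
  (forall s : artin (induced G X), gact (val : {x | x \in X} -> S) b ((fun v => v) : (S -> R) -> S -> R, s) =
             gact val c (fun v => v, s)) ->
  artin_len b <> artin_len c -> 0 < n -> ~ special G X ((a * b) ^+ n).
Proof.
move=> ha hc hbc len n0 hn; have hi := induced_embedding G X.
have hid := min_rep_id R G (val : {x | x \in X} -> S).
have [a0 ea] := special_induced ha; have [c0 ec] := special_induced hc.
have [d ed] := special_induced hn.
have act k (s : artin (induced G X)) : gact (val : {x | x \in X} -> S) ((a * b) ^+ k)
    ((fun v => v) : (S -> R) -> S -> R, s) = (fun v => v, (a0 * c0) ^+ k * s).
  elim: k => [|k IH]; first by rewrite (gact1 hi) // mul1g.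
  rewrite !expgS (gactM hi) // IH (gactM hi) // hbc -ec (gact_artin_map hi).
  by rewrite -ea (gact_artin_map hi) !mulgA.
have := act n 1; rewrite -ed (gact_artin_map hi) !mulg1 => -[ed'].
have : (a * b) ^+ n = (a * c) ^+ n.
  rewrite -ed ed' -ea -ec -(artin_mapM hi); move: (a0 * c0) => e0; elim: n {n0 hn ed act ed'} => [|n IH].
    by rewrite (artin_map1 hi).
  by rewrite !expgS (artin_mapM hi) IH.
move/(congr1 (@artin_len S G)); rewrite !artin_lenX !artin_lenM.
case: n n0 {hn ed act ed'} => // n _ /eqP.
rewrite eqrMn2r => /eqP/addrI; exact: len.
Qed.

Lemma commute_delta_sqr s t : edge G s t ->
  commute (artin_gen G s) (altp (artin_gen G s) (artin_gen G t) (label G s t) ^+ 2).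
Proof.
move=> st; set D := altp _ _ _; rewrite /commute expg2.
have e1 := gen_delta st; rewrite -/D in e1.
rewrite mulgA e1 -!mulgA; congr (_ * _); case: ifP e1 => om e1 //.
have ts : edge G t s by rewrite edge_sym.
have := gen_delta ts; rewrite -(label_sym st) om -(artin_braid st) -/D => ->.
by [].
Qed.

Lemma not_acylindrical (X Y : {set S}) v w x y g :
  v \in X :&: Y -> w \in X :&: Y -> special G (X :&: Y) g ->
  g * artin_gen G v = artin_gen G w * g ->
  x \in X -> x \notin Y -> edge G v x -> y \in Y -> y \notin X -> edge G w y ->
  ~ acylindrical (bass_serre (special G X) (special G Y) (special G (X :&: Y))).
Proof.
rewrite !inE => /andP[vX vY] /andP[wX wY] hg gv xX xY vx yY yX wy.
have gX := special_mono (subsetIl X Y) hg; have gY := special_mono (subsetIr X Y) hg.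
pose D s t := altp (artin_gen G s) (artin_gen G t) (label G s t).
pose a := D v x ^+ 2; pose b := g^-1 * D w y ^+ 2 * g.
have aX : special G X a by apply: specialX; apply: special_altp; exact: special_gen.
have bY : special G Y b.
  apply: specialM => //; apply: specialM; first exact: specialV.
  by apply: specialX; apply: special_altp; exact: special_gen.
have va : commute (artin_gen G v) a := commute_delta_sqr vx.
have ev : artin_gen G v = g^-1 * artin_gen G w * g by rewrite -mulgA -gv mulKg.
have vb : commute (artin_gen G v) b.
  have conjM (u z : artin G) : g^-1 * u * g * (g^-1 * z * g) = g^-1 * (u * z) * g.
    by rewrite !mulgA mulgK.
  by rewrite /commute ev !conjM (commute_delta_sqr wy).
have lenD s t : artin_len (D s t ^+ 2) = (2 * (label G s t)%:Z)%R.
  by rewrite artin_lenX artin_len_altp mulr_natl.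
have lenb : artin_len b = (2 * (label G w y)%:Z)%R.
  rewrite /b (artin_lenM _ g) (artin_lenM g^-1) artin_lenV lenD; lia.
have lenv : artin_len (artin_gen G v ^+ 2) = 2%R by rewrite artin_lenX artin_len_gen.
have mvx := label_ge2 vx; have mwy := label_ge2 wy.
(* By [gact_delta_sqr], D w y ^+ 2 acts over the base point as w^2; conjugating by g^-1, which lies
   in A_X, turns this into v^2. *)
have retrX (s : artin (induced G X)) : gact (val : {x | x \in X} -> S) b ((fun v => v) : (S -> R) -> S -> R, s) =
    gact val (artin_gen G v ^+ 2) (fun v => v, s).
  have hi := induced_embedding G X.
  have hid := min_rep_id R G (val : {x | x \in X} -> S).
  have [g0 eg] := special_induced gX.
  have vv : artin_gen G v ^+ 2 = g^-1 * artin_gen G w ^+ 2 * g.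
    by rewrite ev !expg2 !mulgA mulgK.
  have key (u : artin G) : (forall s : artin (induced G X),
      gact (val : {x | x \in X} -> S) u ((fun v => v) : (S -> R) -> S -> R, s) =
      (fun v => v, artin_gen (induced G X) (exist _ w wX) ^+ 2 * s)) ->
      gact (val : {x | x \in X} -> S) (g^-1 * u * g) ((fun v => v) : (S -> R) -> S -> R, s) =
      (fun v => v, g0^-1 * (artin_gen (induced G X) (exist _ w wX) ^+ 2 * (g0 * s))).
    move=> hu; rewrite -eg -(artin_mapV hi) (gactM hi) // (gact_artin_map hi).
    by rewrite (gactM hi) // hu (gact_artin_map hi).
  rewrite vv /b !key // => s'; last exact: gact_delta_sqr.
  by rewrite -(gact_artin_map hi) !expg2 (artin_mapM hi) (artin_map_gen hi).
have retrY (s : artin (induced G Y)) : gact (val : {x | x \in Y} -> S) a ((fun v => v) : (S -> R) -> S -> R, s) =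
    gact val (artin_gen G v ^+ 2) (fun v => v, s).
  have hi := induced_embedding G Y.
  have hid := min_rep_id R G (val : {x | x \in Y} -> S).
  rewrite (gact_delta_sqr vY _ xY vx) -(gact_artin_map hi) expg2 (artin_mapM hi).
  by rewrite (artin_map_gen hi) expg2.
have v2X : special G X (artin_gen G v ^+ 2) by apply: specialX; exact: special_gen.
have v2Y : special G Y (artin_gen G v ^+ 2) by apply: specialX; exact: special_gen.
have nX n : 0 < n -> ~ special G X ((a * b) ^+ n).
  apply: (retract_power aX v2X retrX); rewrite lenb lenv; lia.
have nY n : 0 < n -> ~ special G Y ((b * a) ^+ n).
  apply: (retract_power bY v2Y retrY); rewrite lenD lenv; lia.
pose h := a * b.
(* The axis of h runs through h^n A_X, h^n a A_Y, h^(n+1) A_X, and so on. Two equal vertices would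
   put a positive power of a b in A_X or of b a in A_Y. *)
pose p (k : nat) : bs_vertex (special G X) (special G Y) :=
  if odd k then inr (mkcoset _ (h ^+ k./2 * a)) else inl (mkcoset _ (h ^+ k./2)).
have sX := special_subgroup G X; have sY := special_subgroup G Y.
have sZ := special_subgroup G (X :&: Y).
have sub : (special G (X :&: Y) `<=` special G X `&` special G Y)%classic.
  by move=> u hu; split; [exact: (special_mono (subsetIl X Y)) | exact: (special_mono (subsetIr X Y))].
have conjh k : a^-1 * h ^+ k * a = (b * a) ^+ k by exact: conj_expg_mul.
have pinj i j : p i = p j -> i = j.
  wlog ij : i j / i <= j => [hw|].
    by case: (leqP i j) => [/hw//|/ltnW/hw h1 /esym/h1 ->].
  rewrite /p => e; have eo : odd i = odd j by move: e; case: odd; case: odd.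
  rewrite -[i]odd_double_half -[j]odd_double_half eo.
  suff : ~ 0 < j./2 - i./2.
    move=> /negP; rewrite -leqNgt leqn0 subn_eq0 => le.
    by have/eqP -> : i./2 == j./2 by rewrite eqn_leq le half_leq.
  have hji : h ^+ j./2 = h ^+ i./2 * h ^+ (j./2 - i./2).
    by rewrite -expgnDr subnKC // half_leq.
  move=> lt; move: e; rewrite eo; case: odd => -[].
    move/(translate_eq _ _ sY); rewrite invgM -!mulgA (mulgA (h ^+ _)^-1) hji mulKg.
    by rewrite mulgA conjh; exact: nY.
  by move/(translate_eq _ _ sX); rewrite hji mulKg; exact: nX.
have padj k : bs_adj (special G (X :&: Y)) (p k) (p k.+1).
  rewrite /p /= uphalf_half; case: odd => /=; apply/(joinedP sX sY sZ sub).
    exists (h ^+ k./2.+1); split=> //; apply/(mkcoset_eq _ _ sY).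
    have -> : h ^+ k./2.+1 = h ^+ k./2 * a * b by rewrite expgSr mulgA.
    by rewrite mulKg.
  exists (h ^+ k./2 * a); split=> //; apply/(mkcoset_eq _ _ sX).
  by rewrite mulKg.
have vh k : commute (artin_gen G v) (h ^+ k) by apply: commuteX; exact: commuteM.
have fix_p k n : bs_move (artin_gen G v ^+ n) (p k) = p k.
  have cn u : commute (artin_gen G v) u -> u^-1 * artin_gen G v ^+ n * u = artin_gen G v ^+ n.
    by move=> /commute_sym/(commuteX n) cu; rewrite -mulgA -cu mulKg.
  have hv := special_gen (G := G) vX; have hv' := special_gen (G := G) vY.
  rewrite /p; case: odd => /=; congr (_ _); [apply: (iffRL (fix_mkcoset _ _ sY)) |
    apply: (iffRL (fix_mkcoset _ _ sX))]; rewrite cn; try exact: specialX.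
    by apply: commuteM; [exact: vh | exact: va].
  exact: vh.
move=> [k [C [_ hkC]]].
have := hkC k p (leqnn k) (conj (fun i _ => padj i) (fun i j _ _ => pinj i j)).
(* By length, the powers v^0, ..., v^C are C + 1 distinct elements, and all of them fix the path. *)
have inj : {in `I_C.+1 &, injective (fun n => artin_gen G v ^+ n)}%classic.
  move=> i j _ _ /(congr1 (@artin_len S G)).
  by rewrite !artin_lenX artin_len_gen !natz => -[].
move=> hle; have : (`I_C.+1 #<= `I_C)%card.
  rewrite -(card_le_eql (inj_card_eq inj)); apply: card_le_trans hle.
  by apply: subset_card_le => _ [n _ <-] i _; exact: fix_p.
by rewrite card_le_II ltnn.
Qed.

End FixedAxis.

(** * From an odd path to a conjugation in A_Z *)

Section OddPath.
Context (S : finType) (G : lgraph S) (X Y Z : {set S}).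
Hypotheses (hZ : Z = X :&: Y) (hXY : X :|: Y = [set: S]%SET).
Hypothesis hcross : forall x y, x \in X -> x \notin Y -> y \in Y -> y \notin X ->
  ~~ odd_edge G x y.

Let conj_in_Z v s := exists2 g, special G Z g & g * artin_gen G v = artin_gen G s * g.
(** The invariant along an odd path starting on the side of X: either the path is still in X \ Z, or
    it is in Z and the current vertex is conjugate under A_Z to some v with a neighbour in X \ Y. *)
Let reached s := (s \in X) && (s \notin Z) \/
  s \in Z /\ exists v x, [/\ v \in Z, conj_in_Z v s, x \in X, x \notin Y & edge G v x].
Let bridge := exists v w x y, [/\ v \in Z, w \in Z, conj_in_Z v w,
  [/\ x \in X, x \notin Y & edge G v x] & [/\ y \in Y, y \notin X & edge G w y]].

(** A step entering Z restarts with v the vertex entered; a step inside Z multiplies the conjugator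
    by an inverse Garside element, which carries s to s' since the label is odd. A step from Z into
    Y \ X completes the bridge, and one from X \ Z into Y \ X is excluded by [hcross]. *)
Lemma reached_step s s' : odd_edge G s s' -> reached s -> bridge \/ reached s'.
Proof.
have inXY u : (u \in X) || (u \in Y) by rewrite -finset.in_setU hXY inE.
move=> ss [/andP[sX sZ]|[sZ [v [x [vZ [g hg eg] xX xY vx]]]]].
  have sY : s \notin Y by move: sZ; rewrite hZ inE sX.
  have s'X : s' \in X.
    apply/negPn/negP => s'X; have s'Y : s' \in Y by have := inXY s'; rewrite (negPf s'X).
    by move/negP: (hcross sX sY s'Y s'X).
  case: (boolP (s' \in Z)) => s'Z; right; last by left; rewrite s'X.
  right; split=> //; exists s', s; split=> //; last by rewrite edge_sym; case/andP: ss.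
  by exists 1; rewrite ?mul1g ?mulg1 //; exact: special1.
case: (boolP (s' \in Z)) => s'Z.
  right; right; split=> //; exists v, x; split=> //.
  have [se so] := andP ss.
  have eD := gen_delta se; rewrite so in eD; move: eD.
  set D := altp _ _ _ => eD; exists (D^-1 * g).
    apply: specialM => //; apply: specialV.
    by apply: special_altp; exact: special_gen.
  by rewrite -mulgA eg !mulgA; congr (_ * _); apply: (mulgI D); rewrite !mulgA -eD mulgK mulgV mul1g.
case: (boolP (s' \in X)) => s'X; first by right; left; rewrite s'X.
left; exists v, s, x, s'; split=> //; first by exists g.
split=> //; last by case/andP: ss.
by have := inXY s'; rewrite (negPf s'X).
Qed.

Lemma odd_connected_bridge :
  odd_connected G (induced_nbhd G X (X :\: Z)) (induced_nbhd G Y (Y :\: Z)) -> bridge.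
Proof.
have nb (W : {set S}) u : u \in induced_nbhd G W (W :\: Z) ->
    u \in W /\ (u \notin Z \/ exists x, [/\ x \in W, x \notin Z & edge G u x]).
  move=> /imsetP[a]; rewrite inE => /existsP[b /andP[hb hab]] ->.
  split; first exact: (valP a).
  move: hb; rewrite !inE => /andP[bZ bW].
  case/orP: hab => [/eqP->|ba]; [by left | right].
  by exists (val b); split=> //; rewrite edge_sym.
move=> [u [v [/nb[uX hu] /nb[vY hv] /connectP[p hp ev]]]].
have start : reached u.
  case: (boolP (u \in Z)) => uZ; last by left; rewrite uX.
  case: hu => [|[x [xX xZ ux]]]; first by rewrite uZ.
  right; split=> //; exists u, x; split=> //.
    by exists 1; rewrite ?mul1g ?mulg1 //; exact: special1.
  by move: xZ; rewrite hZ inE xX.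
have : bridge \/ reached v.
  rewrite ev; elim: p u {uX hu ev} hp start => [|s p IH] u /=; first by right.
  by move=> /andP[us hp] /(reached_step us)[|/(IH _ hp)]; [left|].
case=> // -[/andP[vX vZ]|[vZ [z [x [zZ hc xX xY zx]]]]].
  by exfalso; move: vZ; rewrite hZ inE vX vY.
case: hv => [|[y [yY yZ vy]]]; first by rewrite vZ.
exists z, v, x, y; split=> //; split=> //.
by move: yZ; rewrite hZ inE yY andbT.
Qed.

End OddPath.

Lemma special_neqT_exists (S : finType) (G : lgraph S) (X Y : {set S}) :
  X :|: Y = [set: S]%SET -> special G Y <> setT ->
  exists x, x \in X /\ x \notin Y.
Proof.
move=> hXY nY; apply: contrapT => hn; apply: nY; apply/seteqP; split=> // g _.
have -> : Y = [set: S]%SET; last exact: specialT.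
apply/setP => s; rewrite inE; apply/negPn/negP => sY; apply: hn; exists s; split=> //.
by have := finset.in_setU s X Y; rewrite hXY inE (negPf sY) orbF => <-.
Qed.

Theorem theorem1p4 (S : finType) (G : lgraph S) (X Y Z : {set S})
  (hZ : Z = X :&: Y)
  (hsplit : nontrivial_visual_splitting G X Y)
  (X' : finType) (GX' : lgraph X')
  (hX' : contained_as_special G X GX')
  (hX'pip : PIP GX') (hX'rp : RP GX')
  (Y' : finType) (GY' : lgraph Y')
  (hY' : contained_as_special G Y GY')
  (hY'pip : PIP GY') (hY'rp : RP GY') :
  non_elementary_acylindrical_splitting
    (special G X) (special G Y) (special G Z)
  <->
  ~ odd_connected G (induced_nbhd G X (X :\: Z)) (induced_nbhd G Y (Y :\: Z)).
Proof.
have [[hXY hA] nX nY] := hsplit; rewrite -hZ in hA.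
have [sX sY sZ ZXY _] := hA.
split=> [[acyl _ _] hodd|nodd].
  have cross x y : x \in X -> x \notin Y -> y \in Y -> y \notin X -> ~~ odd_edge G x y.
    by rewrite hZ in hA; exact: cross_edge_even.
  have [v [w [x [y [vZ wZ [g gZ eg] [xX xY vx] [yY yX wy]]]]]] :=
    odd_connected_bridge hZ hXY cross hodd.
  by rewrite hZ in vZ wZ gZ acyl; exact: (not_acylindrical vZ wZ gZ eg xX xY vx yY yX wy acyl).
have ZX : Z \subset X by rewrite hZ subsetIl.
have ZY : Z \subset Y by rewrite hZ subsetIr.
have [x [xX xY]] := special_neqT_exists hXY nY.
split.
- apply: (bass_serre_acylindrical sX sY sZ ZXY).
    by move=> u; rewrite hZ; exact: special_inter.
  move=> b c q bX bZ cY cZ qZ qb qc.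
  exact: (edge_fixer_trivial ZX ZY hX' hX'pip hX'rp hY' hY'pip hY'rp nodd bX bZ cY cZ qZ qb qc).
- exact: no_fixpoint.
- apply: (no_invariant_line hA (special_gen xX)); first exact: not_special_gen.
  exact: not_special_gen_sqr.
Qed.
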